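(* Let $d\ge 1$, $T>0$, $\lambda\in(0,2)$, let $f:\mathbb{R}\to\mathbb{R}^d$ and $A:\mathbb{R}\to\mathbb{R}$ be Lipschitz continuous, with $A$ non-decreasing and $A(0)=0$. Let $u$ and $v$ be two entropy solutions, with initial data $u_0$ and $v_0$ respectively, of the initial value problem $$\partial_t u+\nabla\cdot f(u)=-(-\Delta)^{\lambda/2}A(u)\ \text{ in } Q_T=\mathbb{R}^d\times(0,T),\qquad u(\cdot,0)=u_0 \text{ in }\mathbb{R}^d .$$ Then, for all $t\in(0,T)$, $$\|u(\cdot,t)-v(\cdot,t)\|_{L^1(\mathbb{R}^d)}\le \|u_0-v_0\|_{L^1(\mathbb{R}^d)}.$$
   Context: Fix a constant $c_\lambda>0$. The operator $-(-\Delta)^{\lambda/2}$, also written $g$, is $g[\phi](x)=c_\lambda\,\mathrm{P.V.}\int_{|z|>0}\frac{\phi(x+z)-\phi(x)}{|z|^{d+\lambda}}\,dz$ (acting in the space variable), where $\mathrm{P.V.}\int_{|z|>0}=\lim_{b\to0^+}\int_{|z|>b}$. For $r>0$ write $g=g_r+g^r$ with $$g_r[\varphi](x)=c_\lambda\,\mathrm{P.V.}\int_{|z|<r}\frac{\varphi(x+z)-\varphi(x)}{|z|^{d+\lambda}}\,dz,\qquad g^r[\varphi](x)=c_\lambda\int_{|z|>r}\frac{\varphi(x+z)-\varphi(x)}{|z|^{d+\lambda}}\,dz.$$ For $k\in\mathbb{R}$: $\eta_k(u)=|u-k|$, $\eta_k'(u)=\mathrm{sgn}(u-k)$ with $\mathrm{sgn}(0)=0$,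 $q_k(u)=\eta_k'(u)(f(u)-f(k))$. Entropy solution: a function $u$ is an entropy solution with initial datum $u_0$ if (i) $u\in L^\infty(Q_T)\cap C([0,T];L^1(\mathbb{R}^d))$; (ii) for all $k\in\mathbb{R}$, all $r>0$ and all nonnegative $\varphi\in C_c^\infty(Q_T)$, $$\iint_{Q_T}\eta_k(u)\,\partial_t\varphi+q_k(u)\cdot\nabla\varphi+\eta_{A(k)}(A(u))\,g_r[\varphi]+\eta_k'(u)\,g^r[A(u)]\,\varphi\;dx\,dt\ge0;$$ (iii) $u(\cdot,0)=u_0$ a.e. *)

(* Defs.v *)
From HB Require Import structures.
From mathcomp Require Import all_boot all_order all_algebra.
From mathcomp Require Import all_classical all_reals all_analysis.

Set Implicit Arguments.
Unset Strict Implicit.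
Unset Printing Implicit Defensive.

Import Order.TTheory GRing.Theory Num.Theory.
Import numFieldNormedType.Exports.

Local Open Scope classical_set_scope.
Local Open Scope ring_scope.

(* R^d is 'rV[R]_d.  As for the library's tuples, its sigma-algebra is the one
   generated by the coordinates, i.e. the Borel sets; the Lebesgue measure below
   is the Lebesgue measure on Borel sets, as in the library for d = 1. *)
Definition measure_rV_display : measure_display.
Proof. exact: default_measure_display. Qed.

Section measurable_rV.
Context (R : realType) (d : nat).

Definition rV_coord (i : 'I_d) (x : 'rV[R]_d) : R := x ord0 i.

Let rV_set0 : g_sigma_preimage rV_coord set0.
Proof. exact: sigma_algebra0. Qed.

Let rV_setC A : g_sigma_preimage rV_coord A -> g_sigma_preimage rV_coord (~` A).
Proof. exact: sigma_algebraC. Qed.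

Let rV_bigcup (F : (set 'rV[R]_d)^nat) :
  (forall i, g_sigma_preimage rV_coord (F i)) ->
  g_sigma_preimage rV_coord (\bigcup_i (F i)).
Proof. exact: sigma_algebra_bigcup. Qed.

HB.instance Definition _ := @isMeasurable.Build measure_rV_display
  'rV[R]_d (g_sigma_preimage rV_coord) rV_set0 rV_setC rV_bigcup.

End measurable_rV.

Section lebesgue_rV.
Context (R : realType).

Lemma measurable_rV_coord d (i : 'I_d) :
  measurable_fun [set: 'rV[R]_d] (fun x => x ord0 i).
Proof.
move=> _ Y mY; rewrite setTI; apply: sub_sigma_algebra => /=.
rewrite -bigcup_seq/=; exists i => /=; first by rewrite mem_index_enum.
by exists Y => //; rewrite setTI.
Qed.

Lemma measurable_fun_rVP d d1 (T1 : measurableType d1) (f : T1 -> 'rV[R]_d) :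
  (forall i, measurable_fun [set: T1] (fun y => f y ord0 i)) ->
  measurable_fun [set: T1] f.
Proof.
move=> mf; have : g_sigma_preimage (fun i => @rV_coord R d i \o f)
    `<=` measurable.
  apply: smallest_sub; first exact: sigma_algebra_measurable.
  case: d => [|n] in f mf *; first by rewrite big_ord0.
  rewrite -bigcup_mkord_ord; apply: bigcup_sub => i Ii.
  by move=> A [B mB <-]; exact: mf.
rewrite g_sigma_preimage_comp => prefS _ A mA.
by apply: prefS; exists A.
Qed.

Definition rV_cons d (p : R * 'rV[R]_d) : 'rV[R]_d.+1 :=
  \row_i oapp (p.2 ord0) p.1 (unlift ord0 i).

Definition rV_uncons d (x : 'rV[R]_d.+1) : R * 'rV[R]_d :=
  (x ord0 ord0, \row_i x ord0 (lift ord0 i)).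

Lemma rV_consK d : cancel (@rV_cons d) (@rV_uncons d).
Proof.
move=> [a x]; rewrite /rV_uncons mxE unlift_none/=; congr pair.
by apply/rowP => i; rewrite !mxE liftK.
Qed.

Lemma measurable_rV_cons d : measurable_fun [set: R * 'rV[R]_d] (@rV_cons d).
Proof.
apply: measurable_fun_rVP => i; under eq_fun do rewrite mxE.
case: unliftP => [j _|_] /=; last exact: measurable_fst.
exact: (measurableT_comp (measurable_rV_coord j) measurable_snd).
Qed.

Lemma measurable_rV_uncons d :
  measurable_fun [set: 'rV[R]_d.+1] (@rV_uncons d).
Proof.
apply/measurable_fun_pairP; split => /=; first exact: measurable_rV_coord.
apply: measurable_fun_rVP => i /=.
under eq_fun do rewrite mxE.
exact: measurable_rV_coord.
Qed.

Section step.
Context (d : nat) (mu : {sigma_finite_measure set 'rV[R]_d -> \bar R}).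
Definition lebesgue_rV_step : set 'rV[R]_d.+1 -> \bar R :=
  pushforward (@lebesgue_measure R \x mu)%E (@rV_cons d).

Let step0 : lebesgue_rV_step set0 = 0%E.
Proof. by rewrite /lebesgue_rV_step /pushforward preimage_set0 measure0. Qed.

Let step_ge0 A : (0 <= lebesgue_rV_step A)%E.
Proof. by rewrite /lebesgue_rV_step /pushforward measure_ge0. Qed.

Let step_sigma_additive : semi_sigma_additive lebesgue_rV_step.
Proof.
move=> F mF tF mUF; rewrite /lebesgue_rV_step /pushforward preimage_bigcup.
have mc A : measurable A -> measurable (@rV_cons d @^-1` A).
  by move=> mA; rewrite -[X in measurable X]setTI; exact: measurable_rV_cons.
apply: measure_semi_sigma_additive.
- by move=> n; exact: mc.
- apply/trivIsetP => /= i j _ _ ij; rewrite -preimage_setI.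
  by move/trivIsetP : tF => /(_ _ _ _ _ ij) ->//; rewrite preimage_set0.
- by rewrite -preimage_bigcup; exact: mc.
Qed.

HB.instance Definition _ := isMeasure.Build _ _ _ lebesgue_rV_step
  step0 step_ge0 step_sigma_additive.

Let sigma_finite_step : sigma_finite setT lebesgue_rV_step.
Proof.
have /sigma_finiteP[F [TF ndF Foo]] := sigma_finiteT (@lebesgue_measure R).
have /sigma_finiteP[G [TG ndG Goo]] := sigma_finiteT mu.
exists (fun n => @rV_uncons d @^-1` (F n `*` G n)) => [|n].
  rewrite -preimage_bigcup (_ : \bigcup_n _ = setT) ?preimage_setT//.
  rewrite -setXTT TF TG predeqE => -[x y]; split.
    by move=> [n _ []/= ? ?]; split; exists n.
  move=> [/= [n _ Fnx] [k _ Gky]]; exists (maxn n k) => //; split.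
  - by move: x Fnx; exact/subsetPset/ndF/leq_maxl.
  - by move: y Gky; exact/subsetPset/ndG/leq_maxr.
have [mF ?] := Foo n; have [mG ?] := Goo n; split.
  rewrite -[X in measurable X]setTI; apply: measurable_rV_uncons => //.
  exact: measurableX.
rewrite /lebesgue_rV_step /pushforward -comp_preimage.
rewrite (_ : @rV_uncons d \o @rV_cons d = id); last first.
  by apply/funext => p /=; rewrite rV_consK.
by rewrite preimage_id product_measure1E// lte_mul_pinfty// ge0_fin_numE.
Qed.

HB.instance Definition _ := @Measure_isSigmaFinite.Build _ _ _
  lebesgue_rV_step sigma_finite_step.
End step.

Fixpoint lebesgue_rV d : {sigma_finite_measure set 'rV[R]_d -> \bar R} :=
  if d is d'.+1 then lebesgue_rV_step (lebesgue_rV d') else \d_(0 : 'rV[R]_0).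

(* Together with sigma-finiteness this determines lebesgue_rV d. *)
Lemma lebesgue_rV_box d (B : 'I_d -> set R) :
  (forall i, measurable (B i)) ->
  lebesgue_rV d [set x : 'rV[R]_d | forall i, B i (x ord0 i)] =
  (\prod_(i < d) lebesgue_measure (B i))%E.
Proof.
elim: d B => [|d IH] B mB.
  rewrite big_ord0 /= diracE mem_set//=; by case.
have -> : lebesgue_rV d.+1 [set x : 'rV[R]_d.+1 | forall i, B i (x ord0 i)] =
    (@lebesgue_measure R \x lebesgue_rV d)%E
      (B ord0 `*` [set x : 'rV[R]_d | forall i, B (lift ord0 i) (x ord0 i)]).
  rewrite /= /lebesgue_rV_step /pushforward; congr (_ _).
  apply/seteqP; split => [[a x]/= H|[a x]/= [H0 H] i].
    split => [|i]; first by have := H ord0; rewrite mxE unlift_none.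
    by have := H (lift ord0 i); rewrite mxE liftK.
  by rewrite mxE; case: unliftP => [j ->|->]/=.
rewrite product_measure1E; [|exact: mB|].
  by rewrite big_ord_recl (IH (fun i => B (lift ord0 i))).
rewrite [X in measurable X](_ : _ = \bigcap_(i in [set: 'I_d])
    ((fun x : 'rV[R]_d => x ord0 i) @^-1` B (lift ord0 i))).
  apply: fin_bigcap_measurable => // i _.
  by rewrite -[X in measurable X]setTI; exact: measurable_rV_coord.
by apply/seteqP; split => [x H i _|x H i]; [exact: H|exact: (H i I)].
Qed.

End lebesgue_rV.

Section setting.
Context (R : realType) (d : nat).
Local Notation Rd := 'rV[R]_d.
Implicit Types (T lambda c k r t : R) (x z : Rd).

Definition dotv (x y : Rd) : R := \sum_(i < d) x ord0 i * y ord0 i.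

(* The library norm on row vectors is the sup norm. *)
Definition enorm (x : Rd) : R := Num.sqrt (dotv x x).

Definition QT T : set (Rd * R) := [set p | 0 < p.2 < T].

Local Notation leb := (lebesgue_rV R d).
Local Notation leb1 := (leb \x @lebesgue_measure R)%E.

(* The part over D of the integral defining -(-Delta)^(lambda/2). *)
Definition levy_integral lambda c (D : set Rd) (phi : Rd -> R) x : R :=
  c * \int[leb]_(z in D)
        ((phi (x + z) - phi x) / enorm z `^ (d%:R + lambda)).

(* The principal value: the integral over |z| < r is the limit of the integrals
   over b < |z| < r as b decreases to 0. *)
Definition g_small lambda c r (phi : Rd -> R) x : R :=
  lim (levy_integral lambda c [set z | b < enorm z < r] phi x @[b --> 0^'+]).

Definition g_large lambda c r (phi : Rd -> R) x : R :=
  levy_integral lambda c [set z | r < enorm z] phi x.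

Definition eta k (w : R) : R := `|w - k|.
Definition eta' k (w : R) : R := Num.sg (w - k).
Definition entropy_flux (f : R -> Rd) k (w : R) : Rd := eta' k w *: (f w - f k).

(* Class C^n in (x, t): being C^(n+1) is being Frechet differentiable with a
   differential of class C^n, that is, with p |-> 'D_v phi p of class C^n for
   every vector v. *)
Fixpoint Ck (n : nat) (phi : Rd * R -> R) : Prop :=
  if n is n'.+1 then
    (forall p, differentiable phi p) /\ (forall v, Ck n' ('D_v phi))
  else continuous phi.

(* Elements of C_c^oo(Q_T), extended by 0 to R^d x R. *)
Definition test_function T (phi : Rd * R -> R) : Prop :=
  [/\ forall n, Ck n phi,
      compact (closure [set p | phi p != 0]) &
      closure [set p | phi p != 0] `<=` QT T].

Definition dt (phi : Rd * R -> R) x t : R :=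
  'D_((0, 1) : Rd * R) phi (x, t).

Definition grad (phi : Rd * R -> R) x t : Rd :=
  \row_i 'D_((delta_mx ord0 i, 0) : Rd * R) phi (x, t).

Definition entropy_density lambda c (f : R -> Rd) (A : R -> R)
    (u : Rd -> R -> R) k r (phi : Rd * R -> R) x t : R :=
  eta k (u x t) * dt phi x t
  + dotv (entropy_flux f k (u x t)) (grad phi x t)
  + eta (A k) (A (u x t)) * g_small lambda c r (fun y => phi (y, t)) x
  + eta' k (u x t) * g_large lambda c r (fun y => A (u y t)) x * phi (x, t).

(* u x t is only meaningful for 0 <= t <= T; the values elsewhere are not
   constrained.  u is a Borel representative: L^oo(Q_T) asks that its extension
   by 0 be jointly measurable and essentially bounded, and C([0, T]; L^1) that
   each slice be integrable and depend continuously on t in the L^1 norm.  Every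
   element of the intersection of these spaces has such a representative, with
   the slice at each t in the given L^1 class. *)
Record entropy_solution T lambda c (f : R -> Rd) (A : R -> R)
    (u0 : Rd -> R) (u : Rd -> R -> R) : Prop := EntropySolution {
  es_Linfty : ((fun p => u p.1 p.2) \_ (QT T)) \in Lfun leb1 +oo%E ;
  es_L1 : forall t, 0 <= t <= T -> u ^~ t \in Lfun leb 1%E ;
  es_cont : forall t, 0 <= t <= T ->
    'N[leb]_1[EFin \o (u ^~ s \- u ^~ t)%R]%E
      @[s --> within `[0, T] (nbhs t)] --> 0%E ;
  es_entropy : forall k r (phi : Rd * R -> R), 0 < r ->
    test_function T phi -> (forall p, 0 <= phi p) ->
    (0 <= \int[leb1]_(p in QT T)
      (entropy_density lambda c f A u k r phi p.1 p.2)%:E)%E ;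
  es_init : \forall x \ae leb, u x 0 = u0 x
}.

End setting.

(* Main.v *)
(** Kruzkov's doubling of variables.  The entropy inequality for u at (x, t)
    with k = v (y, s) and the one for v at (y, s) with k = u (x, t) are
    integrated against b(x - y) b(t - s) theta(t), with b a bump near 0.  The
    derivatives of b cancel between the two inequalities.  The terms with g_r
    vanish as r tends to 0.  Since A is monotone, the difference of the terms
    with g^r is at most the average over z of the increment of |A(u) - A(v)|
    between (x, y) and (x + z, y + z); a common translation preserves both
    b(x - y) and Lebesgue measure, so this average integrates to 0.  What is
    left is 0 <= iint |u - v| b(x - y) b(t - s) theta'(t), where theta'(t) is
    b(t - t1) - b(t - t2).  As the support of b shrinks, continuity of
    translations in L^1 and continuity in time give the contraction from t1 to
    t2, and then t1 tends to 0. *)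

Require Import Defs.
From HB Require Import structures.
From mathcomp Require Import all_boot all_order all_algebra.
From mathcomp Require Import all_classical all_reals all_analysis.
From mathcomp Require Import measurable_realfun ring lra.

Set Implicit Arguments.
Unset Strict Implicit.
Unset Printing Implicit Defensive.

Import Order.TTheory GRing.Theory Num.Theory.
Import numFieldNormedType.Exports.

Local Open Scope classical_set_scope.
Local Open Scope ring_scope.

(** The order of limits shapes the proof. The radius del of b is kept while r tends to 0, so in the
    near terms only a factor of order r^(2 - lambda) depends on r: it comes from second differences
    of the test function, and no regularity of u or v is asked. At each fixed r the far kernel is
    integrable, so the far terms are absolutely convergent integrals to which Fubini and translation
    invariance apply. Taking theta at t alone, and not at the mean of t and s, leaves a single
    surviving derivative; the price is that the second inequality sees times up to 2 del away from
    the interval from t1 to t2. Solutions are extended by 0 to all of space-time, so that points can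
    be shifted freely. The principal value is a [lim] whose existence and measurability are never
    discussed: it is bounded whether or not it converges, and integrals are compared pointwise. The
    bump b is not normalised: its mass is a common factor of the final upper and lower bounds. *)

Section measure_preserving.
Context (R : realType).
Local Open Scope ereal_scope.

(** Every change of variables goes through this notion. It is stable under composition and products,
    so the reflections, translations and shears of space-time and of its double are assembled from
    maps of the real line. *)
Definition preserving d1 d2 (T1 : measurableType d1) (T2 : measurableType d2)
    (mu : set T1 -> \bar R) (nu : set T2 -> \bar R) (f : T1 -> T2) :=
  measurable_fun setT f /\ forall A, measurable A -> mu (f @^-1` A) = nu A.

Lemma preserving_comp d1 d2 d3 (T1 : measurableType d1)
    (T2 : measurableType d2) (T3 : measurableType d3)
    (m1 : set T1 -> \bar R) (m2 : set T2 -> \bar R) (m3 : set T3 -> \bar R)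
    (f : T1 -> T2) (g : T2 -> T3) :
  preserving m1 m2 f -> preserving m2 m3 g -> preserving m1 m3 (g \o f).
Proof.
move=> [mf pf] [mg pg]; split; first exact: measurableT_comp.
move=> A mA; rewrite comp_preimage pf ?pg//.
by rewrite -[X in measurable X]setTI; exact: mg.
Qed.

Section integral.
Context d1 d2 (T1 : measurableType d1) (T2 : measurableType d2).
Context (mu : {measure set T1 -> \bar R}) (nu : {measure set T2 -> \bar R}).
Context (phi : T1 -> T2) (pphi : preserving mu nu phi).

Let eq_pushforward (f : T2 -> \bar R) :
  \int[nu]_y f y = \int[pushforward mu phi]_y f y.
Proof.
apply: eq_measure_integral; first exact: pphi.1.
by move=> mphi A mA _; rewrite -(pphi.2 A mA).
Qed.

Lemma ge0_integral_preserving (f : T2 -> \bar R) : measurable_fun setT f ->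
  (forall y, 0 <= f y) -> \int[mu]_x f (phi x) = \int[nu]_y f y.
Proof.
move=> mf f0; rewrite eq_pushforward ge0_integral_pushforward//.
exact: pphi.1.
Qed.

Lemma integrable_preserving (f : T2 -> \bar R) :
  nu.-integrable setT f -> mu.-integrable setT (f \o phi).
Proof.
move=> /integrableP[mf foo]; apply/integrableP; split.
  by apply: measurableT_comp => //; exact: pphi.1.
rewrite (ge0_integral_preserving (f := fun y => `|f y|))//.
exact: measurableT_comp.
Qed.

Lemma integral_preserving (f : T2 -> \bar R) : nu.-integrable setT f ->
  \int[mu]_x f (phi x) = \int[nu]_y f y.
Proof.
move=> fi; rewrite eq_pushforward integral_pushforward//.
- exact: pphi.1.
- exact: (measurable_int _ fi).
- exact: integrable_preserving.
Qed.

End integral.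

(** The section at x of the preimage of A is the preimage under g(x, .) of a section of A, so its
    measure is known; integrating in x uses the invariance under f. Besides products, this covers
    the shear (X, W) to (X, W + X). *)
Lemma preserving_skew d1 d2 d3 d4 (T1 : measurableType d1)
    (T2 : measurableType d2) (S1 : measurableType d3) (S2 : measurableType d4)
    (m1 : {measure set T1 -> \bar R})
    (m2 : {sigma_finite_measure set T2 -> \bar R})
    (n1 : {measure set S1 -> \bar R})
    (n2 : {sigma_finite_measure set S2 -> \bar R})
    (f : T1 -> S1) (g : T1 * T2 -> S2) :
  preserving m1 n1 f -> measurable_fun setT g ->
  (forall x, preserving m2 n2 (fun y => g (x, y))) ->
  preserving (m1 \x m2) (n1 \x n2) (fun p => (f p.1, g p)).
Proof.
move=> pf mg pg; have mF : measurable_fun setT (fun p => (f p.1, g p)).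
  apply/measurable_fun_pairP; split => //=.
  exact: (measurableT_comp pf.1 measurable_fst).
split => // A mA; rewrite /product_measure1.
under eq_integral => x _.
  rewrite /= (_ : xsection _ _ = (fun y => g (x, y)) @^-1` xsection A (f x)).
    by rewrite (pg x).2; [over|exact: measurable_xsection].
  by apply/seteqP; split => y; rewrite /xsection/= ?inE/= ?inE.
rewrite (ge0_integral_preserving pf (f := fun x => n2 (xsection A x)))//.
exact: measurable_fun_xsection.
Qed.

Lemma preserving_id d1 (T1 : measurableType d1) (m1 : set T1 -> \bar R) :
  preserving m1 m1 id.
Proof. by split; first exact: measurable_id. Qed.

Lemma preserving_prod d1 d2 d3 d4 (T1 : measurableType d1)
    (T2 : measurableType d2) (S1 : measurableType d3) (S2 : measurableType d4)
    (m1 : {measure set T1 -> \bar R})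
    (m2 : {sigma_finite_measure set T2 -> \bar R})
    (n1 : {measure set S1 -> \bar R})
    (n2 : {sigma_finite_measure set S2 -> \bar R})
    (f : T1 -> S1) (g : T2 -> S2) :
  preserving m1 n1 f -> preserving m2 n2 g ->
  preserving (m1 \x m2) (n1 \x n2) (fun p => (f p.1, g p.2)).
Proof.
move=> pf [mg pg]; apply: (preserving_skew (g := g \o snd)) => //.
exact: measurableT_comp.
Qed.

End measure_preserving.

(** * Reflections and translations of R^d preserve Lebesgue measure *)

Section lebesgue_invariance.
Context (R : realType).
Local Open Scope ereal_scope.

Lemma preserving_lebesgueN :
  preserving (@lebesgue_measure R) lebesgue_measure (-%R).
Proof.
by split=> [|A mA]; [exact: oppr_measurable|exact: lebesgue_measureN].
Qed.

(** Lebesgue measure is determined by its values on half-open intervals, and a translation keeps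
    their lengths. *)
Lemma preserving_lebesgueD (a : R) :
  preserving (@lebesgue_measure R) lebesgue_measure (fun x : R => x + a)%R.
Proof.
have mD : measurable_fun setT (fun x : R => x + a : measurableTypeR R)%R.
  by apply: measurable_funD.
split => // A mA.
pose mmu := @pushforward _ _ (measurableTypeR R) (measurableTypeR R) R
  (@lebesgue_measure R) (fun x : measurableTypeR R => x + a)%R.
symmetry; apply: (lebesgue_measure_unique (mu := mmu)) => //.
move=> _ [[x y]] _ <-.
rewrite -[RHS]/(lebesgue_measure ((fun z : R => z + a)%R @^-1` `]x, y]%classic)).
have -> : (fun z : R => z + a)%R @^-1` `]x, y]%classic =
    `](x - a)%R, (y - a)%R]%classic.
  by apply/seteqP; split => z; rewrite /= !in_itv/= ltrBlDr lerBrDr.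
rewrite !lebesgue_measure_itv/= !lte_fin ltrD2r.
by rewrite -!EFinB opprD opprK addrACA addNr addr0.
Qed.

Lemma preserving_rV_cons d :
  preserving (@lebesgue_measure R \x lebesgue_rV R d) (lebesgue_rV R d.+1)
    (@rV_cons R d).
Proof. by split => //; exact: measurable_rV_cons. Qed.

Lemma rV_unconsK d : cancel (@rV_uncons R d) (@rV_cons R d).
Proof.
move=> x; apply/rowP => i; rewrite mxE.
by case: unliftP => [j ->|->] //=; rewrite mxE.
Qed.

Lemma preserving_rV_uncons d :
  preserving (lebesgue_rV R d.+1) (@lebesgue_measure R \x lebesgue_rV R d)
    (@rV_uncons R d).
Proof.
split; first exact: measurable_rV_uncons.
move=> A mA; have mA' : measurable (@rV_uncons R d @^-1` A).
  by rewrite -[X in measurable X]setTI; exact: measurable_rV_uncons.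
rewrite -[LHS]((preserving_rV_cons d).2 _ mA'); congr (_ _).
by apply/seteqP; split => p /=; rewrite rV_consK.
Qed.

Lemma preserving_rVN d : preserving (lebesgue_rV R d) (lebesgue_rV R d) (-%R).
Proof.
elim: d => [|d IH].
  rewrite (_ : -%R = id); first exact: preserving_id.
  by apply/funext => x; apply/rowP; case.
rewrite (_ : -%R = @rV_cons R d \o (fun p => (- p.1, - p.2)%R) \o @rV_uncons R d).
  apply: preserving_comp (preserving_rV_uncons d) _.
  apply: preserving_comp (preserving_rV_cons d).
  exact: preserving_prod preserving_lebesgueN IH.
apply/funext => x; apply/rowP => i; rewrite !mxE.
by case: unliftP => [j ->|->] //=; rewrite !mxE.
Qed.

Lemma preserving_rVD d (a : 'rV[R]_d) :
  preserving (lebesgue_rV R d) (lebesgue_rV R d) (fun x : 'rV[R]_d => x + a)%R.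
Proof.
elim: d => [|d IH] in a *.
  rewrite (_ : (fun x => _) = id); first exact: preserving_id.
  by apply/funext => x; apply/rowP; case.
pose b := rV_uncons a.
rewrite (_ : (fun x => _) = @rV_cons R d \o (fun p => (p.1 + b.1, p.2 + b.2)%R)
   \o @rV_uncons R d).
  apply: preserving_comp (preserving_rV_uncons d) _.
  apply: preserving_comp (preserving_rV_cons d).
  exact: preserving_prod (preserving_lebesgueD _) (IH _).
apply/funext => x; apply/rowP => i; rewrite !mxE.
by case: unliftP => [j ->|->] //=; rewrite !mxE.
Qed.

End lebesgue_invariance.

(** * Monotonicity and L^1 distances of integrals *)

Section integral_facts.
Context d (T : measurableType d) (R : realType).
Context (mu : {measure set T -> \bar R}).
Local Open Scope ereal_scope.

(** The integral of a nonnegative function is a supremum over the simple functions below it, so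
    monotonicity holds without measurability. This is what allows integrands containing [g_small],
    whose measurability is never established. *)
Lemma ge0_le_integral_pointwise (f g : T -> \bar R) :
  (forall x, 0 <= f x) -> (forall x, f x <= g x) ->
  \int[mu]_x f x <= \int[mu]_x g x.
Proof.
move=> f0 fg; have g0 x : 0 <= g x by exact: le_trans (fg x).
rewrite (ge0_integralTE _ f0) (ge0_integralTE _ g0).
apply: ge_ereal_sup => _ [h /= hf <-]; apply: ereal_sup_ubound => /=.
by exists h => // x; exact: le_trans (fg x).
Qed.

Lemma le_integral_pointwise (f g : T -> \bar R) :
  (forall x, f x <= g x) -> \int[mu]_x f x <= \int[mu]_x g x.
Proof.
move=> fg; rewrite (integralE mu setT f) (integralE mu setT g); apply: leeB.
  by apply: ge0_le_integral_pointwise => // x; exact: (@funepos_le _ _ setT f g (fun y _ => fg y) x (in_setT x)).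
by apply: ge0_le_integral_pointwise => // x; exact: (@funeneg_le _ _ setT f g (fun y _ => fg y) x (in_setT x)).
Qed.

Lemma cvge0P (a : nat -> \bar R) : (forall n, 0 <= a n) ->
  a @ \oo --> 0 <-> forall e : R, (0 < e)%R -> \forall n \near \oo, a n <= e%:E.
Proof.
move=> a0; split=> [/fine_cvgP[afin a_0] e e0|H].
  move/cvgrPdist_le : a_0 => /(_ _ e0).
  apply: filterS2 afin => n an /=; rewrite sub0r normrN ger0_norm ?fine_ge0//.
  by rewrite -lee_fin fineK.
apply/fine_cvgP; split.
  apply: filterS (H 1%R ltr01) => n an.
  by rewrite ge0_fin_numE// (le_lt_trans an)// ltry.
apply/cvgrPdist_le => e e0; apply: filterS (H e e0) => n an.
rewrite /= sub0r normrN ger0_norm ?fine_ge0// -lee_fin fineK//.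
by rewrite ge0_fin_numE// (le_lt_trans an)// ltry.
Qed.

Lemma integrable_measurable (f : T -> R) :
  mu.-integrable setT (EFin \o f) -> measurable_fun setT f.
Proof. by move=> fi; apply/measurable_EFinP; exact: measurable_int fi. Qed.

Lemma ge0_integrable (f : T -> \bar R) : measurable_fun setT f ->
  (forall x, 0 <= f x) -> \int[mu]_x f x < +oo -> mu.-integrable setT f.
Proof.
move=> mf f0 foo; apply/integrableP; split => //.
by under eq_integral => x _ do rewrite gee0_abs//.
Qed.

Lemma measurable_normB (f g : T -> R) : measurable_fun setT f ->
  measurable_fun setT g -> measurable_fun setT (fun x => `|f x - g x|%:E).
Proof.
move=> mf mg; apply/measurable_EFinP; apply: measurableT_comp => //.
exact: measurable_funB.
Qed.

Lemma L1dist_triangle (f g h : T -> R) : measurable_fun setT f ->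
  measurable_fun setT g -> measurable_fun setT h ->
  \int[mu]_x `|f x - h x|%:E <=
  \int[mu]_x `|f x - g x|%:E + \int[mu]_x `|g x - h x|%:E.
Proof.
move=> mf mg mh; rewrite -ge0_integralD//; last 2 first.
  exact: measurable_normB.
  exact: measurable_normB.
apply: ge0_le_integral_pointwise => // x.
by rewrite -EFinD lee_fin ler_distD.
Qed.

End integral_facts.

(** * Continuity of translations in L^1: transport and products *)

Section L1_vanishing.
Context (R : realType).
Local Open Scope ereal_scope.

(** Sequences are used because products are handled by dominated convergence. Invariance of the
    measure provides the domination: the increment of g has L^1 norm at most twice that of g. *)
Definition L1_vanishing d (T : measurableType d)
    (mu : {measure set T -> \bar R}) (tau : nat -> T -> T) :=
  (forall n, preserving mu mu (tau n)) /\
  forall g : T -> R, mu.-integrable setT (EFin \o g) ->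
    (fun n => \int[mu]_x `|g (tau n x) - g x|%:E) @ \oo --> 0.

Lemma L1_vanishing_conj d d' (T : measurableType d) (S : measurableType d')
    (mu : {measure set T -> \bar R}) (nu : {measure set S -> \bar R})
    (tau : nat -> T -> T) (f : T -> S) (h : S -> T) :
  cancel h f -> preserving mu nu f -> preserving nu mu h ->
  L1_vanishing mu tau -> L1_vanishing nu (fun n => f \o tau n \o h).
Proof.
move=> hK pf ph [pt vt]; split=> [n|g gi].
  exact: preserving_comp (preserving_comp ph (pt n)) pf.
have := vt (g \o f) (integrable_preserving pf gi).
suff -> : (fun n => \int[mu]_x `|(g \o f) (tau n x) - (g \o f) x|%:E) =
  (fun n => \int[nu]_y `|g ((f \o tau n \o h) y) - g y|%:E) by [].
apply/funext => n.
have mg : measurable_fun setT g by exact: integrable_measurable gi.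
rewrite -(ge0_integral_preserving ph)//=.
  by apply: eq_integral => y _; rewrite hK.
apply: measurable_normB; last exact: measurableT_comp mg pf.1.
apply: (measurableT_comp mg); exact: measurableT_comp pf.1 (pt n).1.
Qed.

Section product.
Context d1 d2 (T1 : measurableType d1) (T2 : measurableType d2).
Context (m1 : {sigma_finite_measure set T1 -> \bar R}).
Context (m2 : {sigma_finite_measure set T2 -> \bar R}).

Lemma dominated_cvg0_integral d (T : measurableType d) (m : {measure set T -> \bar R})
    (h : nat -> T -> \bar R) (k : T -> \bar R) :
  (forall n, measurable_fun setT (h n)) -> (forall n x, 0 <= h n x) ->
  m.-integrable setT k -> (forall n x, h n x <= k x) ->
  {ae m, forall x, (h ^~ x) @ \oo --> 0} ->
  (fun n => \int[m]_x h n x) @ \oo --> 0.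
Proof.
move=> mh h0 ik hk hc.
have hc' : {ae m, forall x, setT x -> (h ^~ x) @ \oo --> cst 0 x}.
  by apply: filterS hc.
have hb : {ae m, forall x n, setT x -> `|h n x| <= k x}.
  by apply: nearW => x n _; rewrite gee0_abs.
have [_ _] := dominated_convergence measurableT mh (@measurable_cst _ _ _ _ _ _) hc' ik hb.
by rewrite integral0.
Qed.

Let integrable_G (g : T1 * T2 -> R) : (m1 \x m2).-integrable setT (EFin \o g) ->
  m2.-integrable setT (fun y => \int[m1]_x `|g (x, y)|%:E).
Proof.
move=> gi; have mg : measurable_fun setT g by exact: integrable_measurable gi.
have mag : measurable_fun setT (fun p => `|g p|%:E).
  by apply/measurable_EFinP; exact: measurableT_comp.
have ag0 p : 0 <= `|g p|%:E by [].
apply: ge0_integrable => [|y|].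
- exact: (measurable_fun_fubini_tonelli_G (fun p => `|g p|%:E) mag ag0).
- exact: integral_ge0.
- have := (integrable21ltyP m1 m2 (measurable_int _ gi)).1 gi.
  by under eq_integral do under eq_integral do rewrite /=.
Qed.

Let integrable_F (g : T1 * T2 -> R) : (m1 \x m2).-integrable setT (EFin \o g) ->
  m1.-integrable setT (fun x => \int[m2]_y `|g (x, y)|%:E).
Proof.
move=> gi; have mg : measurable_fun setT g by exact: integrable_measurable gi.
have mag : measurable_fun setT (fun p => `|g p|%:E).
  by apply/measurable_EFinP; exact: measurableT_comp.
have ag0 p : 0 <= `|g p|%:E by [].
apply: ge0_integrable => [|y|].
- exact: (measurable_fun_fubini_tonelli_F (fun p => `|g p|%:E) mag ag0).
- exact: integral_ge0.
- have := (integrable12ltyP m1 m2 (measurable_int _ gi)).1 gi.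
  by under eq_integral do under eq_integral do rewrite /=.
Qed.

(** Move one coordinate at a time. The triangle inequality, with the invariance under the second
    motion, splits the increment into one per variable. By Fubini each is an integral of slice
    increments, which tend to 0 for almost every slice and are at most twice the norm of the
    slice. *)
Lemma L1_vanishing_prod (tau : nat -> T1 -> T1) (sig : nat -> T2 -> T2) :
  L1_vanishing m1 tau -> L1_vanishing m2 sig ->
  L1_vanishing (m1 \x m2)%E (fun n p => (tau n p.1, sig n p.2)).
Proof.
move=> [pt vt] [ps vs]; split=> [n|g gi]; first exact: preserving_prod.
have mg : measurable_fun setT g by exact: integrable_measurable gi.
have p1 n : preserving (m1 \x m2) (m1 \x m2)
    (fun p : T1 * T2 => (tau n p.1, p.2)).
  exact: preserving_prod (pt n) (preserving_id _).
have p2 n : preserving (m1 \x m2) (m1 \x m2)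
    (fun p : T1 * T2 => (p.1, sig n p.2)).
  exact: preserving_prod (preserving_id _) (ps n).
have mg1 n := measurableT_comp mg (p1 n).1.
have mg2 n := measurableT_comp mg (p2 n).1.
apply: (@squeeze_cvge _ _ _ _ (cst 0) _ (fun n =>
    \int[m1 \x m2]_p `|g (tau n p.1, p.2) - g p|%:E +
    \int[m1 \x m2]_p `|g (p.1, sig n p.2) - g p|%:E)).
- apply: nearW => n; rewrite integral_ge0//=.
  have := L1dist_triangle (m1 \x m2)
    (measurableT_comp (mg1 n) (p2 n).1) (mg2 n) mg.
  move=> /le_trans; apply; rewrite leeD2r//.
  rewrite -(ge0_integral_preserving (p2 n)
    (f := fun p => `|g (tau n p.1, p.2) - g p|%:E))//.
  exact: measurable_normB (mg1 n) mg.
- exact: cvg_cst.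
rewrite -[X in _ --> X](adde0 0); apply: cvgeD => //.
- have E n : \int[m1 \x m2]_p `|g (tau n p.1, p.2) - g p|%:E =
      \int[m2]_y \int[m1]_x `|g (tau n x, y) - g (x, y)|%:E.
    by rewrite fubini_tonelli2//; exact: measurable_normB (mg1 n) mg.
  rewrite (funext E).
  apply: (@dominated_cvg0_integral _ _ m2 _ (fun y => \int[m1]_x `|g (x, y)|%:E +
      \int[m1]_x `|g (x, y)|%:E)) => [n|n y||n y|].
  + apply: (measurable_fun_fubini_tonelli_G
      (fun p => `|g (tau n p.1, p.2) - g p|%:E)) => //.
    exact: measurable_normB (mg1 n) mg.
  + exact: integral_ge0.
  + have iG := integrable_G gi.
    exact: integrableD.
  + have mgy : measurable_fun setT (fun x => g (x, y)) by exact: measurableT_comp.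
    rewrite -{1}(ge0_integral_preserving (pt n) (f := fun x => `|g (x, y)|%:E))//;
      last by apply/measurable_EFinP; exact: measurableT_comp.
    rewrite -ge0_integralD//; last 2 first.
      apply/measurable_EFinP; apply: measurableT_comp => //.
      exact: measurableT_comp mgy (pt n).1.
      by apply/measurable_EFinP; exact: measurableT_comp.
    by apply: ge0_le_integral_pointwise => // x; rewrite lee_fin/= ler_normB.
  + by have := ae_integrable2 gi; apply: filterS => y iy; exact: (vt (fun x => g (x, y))).
- have E n : \int[m1 \x m2]_p `|g (p.1, sig n p.2) - g p|%:E =
      \int[m1]_x \int[m2]_y `|g (x, sig n y) - g (x, y)|%:E.
    by rewrite fubini_tonelli1//; exact: measurable_normB (mg2 n) mg.
  rewrite (funext E).
  apply: (@dominated_cvg0_integral _ _ m1 _ (fun x => \int[m2]_y `|g (x, y)|%:E +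
      \int[m2]_y `|g (x, y)|%:E)) => [n|n x||n x|].
  + apply: (measurable_fun_fubini_tonelli_F
      (fun p => `|g (p.1, sig n p.2) - g p|%:E)) => //.
    exact: measurable_normB (mg2 n) mg.
  + exact: integral_ge0.
  + have iF := integrable_F gi.
    exact: integrableD.
  + have mgx : measurable_fun setT (fun y => g (x, y)) by exact: measurableT_comp.
    rewrite -{1}(ge0_integral_preserving (ps n) (f := fun y => `|g (x, y)|%:E))//;
      last by apply/measurable_EFinP; exact: measurableT_comp.
    rewrite -ge0_integralD//; last 2 first.
      apply/measurable_EFinP; apply: measurableT_comp => //.
      exact: measurableT_comp mgx (ps n).1.
      by apply/measurable_EFinP; exact: measurableT_comp.
    by apply: ge0_le_integral_pointwise => // y; rewrite lee_fin/= ler_normB.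
  + by have := ae_integrable1 gi; apply: filterS => x ix; exact: (vs (fun y => g (x, y))).
Qed.

End product.
End L1_vanishing.

(** * Continuity of translations in L^1(R^d) *)

Section L1_translation.
Context (R : realType).
Local Open Scope ereal_scope.

(** Three epsilons: by invariance, composing with [tau n] leaves the distance between g and its
    approximant unchanged. *)
Lemma L1_vanishing_approx d (T : measurableType d)
    (mu : {measure set T -> \bar R}) (tau : nat -> T -> T) (g : T -> R) :
  (forall n, preserving mu mu (tau n)) -> measurable_fun setT g ->
  (forall e : R, (0 < e)%R -> exists h : T -> R,
    [/\ measurable_fun setT h, \int[mu]_x `|g x - h x|%:E <= e%:E &
     (fun n => \int[mu]_x `|h (tau n x) - h x|%:E) @ \oo --> 0]) ->
  (fun n => \int[mu]_x `|g (tau n x) - g x|%:E) @ \oo --> 0.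
Proof.
move=> pt mg H; apply/cvge0P => [n|e e0]; first exact: integral_ge0.
have e3 : (0 < e / 3)%R by rewrite divr_gt0.
have [h [mh gh /cvge0P hc]] := H _ e3.
have h0 n : 0 <= \int[mu]_x `|h (tau n x) - h x|%:E by exact: integral_ge0.
apply: filterS (hc h0 _ e3) => n hn.
have mgt := measurableT_comp mg (pt n).1.
have mht := measurableT_comp mh (pt n).1.
have -> : e = (e / 3 + (e / 3 + e / 3))%R by lra.
rewrite EFinD; apply: le_trans (L1dist_triangle mu mgt mht mg) _.
apply: leeD.
  rewrite (ge0_integral_preserving (pt n) (f := fun x => `|g x - h x|%:E))//.
  exact: measurable_normB.
rewrite EFinD; apply: le_trans (L1dist_triangle mu mht mh mg) _.
apply: leeD => //; apply: le_trans gh.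
by under eq_integral => x _ do rewrite distrC.
Qed.

Lemma measurable_truncation (g : R -> R) (M : R) : measurable_fun setT g ->
  measurable_fun setT (g \_ `[(- M)%R, M]).
Proof.
move=> mg; have [+ _] := @measurable_restrictT _ _ (measurableTypeR R)
  (measurableTypeR R) `[(- M)%R, M] g (measurable_itv _).
by move=> /(_ (measurable_funTS mg)).
Qed.

Lemma truncation_L1 (g : R -> R) (e : R) :
  (@lebesgue_measure R).-integrable setT (EFin \o g) -> (0 < e)%R ->
  exists2 M : R, (0 <= M)%R &
    \int[lebesgue_measure]_x `|g x - (g \_ `[(- M)%R, M]) x|%:E <= e%:E.
Proof.
move=> gi e0; have mg : measurable_fun setT g by exact: integrable_measurable gi.
pose h n x := `|g x - (g \_ `[(- n%:R)%R, n%:R]) x|%:E.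
have h0 n x : 0 <= h n x by rewrite lee_fin.
have mh n : measurable_fun setT (h n).
  apply: measurable_normB => //.
  exact: measurable_truncation.
have hc : (fun n => \int[lebesgue_measure]_x h n x) @ \oo --> 0.
  have gi' := integrable_norm gi.
  apply: (@dominated_cvg0_integral R _ (measurableTypeR R) lebesgue_measure h
    (fun x => `|g x|%:E)) => // [n x|].
    rewrite lee_fin /= patchE; case: ifPn => _; rewrite ?subr0//.
    by rewrite subrr normr0.
  apply: nearW => x; apply/cvge0P => // d d0.
  near=> n; rewrite /h patchE ifT ?subrr ?normr0 ?lee_fin ?ltW//.
  rewrite inE/= in_itv/= -ler_norml.
  by near: n; exact: nbhs_infty_ger.
have hn n : 0 <= \int[lebesgue_measure]_x h n x by exact: integral_ge0.
have [N _ /(_ N (leqnn _)) HN] := (cvge0P hn).1 hc e e0.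
by exists N%:R.
Unshelve. all: by end_near. Qed.

Lemma L1_vanishing_compactly_supported (h : R -> R) (M : R) (a : nat -> R) :
  continuous h -> (forall x, (M < `|x|)%R -> h x = 0%R) ->
  (forall n, (`|a n| <= 1)%R) -> a @ \oo --> 0%R ->
  (fun n => \int[lebesgue_measure]_x `|h (x + a n)%R - h x|%:E) @ \oo --> 0.
Proof.
move=> ch hM a1 a0.
have [C hC] : exists C, forall x, (`|h x| <= C)%R.
  have := @segment_compact R (- M)%R M => cM.
  have [C [_ HC]] := compact_bounded
     (continuous_compact (continuous_subspaceT ch) cM).
  exists (Num.max 0 (C + 1))%R => x; rewrite le_max.
  have [xM|Mx] := leP `|x|%R M; last by rewrite hM// normr0 lexx.
  apply/orP; right; apply: (HC (C + 1)%R); first by rewrite ltrDl.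
  by exists x => //; rewrite /= in_itv/= -ler_norml.
have mh : measurable_fun setT h by exact: continuous_measurable_fun.
(* The margin 1 absorbs the translations, since [a n] is at most 1 in absolute value. *)
pose E : set R := `[(- (M + 1))%R, (M + 1)%R]%classic.
have mE : measurable (E : set (measurableTypeR R)) by exact: measurable_itv.
have Eoo : (@lebesgue_measure R) E < +oo.
  by rewrite /E lebesgue_measure_itv/=; case: ifP => _; rewrite -?EFinB ltry.
pose k x : \bar R := (2 * C)%:E * (\1_E x)%:E.
apply: (@dominated_cvg0_integral R _ (measurableTypeR R) lebesgue_measure _ k) => [n|n x||n x|].
- apply: measurable_normB => //; apply: measurableT_comp => //.
  exact: measurable_funD.
- by [].
- apply: integrableZl => //; apply: ge0_integrable => //.
    by apply/measurable_EFinP; exact: measurable_indic.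
  by rewrite integral_indic// setIT.
- rewrite /k -EFinM lee_fin indicE; have [xE|xE] := boolP (x \in E).
    rewrite mulr1 mulr_natl mulr2n (le_trans (ler_normB _ _))// lerD//.
  rewrite mulr0; move: xE; rewrite notin_setE /E /= in_itv/= -ler_norml => /negP.
  rewrite -ltNge => Mx; rewrite !hM ?subrr ?normr0//.
    by rewrite (lt_trans _ Mx)// ltrDl.
  by have := ler_normB (x + a n)%R (a n); rewrite addrK; have := a1 n; lra.
- apply: nearW => x; apply/cvge0P => // e e0.
  have : (fun n => h (x + a n)%R) @ \oo --> h x.
    have xa : (fun n => x + a n)%R @ \oo --> x.
      have := @cvgD _ _ _ _ _ (cst x) a _ _ (@cvg_cst _ x _ _ _) a0.
      by rewrite addr0; apply.
    exact: cvg_comp xa (ch x).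
  move/cvgrPdist_le => /(_ e e0); apply: filterS => n /=.
  by rewrite lee_fin distrC.
Qed.

Lemma L1_vanishing_lebesgue (a : nat -> R) :
  (forall n, (`|a n| <= 1)%R) -> a @ \oo --> 0%R ->
  L1_vanishing (@lebesgue_measure R) (fun n (x : R) => x + a n)%R.
Proof.
move=> a1 a0; split=> [n|g gi]; first exact: preserving_lebesgueD.
have mg : measurable_fun setT g by exact: integrable_measurable gi.
apply: L1_vanishing_approx => // [n|e e0]; first exact: preserving_lebesgueD.
have e2 : (0 < e / 2)%R by rewrite divr_gt0.
have [M M0 gM] := truncation_L1 gi e2.
set f := (g \_ _) in gM.
have mf : measurable_fun setT f.
  exact: measurable_truncation.
pose E : set R := `[(- (M + 1))%R, (M + 1)%R]%classic.
have mE : measurable E by exact: measurable_itv.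
have fi : (@lebesgue_measure R).-integrable E (EFin \o f).
  apply: (integrableS measurableT) => //.
  apply: (le_integrable measurableT _ _ gi); first exact/measurable_EFinP.
  move=> x _; rewrite /= lee_fin /f patchE; case: ifPn => // _.
  by rewrite normr0.
have Eoo : lebesgue_measure E < +oo.
  by rewrite /E lebesgue_measure_itv/=; case: ifP => _; rewrite -?EFinB ltry.
have [h_ [ch _ /cvge0P]] := approximation_continuous_integrable mE Eoo fi.
have H0 n : 0 <= \int[lebesgue_measure]_(z in E) `|(f z - h_ n z)%:E|.
  exact: integral_ge0.
move=> /(_ H0 _ e2) [N _ /(_ N (leqnn _)) fhN].
(* [cut] gives the continuous approximant a compact support. It equals 1 where the truncation [f]
   can be nonzero, so [f] is [f * cut] and the factor does not increase the error. *)
pose cut (x : R) : R := Num.max 0%R (Num.min 1%R (M + 1 - `|x|)%R).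
have cut0 x : (0 <= cut x)%R by rewrite le_max lexx.
have cut1 x : (cut x <= 1)%R by rewrite ge_max ler01 ge_min lexx.
have ccut : continuous cut.
  move=> x; apply: (@continuous_max R R (cst 0%R)
    (fun y => Num.min 1%R (M + 1 - `|y|)%R)); first exact: cvg_cst.
  apply: (@continuous_min R R (cst 1%R) (fun y => M + 1 - `|y|)%R).
    exact: cvg_cst.
  by apply: cvgB; [exact: cvg_cst|exact: norm_continuous].
have chc : continuous (fun x => h_ N x * cut x)%R.
  by move=> x; apply: cvgM; [exact: ch|exact: ccut].
have mhc : measurable_fun setT (fun x => h_ N x * cut x)%R.
  exact: continuous_measurable_fun.
exists (fun x => h_ N x * cut x)%R; split=> //; last first.
  apply: (L1_vanishing_compactly_supported (M := M + 1)%R) => // x Mx.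
  rewrite /cut (_ : Num.min _ _ = M + 1 - `|x|)%R.
    by rewrite max_l ?mulr0//; lra.
  by rewrite min_r//; lra.
have -> : e = (e / 2 + e / 2)%R by lra.
rewrite EFinD; apply: le_trans (L1dist_triangle _ mg mf mhc) _.
apply: leeD => //; apply: le_trans fhN; rewrite [leRHS]integral_mkcond.
apply: ge0_le_integral_pointwise => // x; rewrite /= patchE.
case: ifPn => [_|].
  rewrite lee_fin; have fE : f x = (f x * cut x)%R.
    rewrite /f patchE; case: ifPn; rewrite ?mul0r// inE/= in_itv/= -ler_norml => xM.
    by rewrite /cut min_l ?max_r ?mulr1//; lra.
  rewrite {1}fE -mulrBl normrM (ger0_norm (cut0 x)) ler_piMr//.
rewrite notin_setE /E /= in_itv/= -ler_norml => /negP; rewrite -ltNge => Mx.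
rewrite /f patchE ifF; last first.
  by apply/negbTE; rewrite notin_setE/= in_itv/= -ler_norml => xM; lra.
rewrite /cut (_ : Num.min _ _ = M + 1 - `|x|)%R; last by rewrite min_r//; lra.
by rewrite max_l ?mulr0 ?subrr ?normr0//; lra.
Qed.

(** Induction on the dimension through the identification of R^(d+1) with R x R^d; in dimension 0
    nothing moves. *)
Lemma L1_vanishing_rV d (a : nat -> 'rV[R]_d) :
  (forall n i, (`|a n ord0 i| <= 1)%R) ->
  (forall i, (fun n => a n ord0 i) @ \oo --> 0%R) ->
  L1_vanishing (lebesgue_rV R d) (fun n (x : 'rV[R]_d) => x + a n)%R.
Proof.
elim: d => [|d IH] in a * => a1 a0.
  split=> [n|g _]; first exact: preserving_rVD.
  apply/cvge0P => [n|e e0]; first exact: integral_ge0.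
  apply: nearW => n; rewrite integral0_eq ?lee_fin ?ltW// => x _.
  have -> : (x + a n = x)%R by apply/rowP; case.
  by rewrite subrr normr0.
have H0 : L1_vanishing (@lebesgue_measure R) (fun n (x : R) => x + a n ord0 ord0)%R.
  by apply: L1_vanishing_lebesgue => [n|]; [exact: a1|exact: a0].
have H1 : L1_vanishing (lebesgue_rV R d)
    (fun n (x : 'rV[R]_d) => x + (rV_uncons (a n)).2)%R.
  apply: IH => [n i|i]; first by rewrite mxE.
  rewrite (_ : (fun n => _) = fun n => a n ord0 (lift ord0 i))//.
  by apply/funext => n; rewrite mxE.
have H2 := L1_vanishing_prod H0 H1.
have := L1_vanishing_conj _ (preserving_rV_cons R d) (preserving_rV_uncons R d) H2.
move=> /(_ (@rV_unconsK R d)).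
congr L1_vanishing; apply/funext => n; apply/funext => x; apply/rowP => i.
by rewrite !mxE; case: unliftP => [j ->|->] //=; rewrite !mxE.
Qed.

(** Passage from sequences to a uniform radius: a failure at every 1 / (n + 1) yields translations
    tending to 0 along which the increment stays above e. *)
Lemma L1_translation_continuous d (g : 'rV[R]_d -> R) (e : R) :
  (lebesgue_rV R d).-integrable setT (EFin \o g) -> (0 < e)%R ->
  exists2 del : R, (0 < del)%R & forall w : 'rV[R]_d,
    (forall i, (`|w ord0 i| <= del)%R) ->
    \int[lebesgue_rV R d]_x `|g (x + w)%R - g x|%:E <= e%:E.
Proof.
move=> gi e0; apply: contrapT => H.
have {}H n : exists w : 'rV[R]_d, (forall i, (`|w ord0 i| <= n.+1%:R^-1)%R) /\
    e%:E < \int[lebesgue_rV R d]_x `|g (x + w)%R - g x|%:E.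
  apply: contrapT => Hn; apply: H; exists n.+1%:R^-1%R => // w wn.
  by rewrite leNgt; apply/negP => ew; apply: Hn; exists w.
have [a Ha] := choice H.
have [_ /(_ g gi)] : L1_vanishing (lebesgue_rV R d)
    (fun n (x : 'rV[R]_d) => x + a n)%R.
  apply: L1_vanishing_rV => [n i|i].
    by rewrite (le_trans ((Ha n).1 i))// invf_le1// ler1n.
  apply/cvgrPdist_le => _/posnumP[f]; near=> n.
  rewrite sub0r normrN (le_trans ((Ha n).1 i))//.
  by apply: ltW; near: n; exact: near_infty_natSinv_lt.
have I0 n : 0 <= \int[lebesgue_rV R d]_x `|g (x + a n)%R - g x|%:E.
  by apply: integral_ge0 => x _; rewrite lee_fin.
by move=> /cvge0P => /(_ I0 e e0) [N _ /(_ N (leqnn _))]; rewrite leNgt (Ha N).2.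
Unshelve. all: by end_near. Qed.

End L1_translation.

(** * Smooth bump functions on the line *)

Section smooth_functions.
Context (R : realType).
Implicit Types (f g h : R -> R) (x y : R).

(** Only existence of n derivatives is recorded, not continuity of the last one; hence statements
    about continuity or class C^n start from [smooth n.+1]. *)
Fixpoint smooth n h : Prop :=
  if n is n'.+1 then
    exists2 h', (forall x, is_derive x (1 : R) h (h' x)) & smooth n' h'
  else True.

Lemma smoothW n h : smooth n.+1 h -> smooth n h.
Proof.
by elim: n h => [//|n IH] h [h' dh sh]; exists h' => //; exact: IH.
Qed.

Lemma smooth_cst n (c : R) : smooth n (cst c).
Proof.
elim: n c => [//|n IH] c; exists (cst 0); last exact: IH.
by move=> x; exact: is_derive_cst.
Qed.

Lemma smoothD n f g : smooth n f -> smooth n g ->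
  smooth n (fun x => f x + g x).
Proof.
elim: n f g => [//|n IH] f g [f' df sf] [g' dg sg].
exists (fun x => f' x + g' x); last exact: IH.
by move=> x; exact: is_deriveD.
Qed.

Lemma smoothM n f g : smooth n f -> smooth n g ->
  smooth n (fun x => f x * g x).
Proof.
elim: n f g => [//|n IH] f g sf sg.
case: (sf) (sg) => f' df sf' [g' dg sg'].
exists (fun x => f x * g' x + g x * f' x).
  by move=> x; exact: is_deriveM.
by apply: smoothD; apply: IH => //; exact: smoothW.
Qed.

Lemma smooth_affine n h (a b : R) : smooth n h ->
  smooth n (fun x => h (a * x + b)).
Proof.
elim: n h => [//|n IH] h [h' dh sh].
exists (fun x => h' (a * x + b) * a); last first.
  by apply: smoothM; [exact: IH|exact: smooth_cst].
move=> x; have H : is_derive x (1 : R) (fun x => a * x + b) a.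
  rewrite (_ : (fun x => _) = (a *: id + cst b)%R)//.
  by apply: is_derive_eq; rewrite addr0 -[RHS]mulr1.
exact: (is_derive1_comp (f := h) (g := fun x => a * x + b)).
Qed.

Lemma smooth1_continuous h : smooth 1 h -> continuous h.
Proof.
move=> [h' dh _] x; apply/differentiable_continuous/derivable1_diffP.
by have [] := dh x.
Qed.

(* The derivatives of exp (- 1 / x) are combinations of such functions. *)
Definition flat (k : nat) x : R :=
  if 0 < x then x^-1 ^+ k * expR (- x^-1) else 0.

Lemma flat_ge0 k x : 0 <= flat k x.
Proof.
rewrite /flat; case: ifPn => // x0.
by rewrite mulr_ge0 ?expR_ge0// exprn_ge0// invr_ge0 ltW.
Qed.

(** The exponential series at 1/x is bounded below by its term of degree k + 2. The spare square of
    x is what makes the difference quotient at 0 tend to 0. *)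
Lemma flat_le k x : flat k x <= (k.+2)`!%:R * x ^+ 2.
Proof.
rewrite /flat; case: ifPn => x0; last by rewrite mulr_ge0// sqr_ge0.
have xV0 : 0 < x^-1 by rewrite invr_gt0.
rewrite expRN -ler_pdivlMr ?invr_gt0 ?expR_gt0// invrK.
have := expR_ge1Dxn k.+1 (ltW xV0).
rewrite -(ler_pM2l (x := (k.+2)`!%:R * x ^+ 2)); last first.
  by rewrite mulr_gt0 ?ltr0n ?fact_gt0// exprn_gt0.
apply: le_trans; rewrite mulrDr mulr1 ler_wpDl//.
  by rewrite mulr_ge0// sqr_ge0.
rewrite [leRHS](_ : _ = x^-1 ^+ k)//.
have f0 : (k.+2)`!%:R != 0 :> R by rewrite pnatr_eq0 -lt0n fact_gt0.
rewrite -addn2 exprD addn2; field.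
by rewrite f0 gt_eqF.
Qed.

Lemma is_derive_flat k x :
  is_derive x (1 : R) (flat k) (flat k.+2 x - k%:R * flat k.+1 x).
Proof.
have [x0|x0|->] := ltgtP x 0.
- have -> : flat k.+2 x - k%:R * flat k.+1 x = 0.
    by rewrite /flat ltNge (ltW x0)/= mulr0 subr0.
  apply: (@near_eq_is_derive R R R (cst 0)).
  near=> y; rewrite /flat ltNge ltW//.
  by near: y; exact: lt_nbhsl.
- pose F := fun y : R => y^-1 ^+ k * expR (- y^-1).
  apply: (@near_eq_is_derive _ _ _ F).
    near=> y; rewrite /flat ifT//.
    by near: y; exact: lt_nbhsr.
  have xn0 : x != 0 by rewrite gt_eqF.
  have dV : is_derive x (1 : R) (fun y : R => y^-1) (- x^-2).
    have := @is_deriveV R id x 1 1 xn0 (is_derive_id _ _).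
    by rewrite [_ *: 1]mulr1.
  have dE : is_derive x (1 : R) (expR \o (fun y : R => - y^-1))
      (expR (- x^-1) * x^-2).
    have dN : is_derive x (1 : R) (fun y : R => - y^-1) (x^-2).
      by rewrite -[x^-2]opprK; exact: is_deriveN.
    exact: is_derive1_comp.
  have -> : F = (fun y : R => y^-1) ^+ k * (expR \o (fun y : R => - y^-1)).
    by apply/funext => y; rewrite /F fctE exprfctE.
  apply: is_derive_eq; rewrite /flat x0 exprfctE /=.
  rewrite -![_ *: _]/(_ * _) -exprVn; case: (k) => [|m].
    by rewrite !mul0r subr0 mulr0 addr0; ring.
  by rewrite /= !exprS; ring.
- have c0 : flat k.+2 0 - k%:R * flat k.+1 0 = 0.
    by rewrite /flat ltxx mulr0 subr0.
  have H : (fun y => y^-1 *: ((flat k \o shift 0) (y *: (1 : R)) - flat k 0))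
      @ 0^' --> (0 : R).
    apply/cvgrPdist_le => e e0; near=> y.
    rewrite /= sub0r normrN addr0 [y *: 1]mulr1 (_ : flat k 0 = 0); last first.
      by rewrite /flat ltxx.
    rewrite subr0 normrZ normfV (ger0_norm (flat_ge0 _ _)).
    have hn0 : 0 < `|y| by rewrite normr_gt0; near: y; exact: nbhs_dnbhs_neq.
    have C0 : 0 < (k.+2)`!%:R :> R by rewrite ltr0n fact_gt0.
    rewrite ler_pdivrMl//; apply: (le_trans (flat_le _ _)).
    rewrite -[y ^+ 2]ger0_norm ?sqr_ge0// normrX expr2 mulrCA ler_wpM2l//.
    rewrite -ler_pdivlMl// mulrC.
    by near: y; apply: dnbhs0_le; rewrite divr_gt0.
  rewrite c0; apply: DeriveDef; first by apply/cvg_ex; exists 0.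
  exact: cvg_lim H.
Unshelve. all: by end_near. Qed.

Lemma smooth_flat n k : smooth n (flat k).
Proof.
elim: n k => [//|n IH] k.
exists (fun x => flat k.+2 x - k%:R * flat k.+1 x).
  exact: is_derive_flat.
rewrite (_ : (fun x => _) = fun x => flat k.+2 x + (- k%:R) * flat k.+1 x).
  by apply: smoothD => //; apply: smoothM => //; exact: smooth_cst.
by apply/funext => x; rewrite mulNr.
Qed.

(** Evenness makes b(x - y) symmetric in the two points, so that its derivatives in x and in y are
    opposite. Positivity at 0 is enough to give b a positive mass. *)
Record bump (del : R) (b : R -> R) : Prop := Bump {
  bump_smooth : forall n, smooth n b ;
  bump_ge0 : forall x, 0 <= b x ;
  bump_out : forall x, del <= `|x| -> b x = 0 ;
  bump_even : forall x, b (- x) = b x ;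
  bump_gt0 : 0 < b 0 }.

Lemma exists_bump (del : R) : 0 < del -> exists b, bump del b.
Proof.
(* For x between -del and del this is exp (- 1 / (1 + x/del)) times exp (- 1 / (1 - x/del));
   elsewhere one factor is 0. *)
move=> d0; exists (fun x => flat 0 (del^-1 * x + 1) * flat 0 (- del^-1 * x + 1)).
split=> [n|x|x dx|x|].
- by apply: smoothM; exact: smooth_affine (smooth_flat _ _).
- by rewrite mulr_ge0 ?flat_ge0.
- have [x0|x0] := leP 0 x.
    rewrite [X in _ * X](_ : _ = 0) ?mulr0// /flat ifF//; apply/negbTE.
    rewrite -leNgt mulNr addrC subr_le0 mulrC ler_pdivlMr// mul1r.
    by rewrite -(ger0_norm x0).
  rewrite [X in X * _](_ : _ = 0) ?mul0r// /flat ifF//; apply/negbTE.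
  rewrite -leNgt -lerBrDr sub0r mulrC ler_pdivrMr// mulN1r lerNr.
  by rewrite -(ltr0_norm x0).
- by rewrite mulrC !mulrN !mulNr opprK.
- by rewrite !mulr0 !add0r /flat ltr01 mulr_gt0// mulr_gt0// expR_gt0.
Qed.

End smooth_functions.

(** * Difference bounds, primitive and positivity of a bump *)

Section bump_theory.
Context (R : realType).
Implicit Types (h : R -> R) (x y : R).

Lemma MVT_is_derive h h' x y : (forall z, is_derive z (1 : R) h (h' z)) ->
  x <= y -> exists2 z, x <= z <= y & h y - h x = h' z * (y - x).
Proof.
move=> dh xy; have [|z] := MVT_segment xy (fun z _ => dh z).
  apply: continuous_subspaceT => z.
  by apply/differentiable_continuous/derivable1_diffP; have [] := dh z.
by rewrite in_itv/=; exists z.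
Qed.

Lemma is_derive_lipschitz h h' (M : R) x y :
  (forall z, is_derive z (1 : R) h (h' z)) -> (forall z, `|h' z| <= M) ->
  `|h x - h y| <= M * `|x - y|.
Proof.
move=> dh hM; wlog yx : x y / y <= x => [H|].
  have [/H//|/ltW/H] := leP y x.
  by rewrite distrC (distrC x).
have [z _ ->] := MVT_is_derive dh yx.
by rewrite normrM ler_wpM2r.
Qed.

(** Mean value theorem for z to h(x + z) + h(x - z), whose derivative is a difference of values of
    h' at two points at most 2z apart; this gives the factor 2. *)
Lemma second_difference_le h h' (h'' : R -> R) (M : R) x z :
  (forall y, is_derive y (1 : R) h (h' y)) ->
  (forall y, is_derive y (1 : R) h' (h'' y)) ->
  (forall y, `|h'' y| <= M) ->
  `|h (x + z) + h (x - z) - 2 * h x| <= 2 * M * z ^+ 2.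
Proof.
move=> dh dh' hM; wlog z0 : z / 0 <= z => [H|].
  have [/H//|/ltW] := leP 0 z; rewrite -oppr_ge0 => /H.
  by rewrite opprK sqrrN addrAC [X in `|X - _|]addrC addrAC.
have M0 : 0 <= M by exact: le_trans (hM 0).
have dg y : is_derive y (1 : R) (fun y => h (x + y) + h (x - y))
    (h' (x + y) - h' (x - y)).
  have d1 : is_derive y (1 : R) (fun y => x + y) 1.
    have -> : (fun y => x + y) = cst x + id by [].
    by apply: is_derive_eq; rewrite add0r.
  have d2 : is_derive y (1 : R) (fun y => x - y) (- 1).
    have -> : (fun y => x - y) = cst x - id by [].
    by apply: is_derive_eq; rewrite sub0r.
  have := is_deriveD (is_derive1_comp (dh _) d1) (is_derive1_comp (dh _) d2).
  by rewrite mulr1 mulrN1.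
have [y /andP[y0 yz]] := MVT_is_derive dg z0.
rewrite !addr0 !subr0 -mulr2n mulr_natl => ->.
rewrite normrM (ger0_norm z0) expr2 mulrA ler_wpM2r//.
apply: le_trans (is_derive_lipschitz _ _ dh' hM) _.
rewrite (_ : x + y - (x - y) = 2 * y); last by ring.
by rewrite ger0_norm ?mulr_ge0// mulrA (mulrC M) ler_wpM2l// mulr_ge0.
Qed.

Lemma smooth_derive1 n h : smooth n.+1 h ->
  (forall x, is_derive x (1 : R) h (derive1 h x)) /\ smooth n (derive1 h).
Proof.
move=> [h' dh sh]; have -> : derive1 h = h'; last by [].
by apply/funext => x; rewrite derive1E; exact: derive_val.
Qed.

Lemma integrable_bounded_support h (M C : R) : measurable_fun setT h ->
  (forall x, `|h x| <= C) -> (forall x, M < `|x| -> h x = 0) ->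
  (@lebesgue_measure R).-integrable setT (EFin \o h).
Proof.
move=> mh hC hM; pose E : set (measurableTypeR R) := `[(- M)%R, M]%classic.
have mE : measurable E by exact: measurable_itv.
have Eoo : (lebesgue_measure E < +oo)%E.
  by rewrite /E lebesgue_measure_itv/=; case: ifP => _; rewrite -?EFinB ltry.
apply: (@le_integrable _ (measurableTypeR R) _ lebesgue_measure setT measurableT
  (EFin \o h) (fun x => C%:E * (\1_E x)%:E)%E).
- exact/measurable_EFinP.
- move=> x _; rewrite -EFinM !abse_EFin lee_fin indicE.
  have [xE|xE] := boolP (x \in E).
    by rewrite mulr1; exact: le_trans (ler_norm _).
  rewrite hM ?normr0// ltNge; apply/negP => xM; move: xE.
  by rewrite notin_setE /E /= in_itv/= -ler_norml.
- apply: integrableZl => //; apply: ge0_integrable => //.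
    by apply/measurable_EFinP; exact: measurable_indic.
  by rewrite integral_indic// setIT.
Qed.

Lemma bounded_of_support h (M : R) : continuous h ->
  (forall x, M < `|x| -> h x = 0) -> exists C, forall x, `|h x| <= C.
Proof.
move=> ch hM; have cM := @segment_compact R (- M) M.
have [C [_ HC]] := compact_bounded
   (continuous_compact (continuous_subspaceT ch) cM).
exists (Num.max 0 (C + 1)) => x; rewrite le_max.
have [xM|Mx] := leP `|x| M; last by rewrite hM// normr0 lexx.
apply/orP; right; apply: (HC (C + 1)); first by rewrite ltrDl.
by exists x => //; rewrite /= in_itv/= -ler_norml.
Qed.

Lemma derive1_support h (M : R) : (forall x, M < `|x| -> h x = 0) ->
  forall x, M < `|x| -> derive1 h x = 0.
Proof.
move=> hM x Mx; rewrite derive1E.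
rewrite -(@near_eq_derive _ _ _ (cst 0)) ?derive_cst//.
have cn : (fun y : R => `|y|) @ x --> `|x| by exact: norm_continuous.
by apply: filterS (cvgr_gt _ cn _ Mx) => y My; rewrite hM.
Qed.

Context (del : R) (b : R -> R) (bb : bump del b).

Lemma bump_support x : del < `|x| -> b x = 0.
Proof. by move=> /ltW; exact: (bump_out bb). Qed.

Lemma bump_is_derive x : is_derive x (1 : R) b (derive1 b x).
Proof. by have [] := smooth_derive1 (bump_smooth bb 1). Qed.

Lemma smooth_derive1_bump n : smooth n (derive1 b).
Proof. by have [] := smooth_derive1 (bump_smooth bb n.+1). Qed.

Lemma bump_continuous : continuous b.
Proof. exact: smooth1_continuous (bump_smooth bb 1). Qed.

Lemma derive1_bump_continuous : continuous (derive1 b).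
Proof. exact: smooth1_continuous (smooth_derive1_bump 1). Qed.

Lemma derive1_bump_support x : del < `|x| -> derive1 b x = 0.
Proof. exact: derive1_support bump_support _. Qed.

Lemma derive1_bumpN x : derive1 b (- x) = - derive1 b x.
Proof.
have H : is_derive x (1 : R) b (derive1 b (- x) * -1).
  have -> : b = b \o -%R by apply/funext => y /=; rewrite (bump_even bb).
  rewrite (_ : b \o -%R = b); last first.
    by apply/funext => y /=; rewrite (bump_even bb).
  have d1 : is_derive x (1 : R) -%R (- 1) by exact: is_deriveNid.
  have := is_derive1_comp (bump_is_derive (- x)) d1.
  by rewrite (_ : b \o -%R = b)//; apply/funext => y /=; rewrite (bump_even bb).
have [_] := H; have [_ ->] := bump_is_derive x.
by rewrite mulrN1 => ->; rewrite opprK.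
Qed.

Lemma bump_bounded : exists C, forall x, `|b x| <= C.
Proof. exact: bounded_of_support bump_continuous bump_support. Qed.

Lemma derive1_bump_bounded : exists C, forall x, `|derive1 b x| <= C.
Proof.
exact: bounded_of_support derive1_bump_continuous derive1_bump_support.
Qed.

Lemma bump_regular : exists C, forall x z, [/\ `|b x| <= C,
  `|b (x + z) - b x| <= C * `|z| &
  `|b (x + z) + b (x - z) - 2 * b x| <= C * z ^+ 2].
Proof.
have [C0 H0] := bump_bounded; have [C1 H1] := derive1_bump_bounded.
have [dd sd] := smooth_derive1 (smooth_derive1_bump 2).
have [C2 H2] : exists C, forall x, `|derive1 (derive1 b) x| <= C.
  apply: bounded_of_support (smooth1_continuous sd) _ => x.
  exact: derive1_support derive1_bump_support _.
have p0 := le_trans (normr_ge0 _) (H0 0).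
have p1 := le_trans (normr_ge0 _) (H1 0).
have p2 := le_trans (normr_ge0 _) (H2 0).
exists (C0 + C1 + 2 * C2) => x z; split.
- by rewrite (le_trans (H0 x))//; lra.
- apply: le_trans (is_derive_lipschitz _ _ bump_is_derive H1) _.
  by rewrite addrAC subrr add0r ler_wpM2r//; lra.
- apply: le_trans (second_difference_le _ _ bump_is_derive dd H2) _.
  by rewrite ler_wpM2r ?sqr_ge0//; lra.
Qed.

Lemma bump_integrable : (@lebesgue_measure R).-integrable setT (EFin \o b).
Proof.
have [C HC] := bump_bounded.
apply: integrable_bounded_support HC bump_support.
exact: continuous_measurable_fun bump_continuous.
Qed.

(** The time cutoff will be the difference of two translates of B. Monotonicity makes it
    nonnegative, and constancy on each side of the support of b makes it vanish away from the two
    times. *)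
Lemma bump_primitive : exists B : R -> R, [/\
  forall x, is_derive x (1 : R) B (b x),
  {homo B : x y / x <= y},
  forall x y, x <= - del -> y <= - del -> B x = B y &
  forall x y, del <= x -> del <= y -> B x = B y].
Proof.
pose B x : R := (\int[lebesgue_measure]_(t in `]-oo, x]) b t)%R.
have dB x : is_derive x (1 : R) B (b x).
  have [||||d1 d2] := @continuous_FTC1 R b -oo%O x (x + 1).
  - by rewrite ltrDl.
  - exact: integrableS bump_integrable.
  - by rewrite ltNyr.
  - exact: bump_continuous.
  - by apply: DeriveDef => //; rewrite -derive1E.
exists B; split=> // [x y xy|x y|x y].
- have [z _] := MVT_is_derive dB xy; move/eqP; rewrite subr_eq => /eqP ->.
  by rewrite lerDr mulr_ge0 ?(bump_ge0 bb)// subr_ge0.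
- wlog xy : x y / x <= y => [H xd yd|_ yd].
    by have [/H->//|/ltW/H->] := leP x y.
  have [z /andP[_ zy]] := MVT_is_derive dB xy.
  rewrite (bump_out bb) ?mul0r => [/eqP|]; first by rewrite subr_eq0 => /eqP.
  by rewrite lerNr in yd *; rewrite (le_trans yd)// -normrN (le_trans _ (ler_norm _))// lerN2.
- wlog xy : x y / x <= y => [H xd yd|xd _].
    by have [/H->//|/ltW/H->] := leP x y.
  have [z /andP[xz _]] := MVT_is_derive dB xy.
  rewrite (bump_out bb) ?mul0r => [/eqP|]; first by rewrite subr_eq0 => /eqP.
  by rewrite (le_trans xd)// (le_trans xz)// ler_norm.
Qed.

Lemma bump_lower_bound : exists2 e : R, 0 < e &
  exists2 c : R, 0 < c & forall x, `|x| <= e -> c <= b x.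
Proof.
have b2 : b 0 / 2 < b 0 by have := bump_gt0 bb; lra.
have cb : b @ (0 : R) --> b 0 by exact: bump_continuous.
have /nbhs_ballP[e /= e0 He] : nbhs (0 : R) [set x | b 0 / 2 <= b x].
  exact: cvgr_ge cb _ b2.
exists (e / 2); first by rewrite divr_gt0.
exists (b 0 / 2); first by rewrite divr_gt0// (bump_gt0 bb).
move=> x xe; apply: He; rewrite /ball/= sub0r normrN.
by rewrite (le_lt_trans xe)//; lra.
Qed.

End bump_theory.

(** * Closure properties of the class C^n *)

Section Ck_closure.
Context (R : realType) (d : nat).
Local Notation V := ('rV[R]_d * R)%type.
Implicit Types (phi psi : V -> R).

Lemma CkW n phi : Ck n.+1 phi -> Ck n phi.
Proof.
elim: n phi => [phi [dphi _] p|n IH phi [dphi cphi]].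
  exact: differentiable_continuous.
by split => // v; exact: IH.
Qed.

Lemma Ck_cst n (c : R) : Ck n (cst c : V -> R).
Proof.
elim: n c => [c p|n IH c]; first exact: cvg_cst.
split=> [p|v]; first exact: differentiable_cst.
rewrite (_ : 'D_v _ = cst 0); first exact: IH.
by apply/funext => p; rewrite derive_cst.
Qed.

Lemma CkD n phi psi : Ck n phi -> Ck n psi -> Ck n (phi + psi).
Proof.
elim: n phi psi => [phi psi cphi cpsi p|n IH phi psi [dphi cphi] [dpsi cpsi]].
  exact: cvgD (cphi p) (cpsi p).
split=> [p|v]; first by apply: differentiableD.
rewrite (_ : 'D_v _ = 'D_v phi + 'D_v psi).
  by apply: IH; [exact: cphi|exact: cpsi].
by apply/funext => p; rewrite deriveD//; exact: diff_derivable.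
Qed.

Lemma CkM n phi psi : Ck n phi -> Ck n psi -> Ck n (phi * psi).
Proof.
elim: n phi psi => [phi psi cphi cpsi p|n IH phi psi sphi spsi].
  exact: cvgM (cphi p) (cpsi p).
case: (sphi) (spsi) => dphi cphi [dpsi cpsi].
split=> [p|v]; first by apply: differentiableM.
rewrite (_ : 'D_v _ = phi * 'D_v psi + psi * 'D_v phi).
  apply: CkD; apply: IH; [exact: CkW|exact: cpsi|exact: CkW|exact: cphi].
by apply/funext => p; rewrite deriveM//; exact: diff_derivable.
Qed.

Lemma Ck_prod n (I : Type) (s : seq I) (f : I -> V -> R) :
  (forall i, Ck n (f i)) -> Ck n (fun p => \prod_(i <- s) f i p).
Proof.
move=> cf; elim: s => [|i s IH].
  rewrite (_ : (fun _ => _) = cst 1); first exact: Ck_cst.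
  by apply/funext => p; rewrite big_nil.
rewrite (_ : (fun _ => _) = f i * (fun p => \prod_(i <- s) f i p)).
  exact: CkM.
by apply/funext => p; rewrite big_cons.
Qed.

(** The derivative of [h \o L] along v is [h' \o L] times the constant [L v]: a function of the same
    form, so the induction closes. *)
Lemma Ck_comp_linear n (h : R -> R) (L : {linear V -> R}) :
  continuous L -> smooth n.+1 h -> Ck n (h \o L).
Proof.
move=> cL; elim: n h => [h sh p|n IH h [h' dh sh]].
  by apply: continuous_comp; [exact: cL|exact: smooth1_continuous sh _].
have dL p : differentiable L p by exact: linear_differentiable.
have dhL p : differentiable h (L p).
  by apply/derivable1_diffP; have [] := dh (L p).
split=> [p|v]; first exact: differentiable_comp.
rewrite (_ : 'D_v _ = (h' \o L) * cst (L v)).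
  by apply: CkM; [exact: IH|exact: Ck_cst].
apply/funext => p; rewrite deriveE; last exact: differentiable_comp.
rewrite diff_comp// /= diff_lin// -[L v]mulr1 -[_ * 1]/(L v *: 1) linearZ/=.
rewrite -deriveE// (_ : 'D_1 h (L p) = h' (L p)); last first.
  by have [] := dh (L p).
by rewrite [_%:A]mulr1 [LHS]mulrC.
Qed.

Lemma Ck_coord n (h : R -> R) i : smooth n.+1 h ->
  Ck n (fun p : V => h (p.1 ord0 i)).
Proof.
move=> sh; have @L : {linear V -> R}.
  by exists (fun p : V => p.1 ord0 i); do 2![eexists]; do ?[constructor];
     rewrite ?mxE// => ? *; rewrite ?mxE//; move=> ?; rewrite !mxE.
have cL : continuous L.
  move=> p; apply: (@continuous_comp _ _ _ fst (fun x : 'rV[R]_d => x ord0 i)).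
    exact: cvg_fst.
  exact: coord_continuous.
exact: (Ck_comp_linear cL sh).
Qed.

Lemma Ck_time n (h : R -> R) : smooth n.+1 h -> Ck n (fun p : V => h p.2).
Proof.
move=> sh; have cL : continuous (@snd 'rV[R]_d R) by move=> p; exact: cvg_snd.
exact: (Ck_comp_linear cL sh).
Qed.

Lemma derive_line phi p v :
  'D_v phi p = 'D_1 (fun tau : R => phi (tau *: v + p)) 0.
Proof.
rewrite /derive (_ : (fun h => h^-1 *: ((phi \o shift p) (h *: v) - phi p)) =
  (fun h : R => h^-1 *: (((fun tau : R => phi (tau *: v + p)) \o shift 0)
    (h *: (1 : R)) - phi (0 *: v + p))))//.
apply/funext => h /=.
by rewrite scale0r add0r addr0 [h *: 1]mulr1.
Qed.

End Ck_closure.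

(** * Test functions of product form and their derivatives *)

Section tensor_test_function.
Context (R : realType) (d : nat) (del : R) (b : R -> R) (bb : bump del b).
Local Notation Rd := 'rV[R]_d.

Implicit Types (x a : Rd).

Definition mollifier (x : Rd) : R := \prod_(i < d) b (x ord0 i).

Definition grad_mollifier (x : Rd) : Rd := \row_i
  (derive1 b (x ord0 i) * \prod_(j < d | j != i) b (x ord0 j)).

Lemma mollifier_ge0 x : 0 <= mollifier x.
Proof. by apply: prodr_ge0 => i _; exact: bump_ge0 bb _. Qed.

Lemma mollifier_out x i : del < `|x ord0 i| -> mollifier x = 0.
Proof.
by move=> xi; rewrite /mollifier (bigD1 i)//= (bump_support bb) ?mul0r.
Qed.

Lemma mollifierN x : mollifier (- x) = mollifier x.
Proof. by apply: eq_bigr => i _; rewrite mxE (bump_even bb). Qed.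

Lemma grad_mollifierN x : grad_mollifier (- x) = - grad_mollifier x.
Proof.
apply/rowP => i; rewrite !mxE (derive1_bumpN bb) mulNr; congr (- (_ * _)).
by apply: eq_bigr => j _; rewrite mxE (bump_even bb).
Qed.

Definition tensor (a : Rd) (chi : R -> R) (p : Rd * R) : R :=
  mollifier (p.1 - a) * chi p.2.

Lemma dt_tensor a (chi : R -> R) (dchi : R) x t :
  is_derive t (1 : R) chi dchi ->
  dt (tensor a chi) x t = mollifier (x - a) * dchi.
Proof.
move=> dc; rewrite /dt derive_line.
rewrite (_ : (fun tau => _) =
    mollifier (x - a) *: (chi \o (fun tau : R => tau + t))); last first.
  by apply/funext => tau; rewrite /tensor/= scaler0 add0r [tau *: 1]mulr1.
have d1 : is_derive (0 : R) (1 : R) (fun tau : R => tau + t) 1.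
  have -> : (fun tau : R => tau + t) = id + cst t by [].
  by apply: is_derive_eq; rewrite addr0.
have dc0 : is_derive ((fun tau : R => tau + t) 0) (1 : R) chi dchi.
  by rewrite add0r.
have := @is_derive1_comp R chi (fun tau : R => tau + t) 0 _ _ dc0 d1.
by rewrite mulr1 => dd; rewrite derive_val.
Qed.

Lemma grad_tensor a (chi : R -> R) x t :
  grad (tensor a chi) x t = chi t *: grad_mollifier (x - a).
Proof.
apply/rowP => i; rewrite !mxE derive_line.
pose P := \prod_(j < d | j != i) b ((x - a) ord0 j).
rewrite (_ : (fun tau => _) =
    (chi t * P) *: (b \o (fun tau : R => tau + (x - a) ord0 i))); last first.
  apply/funext => tau; rewrite /tensor/= /mollifier (bigD1 i)//=.
  have -> : (tau *: delta_mx ord0 i + x - a) ord0 i = tau + (x - a) ord0 i.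
    by rewrite !mxE !eqxx mulr1 addrA.
  have -> : \prod_(j < d | j != i) b ((tau *: delta_mx ord0 i + x - a) ord0 j)
      = P.
    by apply: eq_bigr => j ji; rewrite !mxE eqxx (negbTE ji) mulr0 add0r.
  rewrite scaler0 add0r -[RHS]/(chi t * P * b (tau + (x - a) ord0 i)).
  by ring.
have d1 : is_derive (0 : R) (1 : R) (fun tau : R => tau + (x - a) ord0 i) 1.
  have -> : (fun tau : R => tau + (x - a) ord0 i) = id + cst ((x - a) ord0 i).
    by [].
  by apply: is_derive_eq; rewrite addr0.
have dc0 : is_derive ((fun tau : R => tau + (x - a) ord0 i) 0) (1 : R) b
    (derive1 b ((x - a) ord0 i)).
  by rewrite add0r; exact: bump_is_derive bb _.
have := @is_derive1_comp R b (fun tau : R => tau + (x - a) ord0 i) 0 _ _ dc0 d1.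
rewrite mulr1 => dd; rewrite derive_val.
rewrite -[LHS]/(chi t * P * derive1 b ((x - a) ord0 i)) -mulrA; congr (_ * _).
by rewrite mulrC -/P !mxE.
Qed.

Lemma tensor_test_function T a (chi : R -> R) (al be : R) :
  0 < al -> be < T -> (forall n, smooth n chi) ->
  (forall t, ~~ (al <= t <= be) -> chi t = 0) ->
  test_function T (tensor a chi).
Proof.
move=> al0 beT schi chi0.
pose K := [set x : Rd | forall i, `[a ord0 i - del, a ord0 i + del]%classic (x ord0 i)]
  `*` `[al, be]%classic.
have cK : compact K.
  apply: compact_setX; last exact: segment_compact.
  apply: (@rV_compact R d (fun i => `[a ord0 i - del, a ord0 i + del]%classic)).
  by move=> i; exact: segment_compact.
have clK : closed K.
  exact: (compact_closed (@norm_hausdorff R _) cK).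
have SK : [set p | tensor a chi p != 0] `<=` K.
  move=> [x t] /= /eqP H; split=> /= [i|].
    rewrite in_itv/= -ler_distlC; rewrite leNgt; apply/negP => xi; apply: H.
    by rewrite /tensor (@mollifier_out _ i) ?mul0r//= !mxE distrC.
  by apply: contrapT => /negP; rewrite in_itv/= => /chi0 H'; apply: H; rewrite /tensor/= H' mulr0.
have cSK : closure [set p | tensor a chi p != 0] `<=` K.
  by rewrite ((closure_id K).1 clK); exact: closureS.
split.
- move=> n; apply: CkM; last by apply: Ck_time.
  apply: Ck_prod => i.
  rewrite (_ : (fun p => _) = fun p : Rd * R =>
      (fun y => b (1 * y + - a ord0 i)) (p.1 ord0 i)); last first.
    by apply/funext => p; rewrite !mxE mul1r.
  exact: (Ck_coord i (smooth_affine 1 (- a ord0 i) (bump_smooth bb n.+1))).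
- by apply: (subclosed_compact _ cK cSK); exact: closed_closure.
- apply: subset_trans cSK _ => -[x t] [_] /=; rewrite in_itv/= /QT/=.
  by move=> /andP[alt tbe]; rewrite (lt_le_trans al0)// (le_lt_trans tbe).
Qed.

End tensor_test_function.

(** * Euclidean norm, cubes, and integration over dyadic shells *)

Section enorm_theory.
Context (R : realType) (d : nat).
Local Notation Rd := 'rV[R]_d.
Implicit Types (z : Rd).

Lemma dotvv_ge0 z : 0 <= dotv z z.
Proof. by apply: sumr_ge0 => i _; rewrite -expr2 sqr_ge0. Qed.

Lemma enorm_ge0 z : 0 <= enorm z.
Proof. exact: sqrtr_ge0. Qed.

Lemma enormN z : enorm (- z) = enorm z.
Proof.
by congr Num.sqrt; apply: eq_bigr => i _; rewrite mxE mulrNN.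
Qed.

Lemma coord_le_enorm z i : `|z ord0 i| <= enorm z.
Proof.
rewrite -sqrtr_sqr; apply: ler_wsqrtr; rewrite /dotv (bigD1 i)//= expr2.
by rewrite lerDl; apply: sumr_ge0 => j _; rewrite -expr2 sqr_ge0.
Qed.

Lemma measurable_enorm : measurable_fun setT (@enorm R d).
Proof.
apply: (@eq_measurable_fun _ _ _ _ _ (fun z => dotv z z `^ 2^-1)).
  by move=> z _; rewrite powR12_sqrt// dotvv_ge0.
apply: (measurableT_comp (measurable_powR _)).
apply: measurable_sum => i.
by apply: measurable_funM; exact: measurable_rV_coord.
Qed.

(** Cubes stand in for Euclidean balls: they contain the ball of the same radius, and their measure
    is a product of lengths. *)
Definition box (rho : R) : set Rd := [set z | forall i, `|z ord0 i| <= rho].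

Lemma boxE rho : box rho =
  [set z : Rd | forall i, `[(- rho)%R, rho]%classic (z ord0 i)].
Proof.
apply/seteqP; split => z zi i.
  by rewrite /= in_itv/= -ler_norml; exact: zi.
by have := zi i; rewrite /= in_itv/= -ler_norml.
Qed.

Lemma lebesgue_box rho : 0 <= rho ->
  lebesgue_rV R d (box rho) = ((2 * rho) ^+ d)%:E.
Proof.
move=> rho0; rewrite boxE.
rewrite (@lebesgue_rV_box R d (fun _ => `[(- rho)%R, rho]%classic))//.
under eq_bigr do rewrite lebesgue_measure_itv/= lte_fin.
under eq_bigr => i _.
  rewrite (_ : (if _ then _ else _) = (2 * rho)%:E); first over.
  case: ifPn => [_|]; first by rewrite -EFinB; congr EFin; ring.
  by rewrite -leNgt => ?; congr EFin; lra.
by rewrite prodEFin prodr_const card_ord.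
Qed.

Lemma measurable_box rho : measurable (box rho).
Proof.
rewrite (_ : box rho = \bigcap_(i in [set: 'I_d])
    ((fun x : Rd => x ord0 i) @^-1` [set y | `|y| <= rho])).
  apply: fin_bigcap_measurable => // i _.
  rewrite -[X in measurable X]setTI; apply: measurable_rV_coord => //.
  rewrite (_ : [set y | _] = `[(- rho)%R, rho]%classic).
    exact: measurable_itv.
  by apply/seteqP; split => y; rewrite /= in_itv/= ler_norml.
by apply/seteqP; split => [z H i _|z H i]; [exact: H|exact: (H i I)].
Qed.

Lemma geometric_sum_le (C q : R) n : 0 <= C -> 0 <= q < 1 ->
  \sum_(0 <= j < n) C * q ^+ j <= C / (1 - q).
Proof.
move=> C0 /andP[q0 q1]; rewrite ler_pdivlMr ?subr_gt0//.
suff -> : (\sum_(0 <= j < n) C * q ^+ j) * (1 - q) = C * (1 - q ^+ n).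
  by rewrite ler_piMr// gerBl exprn_ge0.
elim: n => [|n IH]; first by rewrite big_nil mul0r expr0 subrr mulr0.
by rewrite big_nat_recr//= mulrDl IH exprS; ring.
Qed.

(** F is dominated by the sum over j of the constants [a j] on the cubes [box (rho j)], whose
    integrals are bounded by a geometric series. Both the tail and the second moment of the kernel
    are instances. *)
Lemma shell_integral_le (F : Rd -> R) (a rho : nat -> R) (C q : R) :
  (forall z, 0 <= F z) -> (forall j, 0 <= a j) -> (forall j, 0 <= rho j) ->
  (forall z, F z = 0 \/ exists j, box (rho j) z /\ F z <= a j) ->
  0 <= C -> 0 <= q < 1 -> (forall j, a j * (2 * rho j) ^+ d <= C * q ^+ j) ->
  (\int[lebesgue_rV R d]_z (F z)%:E <= (C / (1 - q))%:E)%E.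
Proof.
move=> F0 a0 rho0 HF C0 q01 aC.
pose t j z : \bar R := (a j * \1_(box (rho j)) z)%:E.
have t0 j z : (0 <= t j z)%E by rewrite lee_fin mulr_ge0.
have mt j : measurable_fun setT (t j).
  apply/measurable_EFinP; apply: measurable_funM => //.
  by apply: measurable_indic; exact: measurable_box.
apply: (@le_trans _ _ (\int[lebesgue_rV R d]_z (\sum_(0 <= j <oo) t j z))%E).
  apply: ge0_le_integral_pointwise => [z|z]; first by rewrite lee_fin.
  have s0 : (0 <= \sum_(0 <= j <oo) t j z)%E by exact: nneseries_ge0.
  have [->//|[j [zj Fj]]] := HF z.
  have := @nneseries_lim_ge R (t ^~ z) xpredT 0%N j.+1 (fun n _ _ => t0 n z).
  apply: le_trans; rewrite big_nat_recr//=.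
  apply: le_trans (leeDr _ _); last exact: sume_ge0.
  by rewrite /t indicE mem_set// mulr1 lee_fin.
rewrite integral_nneseries//.
have cv := @is_cvg_nneseries R (fun j => \int[lebesgue_rV R d]_z t j z)%E xpredT 0%N.
apply: lime_le; first by apply: cv => n _ _; exact: integral_ge0.
apply: nearW => n; apply: (@le_trans _ _ (\sum_(0 <= j < n) C * q ^+ j)%:E).
  rewrite -sumEFin; apply: lee_sum => j _; rewrite /t.
  under eq_integral do rewrite EFinM.
  rewrite ge0_integralZl//; last 2 first.
    by apply/measurable_EFinP/measurable_indic; exact: measurable_box.
    by rewrite lee_fin.
  rewrite integral_indic//; last exact: measurable_box.
  by rewrite setIT [X in (_ * X)%E](lebesgue_box (rho0 j)) -EFinM lee_fin.
by rewrite lee_fin geometric_sum_le.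
Qed.

End enorm_theory.

(** * Tail and second moment of the Levy kernel *)

Section levy_kernel.
Context (R : realType) (d : nat) (lam : R) (lam02 : 0 < lam < 2).
Local Notation Rd := 'rV[R]_d.
Local Notation leb := (lebesgue_rV R d).
Implicit Types (z : Rd) (r s x : R).

Definition kern z : R := (enorm z `^ (d%:R + lam))^-1.

Lemma kern_ge0 z : 0 <= kern z.
Proof. by rewrite invr_ge0 powR_ge0. Qed.

Lemma kernN z : kern (- z) = kern z.
Proof. by rewrite /kern enormN. Qed.

Lemma measurable_kern : measurable_fun setT kern.
Proof.
rewrite (_ : kern = fun z => enorm z `^ (- (d%:R + lam))); last first.
  by apply/funext => z; rewrite powRN.
exact: measurableT_comp (measurable_powR _) (@measurable_enorm R d).
Qed.

Let lam0 : 0 < lam. Proof. by case/andP: lam02. Qed.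
Let p0 : 0 <= d%:R + lam. Proof. by rewrite addr_ge0// ltW. Qed.

Let powR_split s : 0 < s -> s `^ (d%:R + lam) = s ^+ d * s `^ lam.
Proof.
move=> s0; rewrite powRD ?powR_mulrn// ?ltW//.
by apply/implyP => _; rewrite gt_eqF.
Qed.

Let powR_expn s (e : R) j : 0 <= s -> (s ^+ j) `^ e = (s `^ e) ^+ j.
Proof.
by move=> s0; rewrite -!powR_mulrn ?powR_ge0// -!powRrM mulrC.
Qed.

Let kern_le s z : 0 < s -> s <= enorm z -> kern z <= (s `^ (d%:R + lam))^-1.
Proof.
move=> s0 sz; rewrite lef_pV2 ?posrE ?powR_gt0//; last exact: lt_le_trans sz.
by apply: ge0_ler_powR; rewrite ?nnegrE// ?enorm_ge0 ?ltW.
Qed.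

Let dyadic r x : 0 < r -> r < x -> exists j, r * 2 ^+ j < x <= r * 2 ^+ j.+1.
Proof.
move=> r0 rx; have ex : exists j, x <= r * 2 ^+ j.
  exists (Num.truncn (x / r)).+1; rewrite -ler_pdivrMl// mulrC.
  apply: (le_trans (ltW (truncnS_gt _))).
  by rewrite -natrX ler_nat ltnW// ltn_expl.
case: (ex_minnP ex) => -[|j] xj jmin.
  by move: xj; rewrite expr0 mulr1 leNgt rx.
exists j; rewrite xj andbT ltNge; apply/negP => /jmin.
by rewrite ltnn.
Qed.

Let one_powR (e : R) : 1 `^ e = 1. Proof. by rewrite powR1. Qed.

(** On the shell between s = r 2^j and 2s the kernel is at most s^-(d + lam), and the shell lies in
    a cube of side 4s, which explains 4^d. The resulting bounds decrease with ratio 2^-lam, below 1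
    because lam > 0. *)
Lemma kern_far_le r : 0 < r -> exists M : R,
  (\int[leb]_z ((r < enorm z)%R%:R * kern z)%:E <= M%:E)%E.
Proof.
move=> r0; have q1 : (2 `^ lam)^-1 < 1 :> R.
  rewrite invf_lt1 ?powR_gt0// -[ltLHS](one_powR lam).
  by apply: gt0_ltr_powR => //; rewrite ?nnegrE// ltr1n.
exists (4 ^+ d * (r `^ lam)^-1 / (1 - (2 `^ lam)^-1)).
have s0 j : 0 < r * 2 ^+ j by rewrite mulr_gt0// exprn_gt0.
apply: (shell_integral_le (a := fun j => ((r * 2 ^+ j) `^ (d%:R + lam))^-1)
    (rho := fun j => r * 2 ^+ j.+1)).
- by move=> z; rewrite mulr_ge0// kern_ge0.
- by move=> j; rewrite invr_ge0 powR_ge0.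
- by move=> j; rewrite ltW.
- move=> z; have [rz|rz] := ltP r (enorm z); last by left; rewrite mul0r.
  right; have [j /andP[lo hi]] := dyadic r0 rz.
  exists j; split; first by move=> i; exact: le_trans (coord_le_enorm z i) hi.
  by rewrite mul1r kern_le// ltW.
- by rewrite mulr_ge0 ?exprn_ge0// invr_ge0 powR_ge0.
- by rewrite q1 invr_ge0 powR_ge0.
move=> j; rewrite powR_split// powRM ?exprn_ge0 ?(ltW r0)// powR_expn//.
rewrite (_ : 2 * (r * 2 ^+ j.+1) = 4 * (r * 2 ^+ j)); last by rewrite exprS; ring.
set s := r * 2 ^+ j; rewrite [(4 * s) ^+ d]exprMn exprVn.
have h1 : s ^+ d != 0 by rewrite expf_neq0// gt_eqF// s0.
have h2 : r `^ lam != 0 by rewrite gt_eqF// powR_gt0.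
have h3 : (2 `^ lam) ^+ j != 0 :> R by rewrite expf_neq0// gt_eqF// powR_gt0.
rewrite le_eqVlt; apply/orP; left; apply/eqP; field.
by rewrite h1 h2 h3.
Qed.

(** On shells shrinking to the origin the contributions have ratio 2^-(2 - lam), below 1 because lam
    < 2. The factor in r is kept explicit, as it is what tends to 0 with r. *)
Lemma kern_second_moment_le : exists2 C : R, 0 <= C & forall r, 0 < r ->
  (\int[leb]_z ((enorm z < r)%R%:R * (enorm z ^+ 2 * kern z))%:E <=
   (C * r `^ (2 - lam))%:E)%E.
Proof.
have l2 : 0 < 2 - lam by rewrite subr_gt0; case/andP: lam02.
pose q : R := 2^-1 `^ (2 - lam).
have q1 : q < 1.
  rewrite -[ltRHS](one_powR (2 - lam)).
  by apply: gt0_ltr_powR => //; rewrite ?nnegrE// ?invr_ge0// invf_lt1// ltr1n.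
exists (4 ^+ d * 2 `^ lam / (1 - q)).
  by rewrite divr_ge0 ?mulr_ge0 ?exprn_ge0 ?powR_ge0// subr_ge0 ltW.
move=> r r0; rewrite mulrAC.
have s0 j : 0 < r * 2^-1 ^+ j by rewrite mulr_gt0// exprn_gt0.
have sh0 j : 0 < r * 2^-1 ^+ j.+1 by exact: s0.
apply: (shell_integral_le (rho := fun j => r * 2^-1 ^+ j)
  (a := fun j => (r * 2^-1 ^+ j) ^+ 2 * ((r * 2^-1 ^+ j.+1) `^ (d%:R + lam))^-1)).
- by move=> z; rewrite mulr_ge0// mulr_ge0 ?sqr_ge0 ?kern_ge0.
- by move=> j; rewrite mulr_ge0 ?sqr_ge0// invr_ge0 powR_ge0.
- by move=> j; rewrite ltW.
- move=> z; have [zr|zr] := ltP (enorm z) r; last by left; rewrite mul0r.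
  (* The origin lies in no shell; there the square of the norm makes the integrand 0. *)
  have [z0|z0] := leP (enorm z) 0.
    have -> : enorm z = 0 by apply/eqP; rewrite eq_le z0 enorm_ge0.
    by left; rewrite expr0n/= mul0r mulr0.
  (* [dyadic] is applied upside down, with the norm of z as base radius and r as target, so that
     shells are counted downwards from r. *)
  right; have [j /andP[lo hi]] := dyadic z0 zr.
  have hi' : enorm z <= r * 2^-1 ^+ j.
    by rewrite exprVn -ler_pdivrMr ?invr_gt0 ?exprn_gt0// invrK ltW.
  have lo' : r * 2^-1 ^+ j.+1 <= enorm z.
    by rewrite exprVn ler_pdivrMr ?exprn_gt0.
  exists j; split; first by move=> i; exact: le_trans (coord_le_enorm z i) hi'.
  rewrite mul1r ler_pM ?sqr_ge0 ?kern_ge0 ?kern_le//.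
  by rewrite ler_pXn2r// ?nnegrE ?enorm_ge0// ltW.
- by rewrite !mulr_ge0 ?exprn_ge0 ?powR_ge0.
- by rewrite q1 powR_ge0.
move=> j; set s := r * 2^-1 ^+ j.
have sE : r * 2^-1 ^+ j.+1 = s * 2^-1 by rewrite exprSr mulrA.
rewrite sE powR_split ?mulr_gt0 ?invr_gt0// -/s.
have sp : 0 < s by exact: s0.
rewrite [(s * 2^-1) `^ lam]powRM ?invr_ge0 ?(ltW sp)//.
have -> : 2^-1 `^ lam = (2 `^ lam)^-1 :> R.
  by rewrite -powR_inv1// -powRrM mulN1r powRN.
have -> : 4 ^+ d * 2 `^ lam * r `^ (2 - lam) * q ^+ j =
    4 ^+ d * 2 `^ lam * s `^ (2 - lam).
  by rewrite -mulrA /s powRM ?exprn_ge0 ?(ltW r0)// powR_expn.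
have -> : s `^ (2 - lam) = s ^+ 2 * (s `^ lam)^-1.
  rewrite powRD; last by apply/implyP => _; rewrite gt_eqF.
  by rewrite powRN (powR_mulrn 2)// ltW.
have h1 : s ^+ d != 0 by rewrite expf_neq0// gt_eqF.
have h2 : s `^ lam != 0 by rewrite gt_eqF// powR_gt0.
have h3 : 2 `^ lam != 0 :> R by rewrite gt_eqF// powR_gt0.
have h4 : 2 ^+ d != 0 :> R by rewrite expf_neq0.
have -> : (4 : R) ^+ d = 2 ^+ d * 2 ^+ d by rewrite -exprMn; congr (_ ^+ _); ring.
rewrite [(2 * s) ^+ d]exprMn [(s * 2^-1) ^+ d]exprMn exprVn.
rewrite le_eqVlt; apply/orP; left; apply/eqP; field.
by rewrite h1 h2 h3 h4.
Qed.

End levy_kernel.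

(** * Real-valued integrals and integrability *)

Section Rintegral_facts.
Context d d' (T : measurableType d) (S : measurableType d') (R : realType).
Context (mu : {measure set T -> \bar R}) (nu : {measure set S -> \bar R}).

Lemma Rintegral_norm_le (f h : T -> R) (M : R) :
  mu.-integrable setT (EFin \o f) -> (forall x, `|f x| <= h x) ->
  (\int[mu]_x (h x)%:E <= M%:E)%E -> `|\int[mu]_x f x| <= M.
Proof.
move=> fi fh hM; apply: le_trans (le_normr_Rintegral measurableT fi) _.
rewrite -lee_fin /Rintegral fineK.
  apply: le_trans hM; apply: ge0_le_integral_pointwise => x.
    by rewrite lee_fin.
  by rewrite lee_fin.
by apply: integrable_fin_num => //; exact: (integrable_norm fi).
Qed.

Lemma Rintegral_preserving (phi : T -> S) (f : S -> R) :
  preserving mu nu phi -> nu.-integrable setT (EFin \o f) ->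
  \int[mu]_x f (phi x) = \int[nu]_y f y.
Proof. by move=> pphi fi; congr fine; exact: (integral_preserving pphi fi). Qed.

Lemma integrable_le (f h : T -> R) : measurable_fun setT f ->
  (forall x, `|f x| <= h x) -> mu.-integrable setT (EFin \o h) ->
  mu.-integrable setT (EFin \o f).
Proof.
move=> mf fh; apply: le_integrable => //; first exact/measurable_EFinP.
by move=> x _; rewrite /= lee_fin (le_trans (fh x))// ler_norm.
Qed.

Lemma integrable_mull (k : R) (f : T -> R) : mu.-integrable setT (EFin \o f) ->
  mu.-integrable setT (EFin \o (fun x => k * f x)).
Proof. exact: (integrableZl measurableT). Qed.

Lemma ge0_integral_mull_le (k M : R) (f : T -> R) : 0 <= k ->
  measurable_fun setT f -> (forall x, 0 <= f x) ->
  (\int[mu]_x (f x)%:E <= M%:E)%E -> (\int[mu]_x (k * f x)%:E <= (k * M)%:E)%E.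
Proof.
move=> k0 mf f0 fM; under eq_integral do rewrite EFinM.
rewrite ge0_integralZl ?lee_fin//; last 2 first.
- exact/measurable_EFinP.
- by move=> x _; rewrite lee_fin.
by rewrite EFinM lee_wpmul2l// lee_fin.
Qed.

Lemma integrable_add (f g : T -> R) : mu.-integrable setT (EFin \o f) ->
  mu.-integrable setT (EFin \o g) ->
  mu.-integrable setT (EFin \o (fun x => f x + g x)).
Proof. by move=> fi gi; exact: (integrableD measurableT fi gi). Qed.

Lemma integrable_sub (f g : T -> R) : mu.-integrable setT (EFin \o f) ->
  mu.-integrable setT (EFin \o g) ->
  mu.-integrable setT (EFin \o (fun x => f x - g x)).
Proof. by move=> fi gi; exact: (integrableB measurableT fi gi). Qed.

End Rintegral_facts.

(** * Size of the near part of the operator *)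

Section g_small_bound.
Context (R : realType) (d : nat) (lam : R) (lam02 : 0 < lam < 2).
Local Notation Rd := 'rV[R]_d.
Local Notation leb := (lebesgue_rV R d).
Implicit Types (phi : Rd -> R) (x z : Rd) (D : set Rd).

Lemma levy_integralE c D phi x : levy_integral lam c D phi x =
  c * \int[leb]_z (\1_D z * ((phi (x + z) - phi x) * kern lam z)).
Proof.
rewrite /levy_integral Rintegral_mkcond; congr (_ * _).
apply: eq_Rintegral => z _; rewrite patchE indicE.
by case: ifPn; rewrite ?mul1r ?mul0r.
Qed.

Lemma measurable_enorm_gt r : measurable [set z : Rd | r < enorm z].
Proof.
rewrite (_ : [set _ | _] = setT `&` @enorm R d @^-1` `]r, +oo[%classic).
  by apply: measurable_enorm => //; exact: measurable_itv.
by rewrite setTI; apply/seteqP; split => z; rewrite /= in_itv/= andbT.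
Qed.

Lemma measurable_enorm_lt r : measurable [set z : Rd | enorm z < r].
Proof.
rewrite (_ : [set _ | _] = setT `&` @enorm R d @^-1` `]-oo, r[%classic).
  by apply: measurable_enorm => //; exact: measurable_itv.
by rewrite setTI; apply/seteqP; split => z; rewrite /= in_itv/=.
Qed.

Lemma integrable_far r : 0 < r ->
  leb.-integrable setT (EFin \o (fun z => (r < enorm z)%R%:R * kern lam z)).
Proof.
move=> r0; apply: ge0_integrable => [|z|].
- apply/measurable_EFinP; apply: measurable_funM; last exact: measurable_kern.
  rewrite (_ : (fun z : Rd => _) = \1_[set z : Rd | r < enorm z]).
    by apply: measurable_indic; exact: measurable_enorm_gt.
  by apply/funext => z; rewrite indicE; congr (nat_of_bool _)%:R; apply/idP/idP; rewrite inE.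
- by rewrite lee_fin mulr_ge0// kern_ge0.
- by have [M] := kern_far_le d lam02 r0; move=> /le_lt_trans; apply; rewrite ltry.
Qed.

(** This replaces a proof that the principal value exists: without convergence [lim] takes the
    default value 0, which satisfies the bound too. *)
Lemma lim_norm_le (f : R -> R) (M : R) : 0 <= M ->
  (forall b, 0 < b -> `|f b| <= M) -> `|lim (f b @[b --> 0^'+])| <= M.
Proof.
move=> M0 fM; have nf : \forall b \near 0^'+, `|f b| <= M.
  by near=> b; apply: fM.
have [cf|ncf] := pselect (cvg (f b @[b --> 0^'+])).
  rewrite ler_norml; apply/andP; split.
    by apply: limr_ge => //; apply: filterS nf => b; rewrite ler_norml => /andP[].
  by apply: limr_le => //; apply: filterS nf => b; rewrite ler_norml => /andP[].
by rewrite (dvgP ncf) normr0.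
Unshelve. all: by end_near. Qed.

Lemma g_small_eq0 c r phi x :
  (forall z, enorm z < r -> phi (x + z) = phi x) -> g_small lam c r phi x = 0.
Proof.
move=> phi0; apply/eqP; rewrite -normr_le0; apply: lim_norm_le => // b b0.
rewrite levy_integralE (_ : Rintegral _ _ _ = 0) ?mulr0 ?normr0//.
under eq_Rintegral => z _.
  rewrite (_ : _ * _ = 0); first over.
  rewrite indicE; case: (boolP (_ \in _)); rewrite ?mul0r// inE/= => /andP[_ zr].
  by rewrite phi0// subrr mul0r mulr0.
by rewrite Rintegral_cst// mul0r.
Qed.

Let norm_half_le (I M : R) : `|I| <= M -> `|2^-1 * I| <= M.
Proof.
move=> H; rewrite normrM ger0_norm//; apply: le_trans H.
by rewrite ler_piMl// invf_le1// ler1n.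
Qed.

(** The annulus and the kernel are even, so averaging over z and -z turns the first difference of
    phi into half of a second difference. That one is quadratic in the norm of z, which makes the
    bound independent of the inner radius b. *)
Lemma g_small_le c r phi x (K M : R) : 0 <= c -> 0 < r -> 0 <= M ->
  measurable_fun setT phi -> (forall y, `|phi y| <= K) ->
  (forall z, `|phi (x + z) + phi (x - z) - 2 * phi x| <= K * enorm z ^+ 2) ->
  (\int[leb]_z ((enorm z < r)%R%:R * (enorm z ^+ 2 * kern lam z))%:E <= M%:E)%E ->
  `|g_small lam c r phi x| <= c * (K * M).
Proof.
move=> c0 r0 M0 mphi phiK phi2 hM.
have K0 : 0 <= K by exact: le_trans (phiK x).
apply: lim_norm_le => [|b b0]; first by rewrite !mulr_ge0.
rewrite levy_integralE normrM (ger0_norm c0) ler_wpM2l//.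
set D := [set _ | _]; pose G z := \1_D z * ((phi (x + z) - phi x) * kern lam z).
have mD : measurable D.
  rewrite (_ : D = [set z | b < enorm z] `&` [set z | enorm z < r]).
    by apply: measurableI; [exact: measurable_enorm_gt|exact: measurable_enorm_lt].
  by apply/seteqP; split => z /=; [move/andP|move=> [? ?]; apply/andP].
(* Separating z from -z needs the integrability of each half; it holds because b > 0 cuts off the
   singularity. *)
have Gi : leb.-integrable setT (EFin \o G).
  apply: (integrable_le _ _ (integrable_mull (2 * K) (integrable_far b0))).
    apply: measurable_funM; first exact: measurable_indic.
    apply: measurable_funM; last exact: measurable_kern.
    apply: measurable_funB => //; apply: (measurableT_comp mphi).
    rewrite (_ : +%R x = (fun z => z + x)).
      exact: (preserving_rVD x).1.
    by apply/funext => z; rewrite addrC.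
  move=> z; rewrite /G indicE; have [|_] := boolP (z \in D); last first.
    by rewrite mul0r normr0 !mulr_ge0// kern_ge0.
  rewrite inE => /andP[-> _]; rewrite !mul1r normrM (ger0_norm (kern_ge0 _ _)).
  rewrite ler_wpM2r ?kern_ge0// (le_trans (ler_normB _ _))//.
  by rewrite mulr_natl mulr2n lerD.
have GNi : leb.-integrable setT (EFin \o (fun z => G (- z))).
  exact: (integrable_preserving (preserving_rVN R d) Gi).
have GN := Rintegral_preserving (preserving_rVN R d) Gi.
rewrite -/(Rintegral _ _ G).
have -> : \int[leb]_z G z = 2^-1 * \int[leb]_z (G z + G (- z)).
  rewrite (RintegralD measurableT Gi GNi) GN; move: (Rintegral _ _ _) => I.
  by rewrite -mulr2n -(mulr_natl I) mulKf.
have DN z : \1_D (- z) = \1_D z :> R.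
  rewrite !indicE; congr (nat_of_bool _)%:R.
  by apply/idP/idP; rewrite !inE /D/= enormN.
have h0 z : 0 <= (enorm z < r)%R%:R * (enorm z ^+ 2 * kern lam z).
  exact: mulr_ge0 (ler0n _ _) (mulr_ge0 (sqr_ge0 _) (kern_ge0 _ _)).
have H : `|\int[leb]_z (G z + G (- z))| <= K * M.
  apply: (Rintegral_norm_le (h := fun z =>
    K * ((enorm z < r)%R%:R * (enorm z ^+ 2 * kern lam z)))).
  - exact: integrable_add.
  - move=> z; rewrite /G DN kernN indicE.
    have [|_] := boolP (z \in D); last first.
      by rewrite !mul0r addr0 normr0; exact: mulr_ge0 K0 (h0 z).
    rewrite inE => /andP[_ ->]; rewrite !mul1r -mulrDl normrM.
    rewrite (ger0_norm (kern_ge0 lam z)) [leRHS]mulrA.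
    apply: ler_wpM2r; first exact: kern_ge0.
    by apply: le_trans (phi2 z); rewrite le_eqVlt; apply/orP; left; apply/eqP; congr `|_|; ring.
  - apply: ge0_integral_mull_le; [exact: K0| |exact: h0|exact: hM].
    apply: measurable_funM.
      rewrite (_ : (fun z : Rd => _) = \1_[set z : Rd | enorm z < r]).
        by apply: measurable_indic; exact: measurable_enorm_lt.
      apply/funext => z; rewrite indicE; congr (nat_of_bool _)%:R.
      by apply/idP/idP; rewrite inE.
    apply: measurable_funM; last exact: measurable_kern.
    by apply: measurable_funX; exact: measurable_enorm.
exact: norm_half_le H.
Qed.

End g_small_bound.

(** * Products of sigma-finite measures and Fubini for real-valued integrals *)

Section prod_measure.
Context d1 d2 (T1 : measurableType d1) (T2 : measurableType d2) (R : realType).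
Context (m1 : {sigma_finite_measure set T1 -> \bar R}).
Context (m2 : {sigma_finite_measure set T2 -> \bar R}).
Local Open Scope ereal_scope.

Let sigma_finite_prod : sigma_finite setT (m1 \x m2).
Proof.
have /sigma_finiteP[F [TF ndF Foo]] := sigma_finiteT m1.
have /sigma_finiteP[G [TG ndG Goo]] := sigma_finiteT m2.
exists (fun n => F n `*` G n).
 rewrite -setXTT TF TG predeqE => -[x y]; split.
    move=> [/= [n _ Fnx] [k _ Gky]]; exists (maxn n k) => //; split.
    - by move: x Fnx; exact/subsetPset/ndF/leq_maxl.
    - by move: y Gky; exact/subsetPset/ndG/leq_maxr.
  by move=> [n _ []/= ? ?]; split; exists n.
move=> k; have [? ?] := Foo k; have [? ?] := Goo k.
split; first exact: measurableX.
by rewrite product_measure1E// lte_mul_pinfty// ge0_fin_numE.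
Qed.

Definition prod_measure_set : set (T1 * T2)%type -> \bar R := m1 \x m2.
HB.instance Definition _ := Measure.on prod_measure_set.
HB.instance Definition _ := @Measure_isSigmaFinite.Build _ _ _
  prod_measure_set sigma_finite_prod.

(* The library's sigma-finite structure on [m1 \x m2] is not inferred. *)
Definition prod_measure : {sigma_finite_measure set (T1 * T2)%type -> \bar R} :=
  prod_measure_set.

Section Rintegral_fubini.
Context (G : T1 * T2 -> R) (Gi : (m1 \x m2).-integrable setT (EFin \o G)).

Lemma integrable_fubini_Rintegral : m1.-integrable setT
  (EFin \o (fun x => \int[m2]_y G (x, y))%R).
Proof.
have Fi := integrable_fubini_F Gi.
apply: (le_integrable measurableT _ _ Fi).
  apply/measurable_EFinP; apply: (measurableT_comp (fine_measurable measurableT)).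
  exact: measurable_int Fi.
have fine_le (y : \bar R) : `|(fine y)%:E| <= `|y|.
  by case: y => [r||] //=; rewrite normr0 leey.
by move=> x _; exact: fine_le.
Qed.

(** The real-valued inner integral differs from the extended one only where the latter is infinite,
    and integrability confines this to a null set. *)
Lemma integral_fubini_Rintegral :
  \int[m1]_x (\int[m2]_y G (x, y))%R%:E = \int[m1 \x m2]_p (G p)%:E.
Proof.
have Fi := integrable_fubini_F Gi.
rewrite -[RHS](integral12_prod_meas1 Gi).
apply: ae_eq_integral => //.
- exact: measurable_int integrable_fubini_Rintegral.
- exact: measurable_int Fi.
- have := integrable_ae measurableT Fi; apply: filterS => x /= H _.
  by rewrite /Rintegral fineK//; exact: H.
Qed.

End Rintegral_fubini.

Lemma integrable_tensor (f : T1 -> R) (g : T2 -> R) :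
  m1.-integrable setT (EFin \o f) -> m2.-integrable setT (EFin \o g) ->
  (m1 \x m2).-integrable setT (EFin \o (fun p => f p.1 * g p.2)%R).
Proof.
move=> fi gi.
have mf := integrable_measurable fi; have mg := integrable_measurable gi.
have mfg : measurable_fun setT (fun p : T1 * T2 => f p.1 * g p.2)%R.
  by apply: measurable_funM; [exact: measurableT_comp mf _|exact: measurableT_comp mg _].
apply/(integrable12ltyP m1 m2); first exact/measurable_EFinP.
have H x : \int[m2]_y `|(EFin \o (fun p : T1 * T2 => f p.1 * g p.2)%R) (x, y)| =
    `|f x|%:E * \int[m2]_y `|g y|%:E.
  rewrite -ge0_integralZl//; last first.
    by apply/measurable_EFinP; exact: measurableT_comp mg.
  by apply: eq_integral => y _; rewrite /= normrM.
under eq_integral do rewrite H.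
rewrite ge0_integralZr//; first last.
- exact: integral_ge0.
- by apply/measurable_EFinP; exact: measurableT_comp mf.
have [_ f1] := integrableP _ _ _ fi; have [_ g1] := integrableP _ _ _ gi.
by apply: lte_mul_pinfty => //; rewrite ?ge0_fin_numE//; exact: integral_ge0.
Qed.

End prod_measure.

(** * Averages of increments under measure-preserving maps *)

Section levy_average.
Context d1 d2 (T : measurableType d1) (S : measurableType d2) (R : realType).
Context (m : {sigma_finite_measure set T -> \bar R}).
Context (n : {sigma_finite_measure set S -> \bar R}).
Context (tau : S -> T -> T) (k : S -> R) (H : T -> R).
Hypothesis ptau : forall z, preserving m m (tau z).
Hypothesis mtau : measurable_fun setT (fun q : T * S => tau q.2 q.1).
Hypothesis ki : n.-integrable setT (EFin \o k).
Hypothesis Hi : m.-integrable setT (EFin \o H).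
Local Open Scope ereal_scope.

Let mH := integrable_measurable Hi.
Let mk := integrable_measurable ki.

Let shifted_integrable : (m \x n).-integrable setT
  (EFin \o (fun q => H (tau q.2 q.1) * k q.2)%R).
Proof.
have mF : measurable_fun setT (fun q : T * S => H (tau q.2 q.1) * k q.2)%R.
  apply: measurable_funM; first exact: measurableT_comp mH mtau.
  exact: measurableT_comp mk _.
apply/(integrable21ltyP m n); first exact/measurable_EFinP.
have E z : \int[m]_x `|(EFin \o (fun q : T * S => H (tau q.2 q.1) * k q.2)%R) (x, z)|
    = `|k z|%:E * \int[m]_x `|H x|%:E.
  have mn : measurable_fun setT (fun x => `|H x|%:E).
    by apply/measurable_EFinP; exact: measurableT_comp mH.
  rewrite -(ge0_integral_preserving (ptau z) (f := fun x => `|H x|%:E))//.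
  rewrite -ge0_integralZl//; last exact: measurableT_comp mn (ptau z).1.
  by apply: eq_integral => x _; rewrite /= normrM mulrC.
under eq_integral do rewrite E.
rewrite ge0_integralZr//; first last.
- exact: integral_ge0.
- by apply/measurable_EFinP; exact: measurableT_comp mk.
have [_ H1] := integrableP _ _ _ Hi; have [_ k1] := integrableP _ _ _ ki.
by apply: lte_mul_pinfty => //; rewrite ?ge0_fin_numE//; exact: integral_ge0.
Qed.

(** The far part of the operator in abstract form. It serves twice: with shifts of one point of
    space-time it is the far operator itself, and with common shifts of two points it bounds the
    dissipation. *)
Definition levy_average x : R := (\int[n]_z ((H (tau z x) - H x) * k z))%R.

Let increment_integrable : (m \x n).-integrable setT
  (EFin \o (fun q => (H (tau q.2 q.1) - H q.1) * k q.2)%R).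
Proof.
have := integrable_sub shifted_integrable (integrable_tensor Hi ki).
by congr (integrable _ _ _); apply/funext => q /=; rewrite mulrBl.
Qed.

Lemma integrable_levy_average : m.-integrable setT (EFin \o levy_average).
Proof. exact: (integrable_fubini_Rintegral increment_integrable). Qed.

(** After exchanging the integrals, for each fixed z the increment of H has integral 0, since
    [tau z] preserves the measure. *)
Lemma integral_levy_average : \int[m]_x (levy_average x)%:E = 0.
Proof.
rewrite (integral_fubini_Rintegral increment_integrable).
rewrite -(integral21_prod_meas1 increment_integrable).
rewrite integral0_eq// => z _; rewrite /fubini_G/=.
have i1 := integrable_preserving (ptau z) Hi.
under eq_integral do rewrite mulrC EFinM.
rewrite integralZl//; last exact: integrable_sub i1 Hi.
under eq_integral do rewrite EFinB.
rewrite integralB// (integral_preserving (ptau z) Hi) subee ?mule0//.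
exact: integrable_fin_num.
Qed.

End levy_average.

(** * Integrability near the diagonal of doubled space-time *)

Section near_diagonal.
Context (R : realType) (d : nat).
Local Notation Z := ('rV[R]_d * measurableTypeR R)%type.
Implicit Types (X Y W : Z) (rho : R).

Definition space_time : {sigma_finite_measure set Z -> \bar R} :=
  prod_measure (lebesgue_rV R d) (@lebesgue_measure R).
Local Notation mu := space_time.

Definition doubled : {sigma_finite_measure set (Z * Z)%type -> \bar R} :=
  prod_measure mu mu.

Lemma preserving_space_timeD W : preserving mu mu (fun X : Z => X + W).
Proof.
exact: (preserving_prod (preserving_rVD W.1) (preserving_lebesgueD W.2)).
Qed.

Lemma preserving_space_timeN : preserving mu mu (fun X : Z => - X).
Proof.
exact: (preserving_prod (preserving_rVN R d) (preserving_lebesgueN R)).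
Qed.

Lemma measurable_offset : measurable_fun setT (fun p : Z * Z => p.2 - p.1).
Proof.
apply/measurable_fun_pairP; split => /=.
  apply: measurable_fun_rVP => i.
  rewrite (_ : (fun p => _) = fun p : Z * Z =>
    p.2.1 ord0 i - p.1.1 ord0 i); last first.
    by apply/funext => p; rewrite !mxE.
  apply: measurable_funB.
    apply: (measurableT_comp (measurable_rV_coord i)).
    exact: (measurableT_comp measurable_fst measurable_snd).
  apply: (measurableT_comp (measurable_rV_coord i)).
  exact: (measurableT_comp measurable_fst measurable_fst).
apply: measurable_funB.
  exact: (measurableT_comp measurable_snd measurable_snd).
exact: (measurableT_comp measurable_snd measurable_fst).
Qed.

Definition band rho : set Z := box rho `*` [set t | `|t| <= rho].

Lemma band_intervalE rho : band rho = box rho `*` `[(- rho)%R, rho]%classic.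
Proof.
by congr setX; apply/seteqP; split => t; rewrite /= in_itv/= ler_norml.
Qed.

Lemma measurable_band rho : measurable (band rho).
Proof.
rewrite band_intervalE; apply: measurableX; first exact: measurable_box.
exact: measurable_itv.
Qed.

Lemma space_time_band rho : 0 < rho ->
  mu (band rho) = ((2 * rho) ^+ d.+1)%:E.
Proof.
move=> r0; rewrite band_intervalE.
have Ei : (@lebesgue_measure R) `[(- rho)%R, rho]%classic = (2 * rho)%:E.
  rewrite lebesgue_measure_itv/= lte_fin ifT; last by lra.
  by rewrite -EFinB; congr EFin; lra.
rewrite [LHS]product_measure1E; [|exact: measurable_box|exact: measurable_itv].
rewrite [X in (X * _)%E](lebesgue_box d (ltW r0)) [X in (_ * X)%E]Ei.
by rewrite -EFinM -exprSr.
Qed.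

Lemma measurable_band_indic rho :
  measurable_fun setT (fun p : Z * Z => \1_(band rho) (p.2 - p.1) : R).
Proof.
apply: (measurableT_comp _ measurable_offset).
by apply: measurable_indic; exact: measurable_band.
Qed.

Lemma integral_band_left rho Y : 0 < rho ->
  (\int[mu]_X (\1_(band rho) (Y - X))%:E = ((2 * rho) ^+ d.+1)%:E)%E.
Proof.
move=> r0; rewrite -space_time_band//.
have pY : preserving mu mu ((fun X : Z => X + Y) \o (fun X => - X)).
  exact: preserving_comp preserving_space_timeN (preserving_space_timeD Y).
have mi : measurable_fun setT (fun X => (\1_(band rho) X : R)%:E).
  by apply/measurable_EFinP/measurable_indic; exact: measurable_band.
rewrite -[mu (band rho)]/(mu (band rho)) -[band rho in RHS]setIT.
rewrite -integral_indic//; last exact: measurable_band.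
rewrite -[RHS](ge0_integral_preserving pY mi); last first.
  by move=> X; rewrite lee_fin.
by apply: eq_integral => X _; rewrite /= addrC.
Qed.

Lemma integral_band_right rho X : 0 < rho ->
  (\int[mu]_Y (\1_(band rho) (Y - X))%:E = ((2 * rho) ^+ d.+1)%:E)%E.
Proof.
move=> r0; rewrite -space_time_band//.
have mi : measurable_fun setT (fun X => (\1_(band rho) X : R)%:E).
  by apply/measurable_EFinP/measurable_indic; exact: measurable_band.
rewrite -[band rho in RHS]setIT.
rewrite -integral_indic//; last exact: measurable_band.
rewrite -[RHS](ge0_integral_preserving (preserving_space_timeD (- X)) mi)//.
Qed.

Lemma integrable_band_left rho (g : Z -> R) : 0 < rho ->
  mu.-integrable setT (EFin \o g) ->
  doubled.-integrable setT
    (EFin \o (fun p : Z * Z => g p.1 * \1_(band rho) (p.2 - p.1))).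
Proof.
move=> r0 gi; have mg := integrable_measurable gi.
have mF : measurable_fun setT
    (fun p : Z * Z => g p.1 * \1_(band rho) (p.2 - p.1)).
  apply: measurable_funM; last exact: measurable_band_indic.
  exact: measurableT_comp mg _.
apply/(integrable12ltyP mu mu); first exact/measurable_EFinP.
have E X : (\int[mu]_Y
    `|(EFin \o (fun p : Z * Z => g p.1 * \1_(band rho) (p.2 - p.1))%R) (X, Y)| =
    `|g X|%:E * ((2 * rho) ^+ d.+1)%:E)%E.
  rewrite -(integral_band_right X r0) -ge0_integralZl//.
  - by apply: eq_integral => Y _; rewrite /= normrM (ger0_norm (_ : 0 <= \1_(band rho) (Y - X))).
  - apply/measurable_EFinP.
    exact: (measurableT_comp (measurable_band_indic rho) (pair1_measurable X)).
under eq_integral => X _ do rewrite E.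
rewrite ge0_integralZr//; first last.
- by rewrite lee_fin exprn_ge0// mulr_ge0// ltW.
- by apply/measurable_EFinP; exact: measurableT_comp mg.
have [_ g1] := integrableP _ _ _ gi.
apply: lte_mul_pinfty => //; last by rewrite ltry.
- exact: integral_ge0.
- by rewrite ge0_fin_numE//; exact: integral_ge0.
Qed.

Lemma integrable_band_right rho (g : Z -> R) : 0 < rho ->
  mu.-integrable setT (EFin \o g) ->
  doubled.-integrable setT
    (EFin \o (fun p : Z * Z => g p.2 * \1_(band rho) (p.2 - p.1))).
Proof.
move=> r0 gi; have mg := integrable_measurable gi.
have mF : measurable_fun setT
    (fun p : Z * Z => g p.2 * \1_(band rho) (p.2 - p.1)).
  apply: measurable_funM; last exact: measurable_band_indic.
  exact: measurableT_comp mg _.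
apply/(integrable21ltyP mu mu); first exact/measurable_EFinP.
have E Y : (\int[mu]_X
    `|(EFin \o (fun p : Z * Z => g p.2 * \1_(band rho) (p.2 - p.1))%R) (X, Y)| =
    `|g Y|%:E * ((2 * rho) ^+ d.+1)%:E)%E.
  rewrite -(integral_band_left Y r0) -ge0_integralZl//.
  - by apply: eq_integral => X _; rewrite /= normrM (ger0_norm (_ : 0 <= \1_(band rho) (Y - X))).
  - apply/measurable_EFinP.
    exact: (measurableT_comp (measurable_band_indic rho) (pair2_measurable Y)).
under eq_integral => X _ do rewrite E.
rewrite ge0_integralZr//; first last.
- by rewrite lee_fin exprn_ge0// mulr_ge0// ltW.
- by apply/measurable_EFinP; exact: measurableT_comp mg.
have [_ g1] := integrableP _ _ _ gi.
apply: lte_mul_pinfty => //; last by rewrite ltry.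
- exact: integral_ge0.
- by rewrite ge0_fin_numE//; exact: integral_ge0.
Qed.

(** A function of one point alone is not integrable over the doubled space, but a bounded weight
    supported near the diagonal makes it so: the other point then ranges over a set of fixed finite
    measure. *)
Lemma integrable_weighted rho (C : R) (g g' : Z -> R) (F w : Z * Z -> R) :
  0 < rho -> mu.-integrable setT (EFin \o g) ->
  mu.-integrable setT (EFin \o g') ->
  measurable_fun setT F -> (forall p, `|F p| <= g p.1 + g' p.2) ->
  measurable_fun setT w -> (forall p, `|w p| <= C) ->
  (forall p, ~ band rho (p.2 - p.1) -> w p = 0) ->
  doubled.-integrable setT (EFin \o (fun p => F p * w p)).
Proof.
move=> r0 gi gi' mF Fg mw wC w0.
have i1 := integrable_band_left r0 (integrable_mull C gi).
have i2 := integrable_band_right r0 (integrable_mull C gi').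
apply: (integrable_le _ _ (integrable_add i1 i2)).
  exact: measurable_funM.
move=> p /=; rewrite -mulrDl -mulrDr indicE.
have [|] := boolP (p.2 - p.1 \in band rho).
  by move=> _; rewrite mulr1 mulrC normrM ler_pM.
by rewrite notin_setE => /w0 ->; rewrite !mulr0 normr0.
Qed.

End near_diagonal.

(** * Consequences of the Lipschitz condition *)

Section lipschitz_facts.
Context (R : realType).

Lemma lipschitz_bound (W : normedModType R) (f : R -> W) : lipschitz f ->
  exists2 L : R, 0 <= L & forall x y, `|f x - f y| <= L * `|x - y|.
Proof.
(* The hypothesis gives the bound for constants strictly above M, hence M + 1; the maximum with 0
   makes the constant nonnegative. *)
move=> [M [_ HM]]; exists (Num.max 0 (M + 1)); first by rewrite le_max lexx.
move=> x y; have M1 : M < M + 1 by rewrite ltrDl.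
apply: le_trans (HM _ M1 (x, y) _) _ => //=.
by rewrite ler_wpM2r// le_max lexx orbT.
Qed.

Lemma rV_coord_le_norm n (x : 'rV[R]_n) i : `|x ord0 i| <= `|x|.
Proof.
rewrite -[leRHS]/(mx_norm x) mx_normrE.
exact: (le_bigmax _ _ (ord0, i)).
Qed.

Lemma continuous_of_bound (f : R -> R) (L : R) : 0 <= L ->
  (forall x y, `|f x - f y| <= L * `|x - y|) -> continuous f.
Proof.
move=> L0 fL x; apply/cvgrPdist_le => e e0; near=> y.
apply: le_trans (fL x y) _.
apply: (@le_trans _ _ ((L + 1) * `|x - y|)).
  by rewrite ler_wpM2r// lerDl.
rewrite mulrC -ler_pdivlMr; last by rewrite ltr_wpDl.
near: y; apply: cvgr_dist_le; first exact: cvg_id.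
by rewrite divr_gt0// ltr_wpDl.
Unshelve. all: by end_near. Qed.

End lipschitz_facts.

(** * Solutions extended by zero to all of space-time *)

Section extension.
Context (R : realType) (d : nat) (T : R).
Local Notation Z := ('rV[R]_d * measurableTypeR R)%type.
Local Notation leb := (lebesgue_rV R d).
Local Notation mu := (space_time R d).

(** On all of space-time the shifted and doubled integrals have no boundary. The value 0 is also
    taken at times 0 and T; the weights used later vanish near both. *)
Definition extension (u : 'rV[R]_d -> R -> R) : Z -> R :=
  (fun p => u p.1 p.2) \_ (QT T).

Lemma extensionE u x t : 0 < t < T -> extension u (x, t) = u x t.
Proof. by move=> tT; rewrite /extension patchE mem_set. Qed.

Lemma extension_out u x t : ~~ (0 < t < T) -> extension u (x, t) = 0.
Proof. by move=> /negP tT; rewrite /extension patchE memNset. Qed.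

Context (lam c : R) (f : R -> 'rV[R]_d) (A : R -> R) (u0 : 'rV[R]_d -> R)
  (u : 'rV[R]_d -> R -> R) (sol : entropy_solution T lam c f A u0 u).

Lemma measurable_extension : measurable_fun setT (extension u).
Proof. by have := es_Linfty sol; rewrite inE => /andP[]; rewrite inE. Qed.

Lemma slice_L1 t : 0 <= t <= T -> leb.-integrable setT (EFin \o u ^~ t).
Proof. by move=> tT; apply/Lfun1_integrable; exact: es_L1 sol _ tT. Qed.

Lemma measurable_slice t : 0 <= t <= T -> measurable_fun setT (u ^~ t).
Proof. by move=> tT; exact: integrable_measurable (slice_L1 tT). Qed.

Lemma time_continuity t (e : R) : 0 <= t <= T -> 0 < e ->
  exists2 del : R, 0 < del & forall s, 0 <= s <= T -> `|s - t| < del ->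
    (\int[leb]_x `|u x s - u x t|%:E <= e%:E)%E.
Proof.
move=> tT e0; have := es_cont sol tT.
move=> /fine_cvgP[fin /cvgrPdist_le/(_ e e0) H].
have /nbhs_ballP[del /= del0 Hdel] : nbhs t
    (fun s => `[0, T]%classic s ->
      'N[leb]_1[EFin \o (u ^~ s \- u ^~ t)%R]%E \is a fin_num /\
      `|0 - fine 'N[leb]_1[EFin \o (u ^~ s \- u ^~ t)%R]%E| <= e).
  apply: (@filterS2 _ (nbhs t) _ _ _ _ _ fin H) => s fs Hs sT.
  by split; [exact: fs|exact: Hs].
exists del => // s sT st; have [||] := Hdel s.
- by rewrite /ball/= distrC.
- by rewrite /= in_itv/=.
move=> fins; rewrite /= sub0r normrN => le_e.
rewrite -[leLHS](_ : 'N[leb]_1[EFin \o (u ^~ s \- u ^~ t)%R]%E = _); last first.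
  by rewrite Lnorm1.
by rewrite -[leLHS]fineK// lee_fin (le_trans _ le_e)// ler_norm.
Qed.

Lemma slice_integral_fin t : 0 <= t <= T ->
  (\int[leb]_x `|u x t|%:E \is a fin_num)%E.
Proof.
by move=> tT; apply: integrable_fin_num => //; exact: integrable_norm (slice_L1 tT).
Qed.

(** The L^1 norm of a slice is continuous in time, hence bounded on the compact interval [0, T].
    Joint integrability of the extension follows from this bound. *)
Lemma slice_L1_bounded : exists2 C : R, 0 <= C & forall t, 0 <= t <= T ->
  (\int[leb]_x `|u x t|%:E <= C%:E)%E.
Proof.
pose N t := fine (\int[leb]_x `|u x t|%:E)%E.
have NE t : 0 <= t <= T -> (N t)%:E = (\int[leb]_x `|u x t|%:E)%E.
  by move=> tT; rewrite fineK//; exact: slice_integral_fin.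
have Ndist s t : 0 <= s <= T -> 0 <= t <= T ->
    ((N s)%:E <= (N t)%:E + \int[leb]_x `|u x s - u x t|%:E)%E.
  move=> sT tT; rewrite !NE// addeC -ge0_integralD//; first last.
  - by apply/measurable_EFinP; apply: measurableT_comp => //; exact: measurable_slice.
  - by apply: measurable_normB; exact: measurable_slice.
  apply: ge0_le_integral_pointwise => // x; rewrite lee_fin.
  by rewrite -{1}(subrK (u x t) (u x s)) ler_normD.
have cN : {within `[0, T], continuous N}.
  apply/subspace_continuousP => t; rewrite /= in_itv/= => tT.
  apply/cvgrPdist_le => e e0; have [del del0 H] := time_continuity tT e0.
  apply/nbhs_ballP; exists del => //= s st; rewrite /= in_itv/= => sT.
  have := H s sT; rewrite distrC => /(_ st) est.
  have I0 a b : (0 <= \int[leb]_x `|u x a - u x b|%:E)%E.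
    by apply: integral_ge0 => x _; rewrite lee_fin.
  have est' : (\int[leb]_x `|u x t - u x s|%:E <= e%:E)%E.
    by under eq_integral do rewrite distrC.
  rewrite ler_norml lerBrDr lerBlDr; apply/andP; split.
    rewrite addrC lerBlDr -lee_fin EFinD.
    by apply: le_trans (Ndist s t sT tT) _; rewrite leeD2l.
  rewrite addrC -lee_fin EFinD.
  by apply: le_trans (Ndist t s tT sT) _; rewrite leeD2l.
have [C [_ HC]] := compact_bounded
  (continuous_compact cN (@segment_compact R 0 T)).
exists (Num.max 0 (C + 1)); first by rewrite le_max lexx.
move=> t tT; rewrite -NE// lee_fin le_max.
apply/orP; right; apply: (le_trans (ler_norm _)).
apply: (HC (C + 1)); first by rewrite ltrDl.
by exists t => //; rewrite /= in_itv.
Qed.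

Lemma integrable_slice_extension t :
  leb.-integrable setT (EFin \o (fun x => extension u (x, t))).
Proof.
have [tT|tT] := boolP (0 < t < T).
  rewrite (_ : (fun x => _) = u ^~ t); last first.
    by apply/funext => x; rewrite extensionE.
  by apply: slice_L1; case/andP: tT => /ltW -> /ltW ->.
rewrite (_ : (fun x => _) = cst 0); first exact: integrable0.
by apply/funext => x; rewrite extension_out.
Qed.

Lemma integrable_extension : mu.-integrable setT (EFin \o extension u).
Proof.
have mE := measurable_extension.
have [C C0 HC] := slice_L1_bounded.
apply/(integrable21ltyP (lebesgue_rV R d) (@lebesgue_measure R)).
  exact/measurable_EFinP.
have H t : (\int[leb]_x `|(EFin \o extension u) (x, t)| <=
    C%:E * (\1_(`]0, T[%classic) t)%:E)%E.
  have [tT|tT] := boolP (0 < t < T).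
    rewrite indicE mem_set ?mule1; last by rewrite /= in_itv.
    under eq_integral do rewrite /= extensionE//.
    by apply: HC; case/andP: tT => /ltW -> /ltW ->.
  under eq_integral do rewrite /= extension_out// normr0.
  by rewrite integral0 mule_ge0 ?lee_fin.
have mi : measurable_fun setT (fun t : measurableTypeR R =>
    (\1_(`]0, T[%classic) t : R)%:E).
  by apply/measurable_EFinP/measurable_indic; exact: measurable_itv.
apply: (@le_lt_trans _ _ (\int[lebesgue_measure]_t
   (C%:E * (\1_(`]0%R, T[%classic) t)%:E))%E).
  apply: ge0_le_integral_pointwise => // t.
  by apply: integral_ge0.
have Ti : (lebesgue_measure `]0%R, T[%classic < +oo)%E.
  by rewrite lebesgue_measure_itv/=; case: ifP => _ /=; rewrite -?EFinB ltry.
have iT := integral_indic (@lebesgue_measure R) measurableT (measurable_itv `]0, T[).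
rewrite ge0_integralZl//.
by rewrite iT setIT; apply: lte_mul_pinfty.
Qed.

End extension.

(** * Near part of the operator on the test functions *)

Section mollifier_regularity.
Context (R : realType) (d : nat) (lam : R) (lam02 : 0 < lam < 2).
Context (del : R) (b : R -> R) (bb : bump del b).
Local Notation Rd := 'rV[R]_d.
Implicit Types (x z a : Rd).

(** These are the bounds that the estimate of the near part consumes. Stated with differences and
    not with derivatives, they pass to products by algebra alone, so the d-dimensional mollifier
    reduces to the bump on the line. *)
Definition regular (F : Rd -> R) := exists C, forall x z, [/\ `|F x| <= C,
  `|F (x + z) - F x| <= C * enorm z &
  `|F (x + z) + F (x - z) - 2 * F x| <= C * enorm z ^+ 2].

(** In the product rule for second differences, two products of first differences appear besides the
    two expected terms; each of the four is bounded by C D times the squared norm, whence the factor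
    4. *)
Lemma regularM (F G : Rd -> R) : regular F -> regular G ->
  regular (fun x => F x * G x).
Proof.
move=> [C HC] [D HD]; exists (4 * (C * D)) => x z.
have [F0 F1 F2] := HC x z; have [G0 G1 G2] := HD x z.
have [_ F1' _] := HC x (- z); have [_ G1' _] := HD x (- z).
have [Fz _ _] := HC (x + z) 0.
rewrite enormN in F1' G1'.
have n0 : 0 <= enorm z by exact: enorm_ge0.
have C0 := le_trans (normr_ge0 _) F0; have D0 := le_trans (normr_ge0 _) G0.
have CD0 : 0 <= C * D by exact: mulr_ge0.
have prod (p q P Q : R) : `|p| <= P -> `|q| <= Q -> `|p * q| <= P * Q.
  by move=> pP qQ; rewrite normrM ler_pM.
split.
- by apply: le_trans (prod _ _ _ _ F0 G0) _; lra.
- have -> : F (x + z) * G (x + z) - F x * G x =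
      F (x + z) * (G (x + z) - G x) + (F (x + z) - F x) * G x by ring.
  apply: le_trans (ler_normD _ _) _.
  have h1 := prod _ _ _ _ Fz G1; have h2 := prod _ _ _ _ F1 G0.
  have : 0 <= C * D * enorm z by exact: mulr_ge0.
  by move: h1 h2; rewrite (mulrA C) (mulrAC C _ D); lra.
- have -> : F (x + z) * G (x + z) + F (x - z) * G (x - z) - 2 * (F x * G x) =
      F x * (G (x + z) + G (x - z) - 2 * G x) +
      (F (x + z) + F (x - z) - 2 * F x) * G x +
      (F (x + z) - F x) * (G (x + z) - G x) +
      (F (x - z) - F x) * (G (x - z) - G x) by ring.
  have h1 := prod _ _ _ _ F0 G2; have h2 := prod _ _ _ _ F2 G0.
  have h3 := prod _ _ _ _ F1 G1; have h4 := prod _ _ _ _ F1' G1'.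
  apply: le_trans (ler_normD _ _) _.
  apply: le_trans (lerD (ler_normD _ _) (lexx _)) _.
  apply: le_trans (lerD (lerD (ler_normD _ _) (lexx _)) (lexx _)) _.
  apply: le_trans (lerD (lerD (lerD h1 h2) h3) h4) _.
  by rewrite le_eqVlt; apply/orP; left; apply/eqP; ring.
Qed.

Lemma regular_coord i : regular (fun x => b (x ord0 i)).
Proof.
have [C HC] := bump_regular bb; exists C => x z; rewrite !mxE.
have [h0 h1 h2] := HC (x ord0 i) (z ord0 i).
have C0 := le_trans (normr_ge0 _) h0.
have zi := coord_le_enorm z i.
split=> //; first by rewrite (le_trans h1)// ler_wpM2l.
rewrite (le_trans h2)// ler_wpM2l// -real_normK ?num_real//.
by rewrite ler_pXn2r// ?nnegrE ?enorm_ge0.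
Qed.

Lemma mollifier_regular : regular (mollifier b).
Proof.
rewrite /mollifier; elim: (index_enum _) => [|i s [C HC]].
  exists 1 => x z; rewrite !big_nil subrr normr0 normr1 mul1r enorm_ge0.
  by rewrite (_ : 1 + 1 - 2 * 1 = 0) ?normr0 ?mul1r ?sqr_ge0//; ring.
have [D HD] := regularM (regular_coord i) (ex_intro _ C HC).
by exists D => x z; rewrite !big_cons; exact: HD.
Qed.

Lemma measurable_bump_coord (h : R -> R) i : measurable_fun setT h ->
  measurable_fun setT (fun x : Rd => h (x ord0 i)).
Proof. by move=> mh; exact: measurableT_comp mh (measurable_rV_coord i). Qed.

Lemma measurable_mollifier : measurable_fun setT (@mollifier R d b).
Proof.
apply: measurable_prod => i _; apply: measurable_bump_coord.
exact: continuous_measurable_fun (bump_continuous bb).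
Qed.

Lemma measurable_grad_mollifier i :
  measurable_fun setT (fun x : Rd => grad_mollifier b x ord0 i).
Proof.
rewrite (_ : (fun x : Rd => _) = fun x : Rd =>
  derive1 b (x ord0 i) * \prod_(j < d | j != i) b (x ord0 j)); last first.
  by apply/funext => x; rewrite mxE.
apply: measurable_funM.
  apply: measurable_bump_coord.
  exact: continuous_measurable_fun (derive1_bump_continuous bb).
rewrite (_ : (fun x : Rd => _) = fun x : Rd =>
  \prod_(j < d) (if j != i then b (x ord0 j) else 1)); last first.
  by apply/funext => x; rewrite big_mkcond.
apply: measurable_prod => j _; have [ji|ji] := boolP (j != i); last exact: measurable_cst.
apply: measurable_bump_coord.
exact: continuous_measurable_fun (bump_continuous bb).
Qed.

(** [kap r] is a constant times r^(2 - lam), uniform in [a], [chi], x and t. The near part looks at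
    most r <= del away from a function supported in [box del], so its own support lies in the
    doubled cube. *)
Lemma g_small_tensor c : 0 <= c -> 0 < del -> exists kap : R -> R,
  [/\ forall r, 0 < r -> 0 <= kap r,
   forall e, 0 < e -> exists2 r, 0 < r <= del & kap r <= e &
   forall r a (chi : R -> R) x t, 0 < r <= del -> 0 <= chi t ->
    `|g_small lam c r (fun y => tensor b a chi (y, t)) x| <=
    kap r * (\1_(box (2 * del)) (x - a) * chi t)].
Proof.
move=> c0 d0; have [C1 HC1] := mollifier_regular.
have [C2 C20 HC2] := kern_second_moment_le d lam02.
have C10 : 0 <= C1.
  by have [h _ _] := HC1 0 0; exact: le_trans (normr_ge0 _) h.
pose kap r := c * (C1 * (C2 * r `^ (2 - lam))).
have kap0 r : 0 <= kap r by rewrite !mulr_ge0// powR_ge0.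
exists kap; split=> // [e e0|r a chi x t /andP[r0 rd] ct0].
  have l2 : 0 < 2 - lam by rewrite subr_gt0; case/andP: lam02.
  have := @powR_cvg0 R _ l2.
  (* The added 1 keeps the divisor positive even if the product is 0. *)
  pose K := c * (C1 * C2) + 1.
  have K0 : 0 < K by rewrite ltr_wpDl// !mulr_ge0.
  move=> /cvgrPdist_le /(_ (e / K)); rewrite divr_gt0// => /(_ isT) H.
  have [r [[r0 rd] Hr]] : exists r, (0 < r /\ r <= del) /\
      `|0 - r `^ (2 - lam)| <= e / K.
    near (0 : R)^'+ => r; exists r; split; first split => //.
    - by near: r; exact: nbhs_right_le.
    - by near: r.
  exists r; first by rewrite r0.
  move: Hr; rewrite sub0r normrN ger0_norm ?powR_ge0// ler_pdivlMr// => Hr.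
  apply: le_trans Hr; rewrite mulrC /kap !mulrA ler_wpM2r ?powR_ge0//.
  by rewrite /K -!mulrA lerDl.
have [xa|xa] := boolP (x - a \in box (2 * del)); last first.
  rewrite indicE (negbTE xa) mul0r mulr0 g_small_eq0 ?normr0// => z zr.
  have xz y : y - a \notin box del -> tensor b a chi (y, t) = 0.
    rewrite notin_setE => /existsNP[i /negP]; rewrite -ltNge => yi.
    by rewrite /tensor (mollifier_out bb yi) mul0r.
  rewrite !xz//; apply: contra xa; rewrite !inE => H i.
    by apply: le_trans (H i) _; lra.
  have := ler_normB ((x + z - a) ord0 i) (z ord0 i).
  rewrite (_ : (x + z - a) ord0 i - z ord0 i = (x - a) ord0 i); last first.
    by rewrite !mxE; ring.
  move=> /le_trans; apply; have := H i; have := coord_le_enorm z i.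
  by move: zr rd; lra.
rewrite indicE xa mul1r.
have -> : kap r * chi t = c * ((C1 * chi t) * (C2 * r `^ (2 - lam))).
  by rewrite /kap; ring.
apply: g_small_le => //.
- by rewrite mulr_ge0// powR_ge0.
- apply: measurable_funM; last exact: (@measurable_cst _ _ _ _ _ (chi t)).
  apply: (measurableT_comp measurable_mollifier).
  exact: (preserving_rVD (- a)).1.
- move=> y; rewrite /tensor/= normrM (ger0_norm ct0) ler_wpM2r//.
  by have [] := HC1 (y - a) 0.
- move=> z; rewrite /tensor/= (_ : _ - _ = (mollifier b ((x - a) + z) +
    mollifier b ((x - a) - z) - 2 * mollifier b (x - a)) * chi t).
    rewrite normrM (ger0_norm ct0) mulrAC ler_wpM2r//.
    by have [] := HC1 (x - a) z.
  by rewrite (addrAC x z) (addrAC x (- z)); ring.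
- exact: HC2.
Unshelve. all: by end_near. Qed.

End mollifier_regularity.

(** * Far part of the operator *)

Section far_jumps.
Context (R : realType) (d : nat) (lam c r : R) (lam02 : 0 < lam < 2).
Hypothesis r0 : 0 < r.
Local Notation Z := ('rV[R]_d * measurableTypeR R)%type.
Local Notation leb := (lebesgue_rV R d).
Local Notation mu := (space_time R d).
Implicit Types (p : Z -> R) (X : Z) (z : 'rV[R]_d).

Definition kern_far z : R := (r < enorm z)%R%:R * kern lam z.

Lemma kern_far_ge0 z : 0 <= kern_far z.
Proof. exact: mulr_ge0 (ler0n _ _) (kern_ge0 _ _). Qed.

Lemma kern_far_bound z : kern_far z <= (r `^ (d%:R + lam))^-1.
Proof.
rewrite /kern_far; have [rz|rz] := ltP r (enorm z); last first.
  by rewrite mul0r invr_ge0 powR_ge0.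
rewrite mul1r /kern lef_pV2 ?posrE ?powR_gt0//; last exact: lt_trans rz.
apply: ge0_ler_powR; rewrite ?nnegrE ?enorm_ge0 ?ltW//.
by rewrite ltr_wpDl//; case/andP: lam02.
Qed.

Definition space_shift z X : Z := X + (z, 0).

Lemma space_shiftE z X : space_shift z X = (X.1 + z, X.2).
Proof. by case: X => x t; congr pair; rewrite addr0. Qed.

Lemma preserving_space_shift z : preserving mu mu (space_shift z).
Proof. exact: preserving_space_timeD. Qed.

Lemma measurable_space_shift :
  measurable_fun setT (fun q : Z * 'rV[R]_d => space_shift q.2 q.1).
Proof.
apply/measurable_fun_pairP; split => /=.
  apply: measurable_fun_rVP => i.
  rewrite (_ : (fun q => _) = fun q : Z * 'rV[R]_d =>
    q.1.1 ord0 i + q.2 ord0 i); last first.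
    by apply/funext => q; rewrite !mxE.
  apply: measurable_funD.
    apply: (measurableT_comp (measurable_rV_coord i)).
    exact: (measurableT_comp measurable_fst measurable_fst).
  exact: (measurableT_comp (measurable_rV_coord i) measurable_snd).
apply: measurable_funD; last exact: measurable_cst.
exact: (measurableT_comp measurable_snd measurable_fst).
Qed.

Definition jump p X : R := g_large lam c r (fun y => p (y, X.2)) X.1.

Lemma jumpE p X : jump p X = c * levy_average leb space_shift kern_far p X.
Proof.
rewrite /jump /g_large levy_integralE; congr (_ * _).
apply: eq_Rintegral => z _; rewrite space_shiftE /kern_far.
rewrite -surjective_pairing mulrCA indicE; congr (_ * (_%:R * _)).
by congr nat_of_bool; apply/idP/idP; rewrite inE.
Qed.

Lemma integrable_jump p : mu.-integrable setT (EFin \o p) ->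
  mu.-integrable setT (EFin \o jump p).
Proof.
move=> ip; rewrite (_ : jump p = fun X => c * levy_average leb space_shift kern_far p X).
  apply: integrable_mull; apply: integrable_levy_average => //.
  - exact: preserving_space_shift.
  - exact: measurable_space_shift.
  - exact: integrable_far.
by apply/funext => X; exact: jumpE.
Qed.

(** This holds at every point X, since the slice is integrable and the truncated kernel is both
    bounded and integrable. The comparison of far terms can therefore be made pointwise, without an
    exceptional set. *)
Lemma integrable_jump_slice p X :
  leb.-integrable setT (EFin \o (fun y => p (y, X.2))) ->
  leb.-integrable setT
    (EFin \o (fun z => (p (space_shift z X) - p X) * kern_far z)).
Proof.
move=> ip; have ki := integrable_far d lam02 r0.
have mk := integrable_measurable ki.
have i1 : leb.-integrable setT (EFin \o (fun z => p (space_shift z X))).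
  rewrite (_ : (fun z => _) = (fun y => p (y, X.2)) \o (fun z => z + X.1)).
    exact: (integrable_preserving (preserving_rVD X.1) ip).
  by apply/funext => z /=; rewrite space_shiftE addrC.
have m1 := integrable_measurable i1.
have i2 := integrable_mull (r `^ (d%:R + lam))^-1 (integrable_norm i1).
have i3 := integrable_mull `|p X| ki.
apply: (integrable_le _ _ (integrable_add i2 i3)).
  by apply: measurable_funM => //; exact: measurable_funB.
move=> z; rewrite normrM (ger0_norm (kern_far_ge0 z)).
apply: le_trans (ler_wpM2r (kern_far_ge0 z) (ler_normB _ _)) _.
rewrite mulrDl; apply: lerD; last exact: lexx.
by rewrite mulrC ler_wpM2r// kern_far_bound.
Qed.

End far_jumps.

(** * The entropy inequality for product test functions *)

Section entropy_tensor.
Context (R : realType) (d : nat) (T lam c : R) (f : R -> 'rV[R]_d)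
  (A : R -> R) (u0 : 'rV[R]_d -> R) (u : 'rV[R]_d -> R -> R).
Hypothesis sol : entropy_solution T lam c f A u0 u.
Context (del : R) (b : R -> R) (bb : bump del b).
Local Notation Z := ('rV[R]_d * measurableTypeR R)%type.
Local Notation mu := (space_time R d).
Local Notation U := (extension T u).

(* [kap] bounds the singular part of the operator on the test function. *)
Definition entropy_majorant (r kap k : R) (a : 'rV[R]_d) (chi dchi : R -> R)
    (X : Z) : R :=
  `|U X - k| * (mollifier b (X.1 - a) * dchi X.2) +
  \sum_(i < d) entropy_flux f k (U X) ord0 i *
    (grad_mollifier b (X.1 - a) ord0 i * chi X.2) +
  `|A (U X) - A k| * (kap * (\1_(box (2 * del)) (X.1 - a) * chi X.2)) +
  (eta' k (U X) * jump lam c r (A \o U) X) * (mollifier b (X.1 - a) * chi X.2).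

Lemma entropy_tensor (r kap k al be : R) (a : 'rV[R]_d) (chi dchi : R -> R) :
  0 < r -> 0 < al -> be < T -> (forall n, smooth n chi) ->
  (forall t, 0 <= chi t) -> (forall t, is_derive t (1 : R) chi (dchi t)) ->
  (forall t, ~~ (al <= t <= be) -> chi t = 0 /\ dchi t = 0) ->
  (forall x t, `|g_small lam c r (fun y => tensor b a chi (y, t)) x| <=
    kap * (\1_(box (2 * del)) (x - a) * chi t)) ->
  (0 <= \int[mu]_X (entropy_majorant r kap k a chi dchi X)%:E)%E.
Proof.
move=> r0 al0 beT schi chi0 dchiE chi_out gle.
have tf : test_function T (tensor b a chi).
  by apply: (tensor_test_function bb) al0 beT schi _ => t /chi_out[].
have tp p : 0 <= tensor b a chi p.
  by rewrite mulr_ge0// (mollifier_ge0 bb).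
apply: le_trans (es_entropy sol k r0 tf tp) _.
(* Inside Q_T only the near term is estimated and the other three agree; outside, [chi] and [dchi]
   vanish. No measurability of the entropy density is required. *)
rewrite integral_mkcond; apply: le_integral_pointwise => -[x t].
rewrite patchE; case: ifPn => [|]; last first.
  rewrite notin_setE /QT/= => /negP tT.
  have [c1 c2] : chi t = 0 /\ dchi t = 0.
    apply: chi_out; apply: contra tT => /andP[alt tbe].
    by rewrite (lt_le_trans al0)// (le_lt_trans tbe).
  rewrite /entropy_majorant/= c1 c2 !mulr0 addr0 lee_fin add0r addr0.
  by rewrite big1// => i _; rewrite !mulr0.
rewrite inE /QT/= => tT; rewrite lee_fin /entropy_density /entropy_majorant/=.
rewrite extensionE// (dt_tensor b a x (dchiE t)) (grad_tensor bb).
have -> : dotv (entropy_flux f k (u x t)) (chi t *: grad_mollifier b (x - a)) =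
    \sum_(i < d) entropy_flux f k (u x t) ord0 i *
    (grad_mollifier b (x - a) ord0 i * chi t).
  by apply: eq_bigr => i _; congr (_ * _); rewrite [LHS]mxE [LHS]mulrC.
have -> : jump lam c r (A \o U) (x, t) = g_large lam c r (fun y => A (u y t)) x.
  rewrite /jump/=; congr (g_large _ _ _ _ _); apply/funext => y.
  by rewrite extensionE.
rewrite /eta [tensor _ _ _ _]/(mollifier b (x - a) * chi t) lerD2r lerD2l.
apply: ler_wpM2l; first exact: normr_ge0.
apply: le_trans (ler_norm _) _; exact: gle.
Qed.

End entropy_tensor.

(** * Weights on doubled space-time *)

Section weights.
Context (R : realType) (d : nat).
Local Notation Z := ('rV[R]_d * measurableTypeR R)%type.
Implicit Types (p : Z * Z).

(** The common shape of all weights of the doubled inequality: a factor in x - y, one in t - s and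
    one in t alone. Here [eta] is this last factor and not the entropy. *)
Definition weight (phi : 'rV[R]_d -> R) (rho eta : R -> R) p : R :=
  phi (p.1.1 - p.2.1) * (rho (p.1.2 - p.2.2) * eta p.1.2).

Definition bounded_measurable d' (S : measurableType d') (h : S -> R) :=
  measurable_fun setT h /\ exists C, forall x, `|h x| <= C.

Lemma measurable_weight phi rho eta : measurable_fun setT phi ->
  measurable_fun setT rho -> measurable_fun setT eta ->
  measurable_fun setT (weight phi rho eta).
Proof.
move=> mphi mrho meta.
have mo : measurable_fun setT (fun p : Z * Z => p.1 - p.2).
  have ms : measurable_fun setT (fun p : Z * Z => (p.2, p.1)).
    exact: measurable_fun_pair.
  exact: (measurableT_comp (@measurable_offset R d) ms).
apply: measurable_funM.
  apply: (measurableT_comp mphi).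
  exact: (measurableT_comp measurable_fst mo).
apply: measurable_funM.
  apply: (measurableT_comp mrho).
  exact: (measurableT_comp measurable_snd mo).
apply: (measurableT_comp meta).
exact: (measurableT_comp measurable_snd measurable_fst).
Qed.

Lemma integrable_weight (del : R) (g g' : Z -> R) (F : Z * Z -> R)
    (phi : 'rV[R]_d -> R) (rho eta : R -> R) :
  0 < del -> (space_time R d).-integrable setT (EFin \o g) ->
  (space_time R d).-integrable setT (EFin \o g') ->
  measurable_fun setT F -> (forall p, `|F p| <= g p.1 + g' p.2) ->
  bounded_measurable phi -> bounded_measurable (rho : measurableTypeR R -> R) ->
  bounded_measurable (eta : measurableTypeR R -> R) ->
  (forall x, ~ box del x -> phi x = 0) ->
  (forall t, del < `|t| -> rho t = 0) ->
  (doubled R d).-integrable setT (EFin \o (fun p => F p * weight phi rho eta p)).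
Proof.
move=> d0 gi gi' mF Fg [mphi [C1 H1]] [mrho [C2 H2]] [meta [C3 H3]] phi0 rho0.
apply: (integrable_weighted d0 gi gi' mF Fg (C := C1 * (C2 * C3))).
- exact: measurable_weight.
- by move=> p; rewrite /weight normrM ler_pM// normrM ler_pM.
- move=> p pb; rewrite /weight; have [xb|xb] := pselect (box del (p.1.1 - p.2.1)).
    rewrite rho0 ?mul0r ?mulr0//; rewrite ltNge; apply/negP => tb; apply: pb.
    split; last by rewrite /= distrC.
    by move=> i; have := xb i; rewrite !mxE distrC.
  by rewrite phi0 ?mul0r.
Qed.

Lemma measurable_sgr : measurable_fun setT (@Num.sg R : R -> R).
Proof.
rewrite (_ : (@Num.sg R : R -> R) = fun x => \1_(`]0, +oo[%classic) x - \1_(`]-oo, 0[%classic) x).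
  apply: measurable_funB; apply: measurable_indic; exact: measurable_itv.
apply/funext => x; rewrite !indicE.
have -> : x \in `]0, +oo[%classic = (0 < x).
  by apply/idP/idP; rewrite inE/= in_itv/= andbT.
have -> : x \in `]-oo, 0[%classic = (x < 0).
  by apply/idP/idP; rewrite inE/= in_itv/=.
have [x0|x0|->] := ltgtP x 0.
- by rewrite ltr0_sg// sub0r.
- by rewrite gtr0_sg// subr0.
- by rewrite sgr0 subrr.
Qed.

End weights.

(** * The time cutoff *)

Section cutoffs.
Context (R : realType) (del : R) (b : R -> R) (bb : bump del b).
Context (B : R -> R) (t1 t2 : R).
Hypothesis d0 : 0 < del.
Hypothesis dB : forall x, is_derive x (1 : R) B (b x).
Hypothesis Bmono : {homo B : x y / x <= y}.
Hypothesis Bleft : forall x y, x <= - del -> y <= - del -> B x = B y.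
Hypothesis Bright : forall x y, del <= x -> del <= y -> B x = B y.
Hypothesis t12 : t1 <= t2.

Definition theta t : R := B (t - t1) - B (t - t2).
Definition dtheta t : R := b (t - t1) - b (t - t2).

Lemma smooth_shift n (h : R -> R) (a : R) : smooth n h ->
  smooth n (fun t => h (t - a)).
Proof.
move=> sh; have := smooth_affine 1 (- a) sh.
by congr smooth; apply/funext => t; rewrite mul1r.
Qed.

Lemma is_derive_shift_sub (h : R -> R) (h' a t : R) :
  is_derive (t - a) (1 : R) h h' -> is_derive t (1 : R) (fun s => h (s - a)) h'.
Proof.
move=> dh; have d1 : is_derive t (1 : R) (fun s : R => s - a) 1.
  have -> : (fun s : R => s - a) = id - cst a by [].
  by apply: is_derive_eq; rewrite subr0.
by have := @is_derive1_comp R h (fun s => s - a) t _ _ dh d1; rewrite mulr1.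
Qed.

Lemma theta_ge0 t : 0 <= theta t.
Proof. by rewrite subr_ge0; apply: Bmono; rewrite lerD2l lerN2. Qed.

(** Out of this interval both arguments of B lie on the same flat side, so the two values cancel. *)
Lemma theta_out t : ~~ (t1 - del <= t <= t2 + del) ->
  theta t = 0 /\ dtheta t = 0.
Proof.
rewrite negb_and -!ltNge; move: t12 d0 => t12' d0'.
move=> /orP[tl|tr]; split; rewrite /theta /dtheta.
- by apply/eqP; rewrite subr_eq0; apply/eqP; apply: Bleft; lra.
- have h1 : del < `|t - t1| by rewrite ltr_normr; apply/orP; right; lra.
  have h2 : del < `|t - t2| by rewrite ltr_normr; apply/orP; right; lra.
  by rewrite (bump_support bb h1) (bump_support bb h2) subrr.
- by apply/eqP; rewrite subr_eq0; apply/eqP; apply: Bright; lra.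
- have h1 : del < `|t - t1| by rewrite ltr_normr; apply/orP; left; lra.
  have h2 : del < `|t - t2| by rewrite ltr_normr; apply/orP; left; lra.
  by rewrite (bump_support bb h1) (bump_support bb h2) subrr.
Qed.

Lemma smooth_theta n : smooth n theta.
Proof.
have sB : smooth n B.
  by apply: smoothW; exists b => //; exact: bump_smooth bb _.
rewrite (_ : theta = fun t => B (t - t1) + (cst (-1) t) * B (t - t2)).
  apply: smoothD; first exact: smooth_shift.
  by apply: smoothM; [exact: smooth_cst|exact: smooth_shift].
by apply/funext => t; rewrite /theta mulN1r.
Qed.

Lemma is_derive_theta t : is_derive t (1 : R) theta (dtheta t).
Proof. by apply: is_deriveB; exact: is_derive_shift_sub. Qed.

Lemma bounded_measurable_cont (h : R -> R) (M : R) : continuous h ->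
  (forall x, M < `|x| -> h x = 0) ->
  bounded_measurable (h : measurableTypeR R -> R).
Proof.
move=> ch hM; split; first exact: continuous_measurable_fun ch.
exact: bounded_of_support ch hM.
Qed.

Lemma theta_bounded_measurable :
  bounded_measurable (theta : measurableTypeR R -> R).
Proof.
apply: (@bounded_measurable_cont _ (`|t1| + `|t2| + del)) => [|t tM].
  exact: smooth1_continuous (smooth_theta 1).
have [|//] := theta_out (t := t); apply: contraTN tM => /andP[lo hi].
rewrite -leNgt ler_norml; have := ler_norm t2; have := lerNnormlW (lexx `|t1|).
have := normr_ge0 t1; have := normr_ge0 t2.
by move=> *; apply/andP; split; lra.
Qed.

Lemma dtheta_bounded_measurable :
  bounded_measurable (dtheta : measurableTypeR R -> R).
Proof.
have [C HC] := bump_bounded bb; split.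
  have cb := bump_continuous bb.
  apply: measurable_funB; apply: (measurableT_comp (continuous_measurable_fun cb));
  exact: measurable_funB.
exists (C + C) => t; apply: le_trans (ler_normB _ _) _; exact: lerD.
Qed.

End cutoffs.

(** * Bounds and supports of the factors of the weights *)

Section mollifier_bounds.
Context (R : realType) (d : nat) (del : R) (b : R -> R) (bb : bump del b).
Hypothesis d0 : 0 < del.
Implicit Types (x : 'rV[R]_d).

Lemma mollifier_bounded_measurable : bounded_measurable (@mollifier R d b).
Proof.
split; first exact: measurable_mollifier bb.
by have [C HC] := mollifier_regular d bb; exists C => x; have [] := HC x 0.
Qed.

Lemma grad_mollifier_bounded_measurable i :
  bounded_measurable (fun x => grad_mollifier b x ord0 i).
Proof.
split; first exact: measurable_grad_mollifier bb _.
have [C HC] := bump_bounded bb; have [D HD] := derive1_bump_bounded bb.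
exists (D * \prod_(j < d | j != i) C) => x; rewrite mxE normrM ler_pM//.
by rewrite normr_prod; apply: ler_prod => j _; rewrite normr_ge0 HC.
Qed.

Lemma box_bounded_measurable rho :
  bounded_measurable (\1_(@box R d rho) : 'rV[R]_d -> R).
Proof.
split; first by apply: measurable_indic; exact: measurable_box.
by exists 1 => x; rewrite ger0_norm// indicE; case: (_ \in _).
Qed.

Lemma bump_bounded_measurable : bounded_measurable (b : measurableTypeR R -> R).
Proof.
exact: bounded_measurable_cont (bump_continuous bb) (bump_support bb).
Qed.

Lemma derive1_bump_bounded_measurable :
  bounded_measurable (derive1 b : measurableTypeR R -> R).
Proof.
exact: bounded_measurable_cont (derive1_bump_continuous bb)
  (derive1_bump_support bb).
Qed.

(** All the weights are given one common radius, 2 * del, which is the one forced by the near part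
    of the operator. *)
Lemma mollifier_box x : ~ box (2 * del) x -> mollifier b x = 0.
Proof.
move=> /existsNP[i /negP]; rewrite -ltNge => xi.
by apply: (mollifier_out bb (i := i)); apply: le_lt_trans xi; have := d0; lra.
Qed.

Lemma grad_mollifier_box i x : ~ box (2 * del) x ->
  grad_mollifier b x ord0 i = 0.
Proof.
move=> /existsNP[j /negP]; rewrite -ltNge => xj.
have dj : del < `|x ord0 j| by apply: le_lt_trans xj; have := d0; lra.
rewrite mxE; have [->|ij] := eqVneq i j.
  by rewrite (derive1_bump_support bb dj) mul0r.
by rewrite (bigD1 j) 1?eq_sym//= (bump_support bb dj) mul0r mulr0.
Qed.

Lemma box_indic_box x : ~ box (2 * del) x -> \1_(box (2 * del)) x = 0 :> R.
Proof. by move=> xb; rewrite indicE memNset. Qed.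

Lemma bump_double t : 2 * del < `|t| -> b t = 0.
Proof. by move=> td; apply: (bump_support bb); apply: le_lt_trans td; have := d0; lra. Qed.

Lemma derive1_bump_double t : 2 * del < `|t| -> derive1 b t = 0.
Proof.
by move=> td; apply: (derive1_bump_support bb); apply: le_lt_trans td; have := d0; lra.
Qed.

End mollifier_bounds.

(** * Measurability and growth of the comparison integrands *)

Section comparison_integrands.
Context (R : realType) (d : nat).
Context (f : R -> 'rV[R]_d) (A : R -> R).
Local Notation Z := ('rV[R]_d * measurableTypeR R)%type.
Local Notation mu := (space_time R d).
Hypothesis (lf : lipschitz f) (lA : lipschitz A) (A0 : A 0 = 0).
Context (U V : Z -> R).
Hypothesis (iU : mu.-integrable setT (EFin \o U)).
Hypothesis (iV : mu.-integrable setT (EFin \o V)).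
Implicit Types (p : Z * Z).

Definition gap p : R := `|U p.1 - V p.2|.
Definition gap_sign p : R := Num.sg (U p.1 - V p.2).
Definition gapA p : R := `|A (U p.1) - A (V p.2)|.
Definition gap_flux i p : R := entropy_flux f (V p.2) (U p.1) ord0 i.

Let mU1 : measurable_fun setT (fun p : Z * Z => U p.1).
Proof. exact: measurableT_comp (integrable_measurable iU) _. Qed.

Let mV2 : measurable_fun setT (fun p : Z * Z => V p.2).
Proof. exact: measurableT_comp (integrable_measurable iV) _. Qed.

Lemma measurable_lipschitz_comp (h : R -> R) (L : R) d' (S : measurableType d')
    (g : S -> R) : 0 <= L -> (forall x y, `|h x - h y| <= L * `|x - y|) ->
  measurable_fun setT g -> measurable_fun setT (fun x => h (g x)).
Proof.
move=> L0 hL mg; apply: (measurableT_comp _ mg).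
exact: continuous_measurable_fun (continuous_of_bound L0 hL).
Qed.

Lemma integrable_lipschitz_comp d' (S : measurableType d')
    (nu : {measure set S -> \bar R}) (g : S -> R) :
  nu.-integrable setT (EFin \o g) -> nu.-integrable setT (EFin \o (A \o g)).
Proof.
move=> ig; have [L L0 AL] := lipschitz_bound lA.
apply: (integrable_le _ _ (integrable_mull L (integrable_norm ig))).
  exact: measurable_lipschitz_comp L0 AL (integrable_measurable ig).
by move=> x /=; have := AL (g x) 0; rewrite A0 !subr0.
Qed.

Lemma measurable_gap : measurable_fun setT gap.
Proof. by apply: measurableT_comp => //; exact: measurable_funB. Qed.

Lemma gap_le p : `|gap p| <= `|U p.1| + `|V p.2|.
Proof. by rewrite normr_id ler_normB. Qed.

Lemma measurable_gapA : measurable_fun setT gapA.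
Proof.
have [L L0 AL] := lipschitz_bound lA.
apply: measurableT_comp => //; apply: measurable_funB.
  exact: measurable_lipschitz_comp L0 AL mU1.
exact: measurable_lipschitz_comp L0 AL mV2.
Qed.

Lemma gapA_le : exists L, forall p, `|gapA p| <= L * `|U p.1| + L * `|V p.2|.
Proof.
have [L L0 AL] := lipschitz_bound lA; exists L => p.
rewrite normr_id -mulrDr (le_trans (AL _ _))// ler_wpM2l//.
exact: ler_normB.
Qed.

Lemma measurable_gap_sign : measurable_fun setT gap_sign.
Proof.
apply: (measurableT_comp (@measurable_sgr R)); exact: measurable_funB.
Qed.

Lemma gap_sign_le1 p : `|gap_sign p| <= 1.
Proof. by rewrite normr_sg; case: (_ == _). Qed.

Lemma measurable_gap_flux i : measurable_fun setT (gap_flux i).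
Proof.
have [L L0 fL] := lipschitz_bound lf.
have fiL x y : `|f x ord0 i - f y ord0 i| <= L * `|x - y|.
  apply: le_trans (fL x y); have := rV_coord_le_norm (f x - f y) i.
  by rewrite !mxE.
rewrite (_ : gap_flux i = fun p => gap_sign p *
    (f (U p.1) ord0 i - f (V p.2) ord0 i)).
  apply: measurable_funM; first exact: measurable_gap_sign.
  apply: measurable_funB.
    exact: (measurable_lipschitz_comp L0 fiL mU1).
  exact: (measurable_lipschitz_comp L0 fiL mV2).
by apply/funext => p; rewrite /gap_flux /entropy_flux !mxE.
Qed.

Lemma gap_flux_le i : exists L, forall p,
  `|gap_flux i p| <= L * `|U p.1| + L * `|V p.2|.
Proof.
have [L L0 fL] := lipschitz_bound lf; exists L => p.
rewrite /gap_flux /entropy_flux !mxE normrM.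
apply: (@le_trans _ _ (1 * `|f (U p.1) ord0 i - f (V p.2) ord0 i|)).
  by rewrite ler_wpM2r//; exact: gap_sign_le1.
rewrite mul1r -mulrDr; apply: (@le_trans _ _ `|f (U p.1) - f (V p.2)|).
  by have := rV_coord_le_norm (f (U p.1) - f (V p.2)) i; rewrite !mxE.
by rewrite (le_trans (fL _ _))// ler_wpM2l// ler_normB.
Qed.

End comparison_integrands.

(** * The far terms of two solutions compared *)

Section dissipation.
Context (R : realType) (d : nat) (lam c r : R) (lam02 : 0 < lam < 2).
Hypotheses (r0 : 0 < r) (c0 : 0 <= c).
Context (A : R -> R) (mA : {homo A : x y / x <= y}).
Local Notation Z := ('rV[R]_d * measurableTypeR R)%type.
Local Notation leb := (lebesgue_rV R d).
Local Notation mu := (space_time R d).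
Context (U V : Z -> R).
Context (phi : 'rV[R]_d -> R) (rho eta : R -> R).
Hypothesis w0 : forall p : Z * Z, 0 <= weight phi rho eta p.
Hypothesis iUs : forall t,
  leb.-integrable setT (EFin \o (fun y => (A \o U) (y, t))).
Hypothesis iVs : forall t,
  leb.-integrable setT (EFin \o (fun y => (A \o V) (y, t))).
Hypotheses (mAU : measurable_fun setT (A \o U))
  (mAV : measurable_fun setT (A \o V)).
Hypothesis iH : (doubled R d).-integrable setT
  (EFin \o (fun p => gapA A U V p * weight phi rho eta p)).
Implicit Types (p : Z * Z) (z : 'rV[R]_d).
Local Notation W := (weight phi rho eta).
Local Notation H := (fun p => gapA A U V p * W p).
Local Notation k := (@kern_far R d lam r).

Definition pair_shift z p : Z * Z := (space_shift z p.1, space_shift z p.2).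

Lemma weight_pair_shift z p : W (pair_shift z p) = W p.
Proof.
rewrite /weight /pair_shift !space_shiftE /=.
by congr (phi _ * _); rewrite opprD addrACA subrr addr0.
Qed.

Lemma preserving_pair_shift z :
  preserving (doubled R d) (doubled R d) (pair_shift z).
Proof.
exact: (preserving_prod (preserving_space_shift z) (preserving_space_shift z)).
Qed.

Lemma measurable_pair_shift :
  measurable_fun setT (fun q : (Z * Z) * 'rV[R]_d => pair_shift q.2 q.1).
Proof.
have ms := @measurable_space_shift R d.
have m1 : measurable_fun setT (fun q : (Z * Z) * 'rV[R]_d => (q.1.1, q.2)).
  apply: measurable_fun_pair; last exact: measurable_snd.
  exact: (measurableT_comp measurable_fst measurable_fst).
have m2 : measurable_fun setT (fun q : (Z * Z) * 'rV[R]_d => (q.1.2, q.2)).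
  apply: measurable_fun_pair; last exact: measurable_snd.
  exact: (measurableT_comp measurable_snd measurable_fst).
exact: (measurable_fun_pair (measurableT_comp ms m1) (measurableT_comp ms m2)).
Qed.

(** The monotonicity of A enters here: the sign of U - V is also a sign for A(U) - A(V), and where A
    is flat both sides are 0. *)
Lemma gap_sign_gapA p :
  gap_sign U V p * (A (U p.1) - A (V p.2)) = gapA A U V p.
Proof.
rewrite /gap_sign /gapA; have [UV|VU|->] := ltgtP (U p.1) (V p.2).
- rewrite ltr0_sg ?subr_lt0// mulN1r ler0_norm// subr_le0.
  exact: mA (ltW UV).
- rewrite gtr0_sg ?subr_gt0// mul1r ger0_norm// subr_ge0.
  exact: mA (ltW VU).
- by rewrite !subrr mulr0 normr0.
Qed.

Let aU X := integrable_jump_slice lam02 r0 (iUs X.2).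
Let aV X := integrable_jump_slice lam02 r0 (iVs X.2).

Lemma measurable_shifted_slice (g : Z -> R) X : measurable_fun setT g ->
  measurable_fun setT (fun z => g (space_shift z X)).
Proof.
move=> mg; apply: (measurableT_comp mg).
exact: (measurableT_comp (@measurable_space_shift R d) (pair1_measurable X)).
Qed.

(** The invariant weight factors out of the increment of H; the reverse triangle inequality bounds
    what remains by the increments of A(U) and A(V) at the two points. *)
Let integrable_H_slice p : leb.-integrable setT
  (EFin \o (fun z => (H (pair_shift z p) - H p) * k z)).
Proof.
have iu := integrable_norm (aU p.1); have iv := integrable_norm (aV p.2).
have := integrable_mull (W p) (integrable_add iu iv).
have mk : measurable_fun setT k.
  exact: integrable_measurable (integrable_far d lam02 r0).
apply: integrable_le.
  apply: measurable_funM => //; apply: measurable_funB; last exact: measurable_cst.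
  rewrite (_ : (fun z => _) = fun z => gapA A U V (pair_shift z p) * W p).
    apply: measurable_funM; last exact: measurable_cst.
    apply: (@measurableT_comp _ _ _ _ _ _ (@Num.norm R R)) => //.
    apply: measurable_funB.
      exact: (measurable_shifted_slice p.1 mAU).
    exact: (measurable_shifted_slice p.2 mAV).
  by apply/funext => z; rewrite weight_pair_shift.
move=> z; rewrite weight_pair_shift -mulrBl.
rewrite (mulrC _ (W p)) -mulrA normrM (ger0_norm (w0 p)).
apply: ler_wpM2l; first exact: w0.
rewrite /=; move: (k z) => kz; rewrite !normrM -mulrDl.
apply: ler_wpM2r; first exact: normr_ge0.
rewrite /gapA /pair_shift /=.
apply: le_trans (ler_dist_dist _ _) _.
rewrite (_ : _ - _ - _ = (A (U (space_shift z p.1)) - A (U p.1)) -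
  (A (V (space_shift z p.2)) - A (V p.2))); last by ring.
exact: ler_normB.
Qed.

(** Convexity of the absolute value: g acts as a subgradient at the base point. At the shifted
    points only |g| <= 1 is used, while g (x - y) is kept as it is, to be identified with |x - y| by
    [gap_sign_gapA]. *)
Let sign_increment_le (g w x x' y y' h : R) : `|g| <= 1 -> 0 <= w -> 0 <= h ->
  g * w * ((x' - x) * h - (y' - y) * h) <=
  (`|x' - y'| * w - g * (x - y) * w) * h.
Proof.
move=> g1 w_ge0 h0; rewrite -subr_ge0.
rewrite (_ : _ - _ = w * h * (`|x' - y'| - g * (x' - y'))); last by ring.
apply: mulr_ge0; first exact: mulr_ge0.
rewrite subr_ge0; apply: le_trans (ler_norm _) _.
by rewrite normrM ler_piMl.
Qed.

Lemma dissipation_pointwise p :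
  gap_sign U V p * (jump lam c r (A \o U) p.1 - jump lam c r (A \o V) p.2) *
    W p <= c * levy_average leb pair_shift k H p.
Proof.
have factor (g x y w : R) : g * (c * x - c * y) * w = c * (g * w * (x - y)).
  by ring.
rewrite !jumpE factor; apply: ler_wpM2l => //; rewrite /levy_average.
rewrite -(RintegralB measurableT (aU p.1) (aV p.2)).
rewrite -(RintegralZl (gap_sign U V p * W p) measurableT
  (integrable_sub (aU p.1) (aV p.2))).
apply: (le_Rintegral measurableT _ (integrable_H_slice p)).
  exact: integrable_mull (integrable_sub (aU p.1) (aV p.2)).
move=> z _.
rewrite weight_pair_shift -(gap_sign_gapA p).
exact: sign_increment_le (gap_sign_le1 U V p) (w0 p) (kern_far_ge0 _ _ z).
Qed.

Lemma integrable_dissipation_majorant : (doubled R d).-integrable setT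
  (EFin \o levy_average leb pair_shift k H).
Proof.
exact: (integrable_levy_average preserving_pair_shift measurable_pair_shift
  (integrable_far d lam02 r0) iH).
Qed.

Lemma integral_dissipation_majorant :
  \int[doubled R d]_p levy_average leb pair_shift k H p = 0.
Proof.
have E := integral_levy_average preserving_pair_shift measurable_pair_shift
  (integrable_far d lam02 r0) iH.
by rewrite /Rintegral E.
Qed.

End dissipation.

Lemma boxN (R : realType) d (rho : R) (x : 'rV[R]_d) :
  box rho (- x) = box rho x.
Proof.
by apply/propext; split => H i; have := H i; rewrite mxE normrN.
Qed.

(** * The doubled entropy inequality and the limit in r *)

Section kruzkov.
Context (R : realType) (d : nat) (T lam c : R) (f : R -> 'rV[R]_d) (A : R -> R)
  (u0 v0 : 'rV[R]_d -> R) (u v : 'rV[R]_d -> R -> R).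
Hypotheses (lam02 : 0 < lam < 2) (c0 : 0 < c) (lf : lipschitz f)
  (lA : lipschitz A) (mA : {homo A : x y / x <= y}) (A0 : A 0 = 0).
Hypothesis su : entropy_solution T lam c f A u0 u.
Hypothesis sv : entropy_solution T lam c f A v0 v.
Context (del : R) (b : R -> R) (bb : bump del b) (B : R -> R) (t1 t2 : R).
Hypothesis d0 : 0 < del.
Hypothesis dB : forall x, is_derive x (1 : R) B (b x).
Hypothesis Bmono : {homo B : x y / x <= y}.
Hypothesis Bleft : forall x y, x <= - del -> y <= - del -> B x = B y.
Hypothesis Bright : forall x y, del <= x -> del <= y -> B x = B y.
Hypothesis t12 : t1 <= t2.
Hypothesis (t1del : 2 * del < t1) (t2del : t2 + 2 * del < T).
Local Notation Z := ('rV[R]_d * measurableTypeR R)%type.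
Local Notation mu := (space_time R d).
Local Notation dbl := (doubled R d).
Local Notation U := (extension T u).
Local Notation V := (extension T v).
Local Notation th := (theta B t1 t2).
Local Notation dth := (dtheta b t1 t2).
Local Notation W1 := (@weight R d (mollifier b) (derive1 b) th).
Local Notation W2 := (@weight R d (mollifier b) b dth).
Local Notation G i := (@weight R d (fun x => grad_mollifier b x ord0 i) b th).
Local Notation W3 := (@weight R d \1_(box (2 * del)) b th).
Local Notation W := (@weight R d (mollifier b) b th).
Implicit Types (p : Z * Z).

Let iU := integrable_extension su.
Let iV := integrable_extension sv.
Let nU := integrable_norm iU.
Let nV := integrable_norm iV.
Let dd0 : 0 < 2 * del. Proof. exact: mulr_gt0. Qed.

Let bmw := mollifier_bounded_measurable d bb.
Let bmb := bump_bounded_measurable bb.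
Let bmd := derive1_bump_bounded_measurable bb.
Let bmth := theta_bounded_measurable bb d0 dB Bleft Bright t12.
Let bmdth := dtheta_bounded_measurable bb t1 t2.

Lemma integrable_gap_weight :
  dbl.-integrable setT (EFin \o (fun p => gap U V p * W2 p)).
Proof.
exact: (integrable_weight dd0 nU nV (measurable_gap iU iV) (gap_le U V)
  bmw bmb bmdth (mollifier_box bb d0) (bump_double bb d0)).
Qed.

Let iN1 : dbl.-integrable setT (EFin \o (fun p => gap U V p * W1 p)).
Proof.
exact: (integrable_weight dd0 nU nV (measurable_gap iU iV) (gap_le U V)
  bmw bmd bmth (mollifier_box bb d0) (derive1_bump_double bb d0)).
Qed.

Let iF i : dbl.-integrable setT (EFin \o (fun p => gap_flux f U V i p * G i p)).
Proof.
have [L HL] := gap_flux_le lf U V i.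
exact: (integrable_weight dd0 (integrable_mull L nU) (integrable_mull L nV)
  (measurable_gap_flux lf iU iV i) HL
  (grad_mollifier_bounded_measurable bb i) bmb bmth
  (grad_mollifier_box bb d0 i) (bump_double bb d0)).
Qed.

Let iA3 : dbl.-integrable setT (EFin \o (fun p => gapA A U V p * W3 p)).
Proof.
have [L HL] := gapA_le lA U V.
exact: (integrable_weight dd0 (integrable_mull L nU) (integrable_mull L nV)
  (measurable_gapA lA iU iV) HL (@box_bounded_measurable R d (2 * del)) bmb bmth
  (@box_indic_box R d del) (bump_double bb d0)).
Qed.

Let iAW : dbl.-integrable setT (EFin \o (fun p => gapA A U V p * W p)).
Proof.
have [L HL] := gapA_le lA U V.
exact: (integrable_weight dd0 (integrable_mull L nU) (integrable_mull L nV)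
  (measurable_gapA lA iU iV) HL bmw bmb bmth
  (mollifier_box bb d0) (bump_double bb d0)).
Qed.

Section fixed_radius.
Context (r kap : R).
Hypothesis r0 : 0 < r.
Hypothesis gle : forall (a : 'rV[R]_d) (chi : R -> R) x t, 0 <= chi t ->
  `|g_small lam c r (fun y => tensor b a chi (y, t)) x| <=
    kap * (\1_(box (2 * del)) (x - a) * chi t).
Local Notation JU := (jump lam c r (A \o U)).
Local Notation JV := (jump lam c r (A \o V)).

Let iAU := integrable_lipschitz_comp lA A0 iU.
Let iAV := integrable_lipschitz_comp lA A0 iV.
Let iJU := integrable_jump c lam02 r0 iAU.
Let iJV := integrable_jump c lam02 r0 iAV.

Let iSU : dbl.-integrable setT
  (EFin \o (fun p => (gap_sign U V p * JU p.1) * W p)).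
Proof.
apply: (integrable_weight dd0 (integrable_norm iJU) (integrable_norm iJV) _ _
  bmw bmb bmth (mollifier_box bb d0) (bump_double bb d0)).
  apply: measurable_funM; first exact: measurable_gap_sign.
  exact: measurableT_comp (integrable_measurable iJU) measurable_fst.
move=> p /=; apply: (@le_trans _ _ `|JU p.1|).
  by rewrite normrM; apply: ler_piMl => //; exact: gap_sign_le1.
by rewrite lerDl.
Qed.

Let iSV : dbl.-integrable setT
  (EFin \o (fun p => (gap_sign U V p * JV p.2) * W p)).
Proof.
apply: (integrable_weight dd0 (integrable_norm iJU) (integrable_norm iJV) _ _
  bmw bmb bmth (mollifier_box bb d0) (bump_double bb d0)).
  apply: measurable_funM; first exact: measurable_gap_sign.
  exact: measurableT_comp (integrable_measurable iJV) measurable_snd.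
move=> p /=; apply: (@le_trans _ _ `|JV p.2|).
  by rewrite normrM; apply: ler_piMl => //; exact: gap_sign_le1.
by rewrite lerDr.
Qed.

Let flux_sum p := \sum_(i < d) gap_flux f U V i p * G i p.

Let iflux : dbl.-integrable setT (EFin \o flux_sum).
Proof.
rewrite (_ : EFin \o flux_sum = fun p => \sum_(i < d)
  (gap_flux f U V i p * G i p)%:E)%E; last first.
  by apply/funext => p; rewrite sumEFin.
by apply: integrable_sum => // i _; exact: iF.
Qed.

Definition majorant_u p : R :=
  gap U V p * W1 p + gap U V p * W2 p + flux_sum p +
  kap * (gapA A U V p * W3 p) + (gap_sign U V p * JU p.1) * W p.

(** As theta depends on t alone, the derivative in s falls only on b(t - s): the term with [W2] has
    no counterpart here and survives the addition, while those with [W1] and the flux are opposite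
    to the ones in [majorant_u]. *)
Definition majorant_v p : R :=
  - (gap U V p * W1 p) - flux_sum p +
  kap * (gapA A U V p * W3 p) - (gap_sign U V p * JV p.2) * W p.

Let ikA3 := integrable_mull kap iA3.

Lemma integrable_majorant_u : dbl.-integrable setT (EFin \o majorant_u).
Proof.
exact: integrable_add (integrable_add (integrable_add
  (integrable_add iN1 integrable_gap_weight) iflux) ikA3) iSU.
Qed.

Lemma integrable_majorant_v : dbl.-integrable setT (EFin \o majorant_v).
Proof.
have iN := integrable_mull (-1) iN1.
have := integrable_sub (integrable_add (integrable_sub iN iflux) ikA3) iSV.
by congr (integrable _ _ _); apply/funext => p; rewrite /majorant_v /= mulN1r.
Qed.

Lemma majorant_uE p : entropy_majorant T lam c f A u del b r kap (V p.2) p.2.1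
    (fun t => b (t - p.2.2) * th t)
    (fun t => derive1 b (t - p.2.2) * th t + b (t - p.2.2) * dth t) p.1 =
  majorant_u p.
Proof.
rewrite /entropy_majorant /majorant_u; congr (_ + _ + _ + _).
  by rewrite -mulrDr /weight -mulrDr.
by rewrite mulrCA.
Qed.

(** The modulus and the entropy flux are symmetric in the solution and the level, whereas the
    derivatives of the even bump and the sign are odd. This produces the minus signs of
    [majorant_v]. *)
Lemma majorant_vE p : entropy_majorant T lam c f A v del b r kap (U p.1) p.1.1
    (fun s => b (s - p.1.2) * th p.1.2)
    (fun s => derive1 b (s - p.1.2) * th p.1.2) p.2 =
  majorant_v p.
Proof.
have yx : p.2.1 - p.1.1 = - (p.1.1 - p.2.1) by rewrite opprB.
have st : p.2.2 - p.1.2 = - (p.1.2 - p.2.2) by rewrite opprB.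
rewrite /entropy_majorant /majorant_v yx st (mollifierN bb) (bump_even bb).
rewrite (derive1_bumpN bb); congr (_ + _ + _ + _).
- by rewrite distrC /weight -mulrN -mulrN -mulNr.
- rewrite /flux_sum -sumrN; apply: eq_bigr => i _.
  have -> : grad_mollifier b (- (p.1.1 - p.2.1)) ord0 i =
      - grad_mollifier b (p.1.1 - p.2.1) ord0 i.
    by rewrite (grad_mollifierN bb) mxE.
  rewrite mulNr mulrN; congr (- (_ * _)).
  rewrite /gap_flux /entropy_flux !mxE /eta' -(opprB (U p.1)) sgrN.
  by rewrite mulNr -mulrN opprB.
- rewrite distrC mulrCA; congr (_ * (_ * (_ * _))).
  by rewrite !indicE; congr (nat_of_bool _)%:R; apply/idP/idP; rewrite !inE boxN.
- by rewrite /eta' -(opprB (U p.1)) sgrN !mulNr.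
Qed.

Lemma integral_majorant_u_ge0 : 0 <= \int[dbl]_p majorant_u p.
Proof.
apply: fine_ge0; have iE := integrable_majorant_u.
(* The second point is taken as the outer variable, so that the inner integral is the entropy
   inequality for u with the constant level [V Y]. *)
rewrite -(@integral21_prod_meas1 _ _ _ _ R mu mu _ iE).
apply: integral_ge0 => Y _; rewrite /fubini_G.
have t1' := t1del; have t2' := t2del; have dp := d0.
pose chi t := b (t - Y.2) * th t.
pose dchi t := derive1 b (t - Y.2) * th t + b (t - Y.2) * dth t.
have chi0 t : 0 <= chi t.
  by apply: mulr_ge0; [exact: bump_ge0 bb _|exact: theta_ge0].
have H := @entropy_tensor R d T lam c f A u0 u su del b bb r kap (V Y)
  (t1 - del) (t2 + del) Y.1 chi dchi r0.
under eq_integral => X _ do rewrite /= -majorant_uE.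
apply: H => //; first by lra.
- by lra.
- move=> n; apply: smoothM; last exact: (smooth_theta bb t1 t2 dB n).
  exact: smooth_shift (bump_smooth bb n).
- move=> t; have dc := is_deriveM (is_derive_shift_sub (bump_is_derive bb (t - Y.2)))
    (is_derive_theta t1 t2 dB t).
  apply: is_derive_eq; rewrite /dchi -![_ *: _]/(_ * _).
  by rewrite addrC [th t * _]mulrC.
- move=> t tout; have [e1 e2] := theta_out bb d0 Bleft Bright t12 tout.
  by rewrite /chi /dchi e1 e2 !mulr0 addr0.
by move=> x t; exact: gle.
Qed.

(** The factor theta is now a constant, so the cutoff in s is provided by b(s - t). It confines s to
    within del of the support of theta, which explains the margins 2 * del in the hypotheses on t1
    and t2. *)
Lemma integral_majorant_v_ge0 : 0 <= \int[dbl]_p majorant_v p.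
Proof.
apply: fine_ge0; have iE := integrable_majorant_v.
rewrite -(@integral12_prod_meas1 _ _ _ _ R mu mu _ iE).
apply: integral_ge0 => X _; rewrite /fubini_F.
have t1' := t1del; have t2' := t2del; have dp := d0; have t12' := t12.
pose chi s := b (s - X.2) * th X.2.
pose dchi s := derive1 b (s - X.2) * th X.2.
have chi0 s : 0 <= chi s.
  by apply: mulr_ge0; [exact: bump_ge0 bb _|exact: theta_ge0].
have H := @entropy_tensor R d T lam c f A v0 v sv del b bb r kap (U X)
  (t1 - 2 * del) (t2 + 2 * del) X.1 chi dchi r0.
under eq_integral => Y _ do rewrite /= -majorant_vE.
apply: H => //; first by lra.
- move=> n; apply: smoothM; last exact: smooth_cst.
  exact: smooth_shift (bump_smooth bb n).
- move=> s; have dc := is_deriveM (is_derive_shift_sub (bump_is_derive bb (s - X.2)))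
    (is_derive_cst (th X.2) s (1 : R)).
  apply: is_derive_eq; rewrite /dchi -![_ *: _]/(_ * _).
  by rewrite mulr0 add0r mulrC.
- move=> s sout; rewrite /chi /dchi.
  have [Xb|Xout] := boolP (t1 - del <= X.2 <= t2 + del); last first.
    have [-> _] := theta_out bb d0 Bleft Bright t12 Xout.
    by rewrite !mulr0.
  have sX : del < `|s - X.2|.
    rewrite ltNge; apply: contra sout; rewrite ler_norml.
    by case/andP: Xb => ? ? /andP[? ?]; apply/andP; split; lra.
  by rewrite (bump_support bb sX) (derive1_bump_support bb sX) !mul0r.
by move=> x s; exact: gle.
Qed.

Let sAU t := integrable_lipschitz_comp lA A0 (integrable_slice_extension su t).
Let sAV t := integrable_lipschitz_comp lA A0 (integrable_slice_extension sv t).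

Let W_ge0 p : 0 <= W p.
Proof.
apply: mulr_ge0; first exact: mollifier_ge0 bb _.
by apply: mulr_ge0; [exact: bump_ge0 bb _|exact: theta_ge0].
Qed.

Let dis p := @dissipation_pointwise R d lam c r lam02 r0 (ltW c0) A mA U V
  (mollifier b) b th W_ge0 sAU sAV (integrable_measurable iAU)
  (integrable_measurable iAV) p.
Let iD := integrable_dissipation_majorant lam02 r0 iAW.
Let intD := integral_dissipation_majorant lam02 r0 iAW.

Lemma kruzkov_fixed_radius : 0 <= \int[dbl]_p (gap U V p * W2 p) +
  2 * kap * \int[dbl]_p (gapA A U V p * W3 p).
Proof.
have iUV := integrable_add integrable_majorant_u integrable_majorant_v.
have icD := integrable_mull c iD; have i3 := integrable_mull (2 * kap) iA3.
have iS := integrable_add integrable_gap_weight (integrable_add i3 icD).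
have := addr_ge0 integral_majorant_u_ge0 integral_majorant_v_ge0.
rewrite -(RintegralD measurableT integrable_majorant_u integrable_majorant_v).
move=> /le_trans; apply; apply: le_trans (le_Rintegral measurableT iUV iS _) _.
  (* In the sum the [W1] and flux terms cancel, the near terms add up to the factor 2 * kap, and
     [dis] bounds the far terms. Once the products are abstracted, the inequality is linear. *)
  move=> p _; rewrite /majorant_u /majorant_v.
  have := dis p; move: (_ * levy_average _ _ _ _ _) => D.
  move: (gap U V p * W1 p) (gap U V p * W2 p) (flux_sum p) (gapA A U V p * W3 p).
  by move: (gap_sign U V p) (JU p.1) (JV p.2) (W p) => *; lra.
rewrite (RintegralD measurableT integrable_gap_weight (integrable_add i3 icD)).
rewrite (RintegralD measurableT i3 icD) (RintegralZl _ measurableT iD) intD.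
by rewrite mulr0 addr0 (RintegralZl _ measurableT iA3).
Qed.

End fixed_radius.

(** Neither integral depends on r. If I were negative, r could be chosen with kap r (|I3| + 1) <=
    -I/4, and the inequality at radius r would give 0 <= I/2. *)
Lemma kruzkov : 0 <= \int[dbl]_p (gap U V p * W2 p).
Proof.
have [kap [kap0 kap_small kapP]] := g_small_tensor d lam02 bb (ltW c0) d0.
set I := \int[dbl]_p (gap U V p * W2 p).
pose I3 := \int[dbl]_p (gapA A U V p * W3 p).
rewrite leNgt; apply/negP => I0.
have n0 : 0 < `|I3| + 1 by rewrite ltr_wpDl.
have e0 : 0 < - I / (4 * (`|I3| + 1)).
  by rewrite divr_gt0 ?oppr_gt0// mulr_gt0.
have [r /[dup] rd /andP[r0 _] kr] := kap_small _ e0.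
have gle (a : 'rV[R]_d) (chi : R -> R) x t : 0 <= chi t ->
    `|g_small lam c r (fun y => tensor b a chi (y, t)) x| <=
    kap r * (\1_(box (2 * del)) (x - a) * chi t).
  exact: kapP.
have := kruzkov_fixed_radius r0 gle; rewrite -/I -/I3 => H.
have h1 : kap r * I3 <= kap r * (`|I3| + 1).
  apply: ler_wpM2l; first exact: kap0.
  by rewrite (le_trans (ler_norm _))// lerDl.
have h2 : kap r * (`|I3| + 1) <= - I / 4.
  rewrite -ler_pdivlMr//; apply: le_trans kr _.
  by rewrite invfM mulrA.
by move: H; rewrite -mulrA; lra.
Qed.

End kruzkov.

(** * Masses of the bump and of the mollifier *)

Section masses.
Context (R : realType) (d : nat) (del : R) (b : R -> R) (bb : bump del b).
Hypothesis d0 : 0 < del.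
Local Notation Z := ('rV[R]_d * measurableTypeR R)%type.
Local Notation mu := (space_time R d).

Definition offset_weight (W : Z) : R := mollifier b W.1 * b W.2.

Lemma offset_weight_ge0 W : 0 <= offset_weight W.
Proof.
by apply: mulr_ge0; [exact: mollifier_ge0 bb _|exact: bump_ge0 bb _].
Qed.

Lemma measurable_offset_weight : measurable_fun setT offset_weight.
Proof.
apply: measurable_funM.
  exact: (measurableT_comp (measurable_mollifier bb) measurable_fst).
have mb := continuous_measurable_fun (bump_continuous bb).
exact: (measurableT_comp mb measurable_snd).
Qed.

Lemma offset_weight_out W : ~ band del W -> offset_weight W = 0.
Proof.
move=> Wb; rewrite /offset_weight.
have [W1|/existsNP[i /negP]] := pselect (box del W.1); last first.
  by rewrite -ltNge => Wi; rewrite (mollifier_out bb Wi) mul0r.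
rewrite (bump_support bb) ?mulr0// ltNge; apply/negP => W2.
by apply: Wb.
Qed.

(** Finite because the weight is bounded and supported in a band; positive because b is bounded
    below near 0, which bounds the weight below on a smaller band. *)
Lemma integral_offset_weight : exists2 m : R, 0 < m &
  (\int[mu]_W (offset_weight W)%:E = m%:E)%E.
Proof.
have [e e0 [a a0 ba]] := bump_lower_bound bb.
have [_ [C HC]] := mollifier_bounded_measurable d bb.
have [D HD] := bump_bounded bb.
have C0 := le_trans (normr_ge0 _) (HC 0).
have D0 := le_trans (normr_ge0 _) (HD 0).
have I0 : (0 <= \int[mu]_W (offset_weight W)%:E)%E.
  by apply: integral_ge0 => W _; rewrite lee_fin offset_weight_ge0.
have mi rho : measurable_fun setT (fun W => (\1_(band rho) W : R)%:E).
  by apply/measurable_EFinP/measurable_indic; exact: measurable_band.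
have Ib rho (k : R) : 0 < rho -> 0 <= k ->
    (\int[mu]_W (k * \1_(band rho) W)%:E = (k * (2 * rho) ^+ d.+1)%:E)%E.
  move=> rho0 k0; under eq_integral do rewrite EFinM.
  rewrite ge0_integralZl//; last by exact: mi.
  rewrite integral_indic//; last exact: measurable_band.
  by rewrite setIT [X in (_ * X)%E](space_time_band d rho0).
have le_up : (\int[mu]_W (offset_weight W)%:E <=
    (C * D * (2 * del) ^+ d.+1)%:E)%E.
  rewrite -Ib// ?mulr_ge0//; apply: ge0_le_integral_pointwise => W.
    by rewrite lee_fin offset_weight_ge0.
  rewrite lee_fin indicE; have [|] := boolP (W \in band del).
    move=> _; rewrite mulr1; apply: le_trans (ler_norm _) _.
    by rewrite normrM ler_pM.
  by rewrite notin_setE => /offset_weight_out ->; rewrite mulr0.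
have lo : ((a ^+ d * a * (2 * e) ^+ d.+1)%:E <=
    \int[mu]_W (offset_weight W)%:E)%E.
  have ad0 : 0 <= a ^+ d * a by rewrite mulr_ge0 ?exprn_ge0// ltW.
  rewrite -Ib//; apply: ge0_le_integral_pointwise => W.
    by rewrite lee_fin mulr_ge0.
  rewrite lee_fin indicE; have [|] := boolP (W \in band e); last first.
    by move=> _; rewrite mulr0 offset_weight_ge0.
  rewrite inE => -[W1 W2]; rewrite mulr1 ler_pM ?exprn_ge0 ?(ltW a0)//.
    rewrite /mollifier -[X in a ^+ X](card_ord d) -prodr_const.
    by apply: ler_prod => i _; rewrite (ltW a0) ba.
  exact: ba.
exists (fine (\int[mu]_W (offset_weight W)%:E)%E); last first.
  by rewrite fineK// ge0_fin_numE//; apply: le_lt_trans le_up _; rewrite ltry.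
apply: fine_gt0; apply/andP; split.
  apply: lt_le_trans lo; rewrite lte_fin.
  by apply: mulr_gt0; [apply: mulr_gt0 => //; exact: exprn_gt0|
    apply: exprn_gt0; exact: mulr_gt0].
by apply: le_lt_trans le_up _; rewrite ltry.
Qed.

Lemma integral_bump : exists2 m : R, 0 < m & forall t0 : R,
  (\int[lebesgue_measure]_t (b (t - t0))%:E = m%:E)%E.
Proof.
have ib := bump_integrable bb.
have [e e0 [a a0 ba]] := bump_lower_bound bb.
have mb := continuous_measurable_fun (bump_continuous bb).
have fin : (\int[lebesgue_measure]_t (b t)%:E \is a fin_num)%E.
  exact: integrable_fin_num ib.
have E t0 : (\int[lebesgue_measure]_t (b (t - t0))%:E =
    \int[lebesgue_measure]_t (b t)%:E)%E.
  by rewrite (integral_preserving (preserving_lebesgueD (- t0)) ib).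
have Ei : (@lebesgue_measure R) `[(- e)%R, e]%classic = (2 * e)%:E.
  rewrite lebesgue_measure_itv/= lte_fin ifT; last by lra.
  by rewrite -EFinB; congr EFin; lra.
have lo : ((a * (2 * e))%:E <= \int[lebesgue_measure]_t (b t)%:E)%E.
  have iT := integral_indic (@lebesgue_measure R) measurableT
    (measurable_itv `[(- e)%R, e]).
  rewrite EFinM -Ei -[X in lebesgue_measure X]setIT -iT.
  rewrite -ge0_integralZl//; last 2 first.
    by apply/measurable_EFinP/measurable_indic; exact: measurable_itv.
    by rewrite lee_fin ltW.
  apply: ge0_le_integral_pointwise => t.
    by rewrite -EFinM lee_fin mulr_ge0// ltW.
  rewrite -EFinM lee_fin indicE; have [|] := boolP (t \in _); last first.
    by move=> _; rewrite mulr0; exact: bump_ge0 bb _.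
  by rewrite inE/= in_itv/= -ler_norml mulr1 => /ba.
exists (fine (\int[lebesgue_measure]_t (b t)%:E)%E); last first.
  by move=> t0; rewrite E fineK.
apply: fine_gt0; apply/andP; split; last first.
  by move: fin; rewrite fin_numE ltey => /andP[].
by apply: lt_le_trans lo; rewrite lte_fin; apply: mulr_gt0 => //; exact: mulr_gt0.
Qed.

End masses.

(** * The doubled integral in terms of the offset of the two points *)

Section offset_coordinates.
Context (R : realType) (d : nat) (del : R) (b : R -> R) (bb : bump del b).
Local Notation Z := ('rV[R]_d * measurableTypeR R)%type.
Local Notation mu := (space_time R d).
Context (U V : Z -> R) (mU : measurable_fun setT U) (mV : measurable_fun setT V).
Context (t0 : R).
Local Open Scope ereal_scope.

Definition bump_at (t : R) : R := b (t - t0)%R.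

Let mb := continuous_measurable_fun (bump_continuous bb).

Lemma measurable_bump_at : measurable_fun setT bump_at.
Proof. exact: measurableT_comp mb (preserving_lebesgueD (- t0)).1. Qed.

Let offset_map (q : Z * Z) : Z * Z := (q.1, (q.2 + q.1)%R).

Let preserving_offset_map : preserving (doubled R d) (doubled R d) offset_map.
Proof.
have mN : measurable_fun setT (fun q : Z * Z => ((- q.1)%R, q.2)).
  apply: measurable_fun_pair; last exact: measurable_snd.
  exact: (measurableT_comp (preserving_space_timeN R d).1 measurable_fst).
have mg : measurable_fun setT (fun q : Z * Z => (q.2 + q.1)%R).
  have := measurableT_comp (@measurable_offset R d) mN.
  by congr measurable_fun; apply/funext => q /=; rewrite opprK.
exact: (@preserving_skew R _ _ _ _ Z Z Z Z mu mu mu mu id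
  (fun q : Z * Z => (q.2 + q.1)%R) (preserving_id mu) mg
  (fun X => preserving_space_timeD X)).
Qed.

(** The shear (X, W) to (X, W + X) makes the offset W = Y - X a coordinate. The weight then depends
    on W and t alone, so the innermost integral is an L^1 distance between a slice of U and a
    translated slice of V. *)
Lemma integral_gap_offset :
  \int[doubled R d]_p (gap U V p * weight (mollifier b) b bump_at p)%:E =
  \int[mu]_W \int[lebesgue_measure]_t \int[lebesgue_rV R d]_x
    (`|U (x, t) - V ((x, t) + W)| * (offset_weight b W * bump_at t))%:E.
Proof.
pose F p := (gap U V p * weight (mollifier b) b bump_at p)%R.
have mF : measurable_fun setT F.
  apply: measurable_funM.
    apply: measurableT_comp => //; apply: measurable_funB.
      exact: (measurableT_comp mU measurable_fst).
    exact: (measurableT_comp mV measurable_snd).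
  exact: (measurable_weight (measurable_mollifier bb) mb measurable_bump_at).
have F0 p : 0 <= (F p)%:E.
  rewrite lee_fin; apply: mulr_ge0; first exact: normr_ge0.
  rewrite /weight; apply: mulr_ge0; first exact: mollifier_ge0 bb _.
  by apply: mulr_ge0; exact: bump_ge0 bb _.
have mFE : measurable_fun setT (fun p => (F p)%:E) by exact/measurable_EFinP.
have mG := measurableT_comp mFE preserving_offset_map.1.
rewrite -(ge0_integral_preserving preserving_offset_map mFE F0).
rewrite (@fubini_tonelli2 _ _ _ _ _ mu mu _ mG (fun q => F0 (offset_map q))).
apply: eq_integral => W _; rewrite /fubini_G.
have mW : measurable_fun setT (fun X : Z => (F (offset_map (X, W)))%:E).
  exact: (measurableT_comp mG (pair2_measurable W)).
rewrite (@fubini_tonelli2 _ _ _ _ _ (lebesgue_rV R d) (@lebesgue_measure R)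
  _ mW (fun X => F0 (offset_map (X, W)))).
apply: eq_integral => t _; apply: eq_integral => x _.
congr EFin; rewrite /F /offset_map /gap /weight /offset_weight /=.
have -> : (x - (W.1 + x) = - W.1)%R by rewrite opprD addrCA subrr addr0.
have -> : (t - (W.2 + t) = - W.2)%R by rewrite opprD addrCA subrr addr0.
rewrite (mollifierN bb) (bump_even bb) mulrA [X in V X]addrC.
by rewrite -!mulrA.
Qed.

Lemma integral_weights (m1 m2 : R) :
  \int[mu]_W (offset_weight b W)%:E = m1%:E ->
  \int[lebesgue_measure]_t (bump_at t)%:E = m2%:E -> forall k : R, (0 <= k)%R ->
  \int[mu]_W \int[lebesgue_measure]_t
    (k * (offset_weight b W * bump_at t))%:E = (k * (m1 * m2))%:E.
Proof.
move=> E1 E2 k k0.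
have ow W := offset_weight_ge0 bb W.
have b0 t : (0 <= bump_at t)%R by exact: bump_ge0 bb _.
have m20 : (0 <= m2)%R.
  by rewrite -lee_fin -E2; apply: integral_ge0 => t _; rewrite lee_fin.
have E W : \int[lebesgue_measure]_t (k * (offset_weight b W * bump_at t))%:E =
    ((k * m2) * offset_weight b W)%:E.
  under eq_integral do rewrite mulrA EFinM.
  rewrite ge0_integralZl//; last 3 first.
  - by apply/measurable_EFinP; exact: measurable_bump_at.
  - by move=> t _; rewrite lee_fin.
  - by rewrite lee_fin mulr_ge0.
  by rewrite E2 -EFinM; congr EFin; ring.
under eq_integral do rewrite E EFinM.
rewrite ge0_integralZl//; last 3 first.
- by apply/measurable_EFinP; exact: measurable_offset_weight bb.
- by move=> W _; rewrite lee_fin.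
- by rewrite lee_fin mulr_ge0.
by rewrite E1 -EFinM; congr EFin; ring.
Qed.

Lemma integral_gap_le (N m1 m2 : R) : (0 <= N)%R ->
  \int[mu]_W (offset_weight b W)%:E = m1%:E ->
  \int[lebesgue_measure]_t (bump_at t)%:E = m2%:E ->
  (forall t W, (`|t - t0| <= del)%R -> band del W ->
    \int[lebesgue_rV R d]_x `|U (x, t) - V ((x, t) + W)|%:E <= N%:E) ->
  \int[doubled R d]_p (gap U V p * weight (mollifier b) b bump_at p)%:E <=
    (N * (m1 * m2))%:E.
Proof.
move=> N0 E1 E2 H; rewrite integral_gap_offset -(integral_weights E1 E2 N0).
have c0 W t : (0 <= offset_weight b W * bump_at t)%R.
  by apply: mulr_ge0; [exact: offset_weight_ge0 bb _|exact: bump_ge0 bb _].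
apply: ge0_le_integral_pointwise => W.
  apply: integral_ge0 => t _; apply: integral_ge0 => x _.
  by rewrite lee_fin mulr_ge0.
apply: ge0_le_integral_pointwise => t.
  by apply: integral_ge0 => x _; rewrite lee_fin mulr_ge0.
(* [H] speaks only of offsets and times in the support of the weight; elsewhere both sides are 0. *)
have [cW|cW] := eqVneq (offset_weight b W * bump_at t)%R 0%R.
  rewrite cW mulr0; under eq_integral do rewrite mulr0.
  by rewrite integral0.
have Wb : band del W.
  apply: contrapT => Wb; move/eqP: cW; apply.
  by rewrite (offset_weight_out bb Wb) mul0r.
have tb : (`|t - t0| <= del)%R.
  rewrite leNgt; apply/negP => tb; move/eqP: cW; apply.
  by rewrite /bump_at (bump_support bb tb) mulr0.
under eq_integral do rewrite mulrC EFinM.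
rewrite ge0_integralZl//; last 2 first.
- apply: measurable_normB.
    exact: (measurableT_comp mU (pair2_measurable t)).
  exact: (measurableT_comp mV (measurableT_comp (preserving_space_timeD W).1
    (pair2_measurable t))).
- by rewrite lee_fin.
rewrite [(N * _)%R]mulrC [X in _ <= X]EFinM lee_wpmul2l ?lee_fin//.
exact: H.
Qed.

Lemma integral_gap_ge (N m1 m2 : R) : (0 <= N)%R ->
  \int[mu]_W (offset_weight b W)%:E = m1%:E ->
  \int[lebesgue_measure]_t (bump_at t)%:E = m2%:E ->
  (forall t W, (`|t - t0| <= del)%R -> band del W ->
    N%:E <= \int[lebesgue_rV R d]_x `|U (x, t) - V ((x, t) + W)|%:E) ->
  (N * (m1 * m2))%:E <=
  \int[doubled R d]_p (gap U V p * weight (mollifier b) b bump_at p)%:E.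
Proof.
move=> N0 E1 E2 H; rewrite integral_gap_offset -(integral_weights E1 E2 N0).
have c0 W t : (0 <= offset_weight b W * bump_at t)%R.
  by apply: mulr_ge0; [exact: offset_weight_ge0 bb _|exact: bump_ge0 bb _].
apply: ge0_le_integral_pointwise => W.
  by apply: integral_ge0 => t _; rewrite lee_fin mulr_ge0.
apply: ge0_le_integral_pointwise => t; first by rewrite lee_fin mulr_ge0.
have [cW|cW] := eqVneq (offset_weight b W * bump_at t)%R 0%R.
  rewrite cW mulr0; apply: integral_ge0 => x _; by rewrite mulr0.
have Wb : band del W.
  apply: contrapT => Wb; move/eqP: cW; apply.
  by rewrite (offset_weight_out bb Wb) mul0r.
have tb : (`|t - t0| <= del)%R.
  rewrite leNgt; apply/negP => tb; move/eqP: cW; apply.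
  by rewrite /bump_at (bump_support bb tb) mulr0.
under eq_integral do rewrite mulrC EFinM.
rewrite ge0_integralZl//; last 2 first.
- apply: measurable_normB.
    exact: (measurableT_comp mU (pair2_measurable t)).
  exact: (measurableT_comp mV (measurableT_comp (preserving_space_timeD W).1
    (pair2_measurable t))).
- by rewrite lee_fin.
rewrite [X in X <= _](_ : _ =
  (offset_weight b W * bump_at t)%:E * N%:E); last by rewrite -EFinM mulrC.
by rewrite lee_wpmul2l ?lee_fin//; exact: H.
Qed.

End offset_coordinates.

(** * Perturbation of L^1 distances *)

Section L1_distance.
Context d (S : measurableType d) (R : realType) (mu : {measure set S -> \bar R}).
Local Open Scope ereal_scope.

Lemma L1distC (f g : S -> R) :
  \int[mu]_x `|f x - g x|%:E = \int[mu]_x `|g x - f x|%:E.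
Proof. by apply: eq_integral => x _; rewrite distrC. Qed.

Lemma L1dist_perturb (e e' : R) (f f' g g' : S -> R) :
  measurable_fun setT f -> measurable_fun setT f' ->
  measurable_fun setT g -> measurable_fun setT g' ->
  \int[mu]_x `|f x - f' x|%:E <= e%:E -> \int[mu]_x `|g x - g' x|%:E <= e'%:E ->
  \int[mu]_x `|f x - g x|%:E <= \int[mu]_x `|f' x - g' x|%:E + (e + e')%:E.
Proof.
move=> mf mf' mg mg' fe ge.
apply: (le_trans (L1dist_triangle mu mf mf' mg)).
rewrite EFinD [leRHS]addeCA; apply: leeD; first exact: fe.
apply: (le_trans (L1dist_triangle mu mf' mg' mg)).
by apply: leeD2l; rewrite L1distC.
Qed.

End L1_distance.

(** * Contraction between slices, down to the initial time *)

Section contraction.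
Context (R : realType) (d : nat) (T lam c : R) (f : R -> 'rV[R]_d) (A : R -> R)
  (u0 v0 : 'rV[R]_d -> R) (u v : 'rV[R]_d -> R -> R).
Hypotheses (lam02 : 0 < lam < 2) (c0 : 0 < c) (lf : lipschitz f)
  (lA : lipschitz A) (mA : {homo A : x y / x <= y}) (A0 : A 0 = 0).
Hypothesis su : entropy_solution T lam c f A u0 u.
Hypothesis sv : entropy_solution T lam c f A v0 v.
Local Notation leb := (lebesgue_rV R d).
Local Notation Z := ('rV[R]_d * measurableTypeR R)%type.
Local Notation U := (extension T u).
Local Notation V := (extension T v).

Definition slice_distance t : \bar R := (\int[leb]_x `|u x t - v x t|%:E)%E.

Lemma slice_distance_fin t : 0 <= t <= T -> exists2 n : R, 0 <= n &
  slice_distance t = n%:E.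
Proof.
move=> tT; have D0 : (0 <= slice_distance t)%E.
  by apply: integral_ge0 => x _; rewrite lee_fin.
have Dfin : slice_distance t \is a fin_num.
  apply: integrable_fin_num => //.
  exact: (integrable_norm (integrable_sub (slice_L1 su tT) (slice_L1 sv tT))).
by exists (fine (slice_distance t)); [exact: fine_ge0|rewrite fineK].
Qed.

(** Each of three moves costs e: u in time, v in time, and the translation of v in space. *)
Lemma slice_distance_offset t0 (e : R) : 0 < t0 < T -> 0 < e ->
  exists2 del : R, 0 < del & forall t (W : Z), `|t - t0| <= del -> band del W ->
  (\int[leb]_x `|U (x, t) - V ((x, t) + W)|%:E <=
    slice_distance t0 + (3 * e)%:E)%E /\
  (slice_distance t0 <=
    \int[leb]_x `|U (x, t) - V ((x, t) + W)|%:E + (3 * e)%:E)%E.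
Proof.
move=> t0T e0; have tT : 0 <= t0 <= T by case/andP: t0T => /ltW -> /ltW ->.
have [du du0 Hu] := time_continuity su tT e0.
have [dv dv0 Hv] := time_continuity sv tT e0.
have [dw dw0 Hw] := L1_translation_continuous (slice_L1 sv tT) e0.
pose m := Num.min (Num.min du dv) (Num.min t0 (T - t0)).
have m0 : 0 < m.
  by rewrite !lt_min du0 dv0/= subr_gt0.
(* With thirds, t and t + W.2 both stay within 2m/3 of t0, hence inside (0, T) and within the range
   of the time continuity of u and v. *)
exists (Num.min dw (m / 3)); first by rewrite lt_min dw0 divr_gt0.
have [mu_ [mv [mt mT]]] : m <= du /\ m <= dv /\ m <= t0 /\ m <= T - t0.
  by rewrite /m !ge_min !lexx !orbT.
move=> t W; rewrite le_min => /andP[_ tm] [W1 W2].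
have {}W1 i : `|W.1 ord0 i| <= dw by apply: le_trans (W1 i) _; rewrite ge_min lexx.
have {}W2 : `|W.2| <= m / 3 by apply: le_trans W2 _; rewrite ge_min lexx orbT.
pose s := t + W.2.
have sm : `|s - t0| <= 2 * (m / 3).
  rewrite /s -addrA [W.2 - t0]addrC addrA.
  by apply: le_trans (ler_normD _ _) _; lra.
have in_range r : `|r - t0| <= 2 * (m / 3) -> 0 < r < T.
  by rewrite ler_norml => /andP[? ?]; apply/andP; split; lra.
have weak r : 0 < r < T -> 0 <= r <= T by case/andP => /ltW -> /ltW ->.
have tr : 0 < t < T by apply: in_range; lra.
have sr : 0 < s < T by exact: in_range.
have E : (\int[leb]_x `|U (x, t) - V ((x, t) + W)|%:E =
    \int[leb]_x `|u x t - v (x + W.1) s|%:E)%E.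
  apply: eq_integral => x _; rewrite extensionE//.
  by have -> : V ((x, t) + W) = v (x + W.1) s by exact: extensionE sr.
rewrite E.
have mshift r : 0 <= r <= T -> measurable_fun setT (fun x : 'rV[R]_d => v (x + W.1) r).
  move=> rT; exact: measurableT_comp (measurable_slice sv rT) (preserving_rVD W.1).1.
have eu : (\int[leb]_x `|u x t - u x t0|%:E <= e%:E)%E.
  by apply: Hu; [exact: weak|lra].
have ev : (\int[leb]_x `|v (x + W.1) s - v x t0|%:E <= (e + e)%:E)%E.
  apply: le_trans (L1dist_triangle leb (mshift s (weak _ sr)) (mshift t0 tT)
    (measurable_slice sv tT)) _.
  rewrite EFinD; apply: leeD; last exact: Hw.
  have mst := measurable_normB (measurable_slice sv (weak _ sr))
    (measurable_slice sv tT).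
  rewrite (ge0_integral_preserving (preserving_rVD W.1) mst); last first.
    by move=> x; rewrite lee_fin.
  by apply: Hv; [exact: weak|lra].
have e3 : 3 * e = e + (e + e) by lra.
have m1 := measurable_slice su (weak _ tr).
have m2 := measurable_slice su tT.
have m3 := mshift s (weak _ sr).
have m4 := measurable_slice sv tT.
rewrite e3; split; first exact: L1dist_perturb m1 m2 m3 m4 eu ev.
rewrite L1distC in eu; rewrite L1distC in ev.
exact: L1dist_perturb m2 m1 m4 m3 eu ev.
Qed.

Lemma slice_distance_nonincreasing t1 t2 : 0 < t1 -> t1 <= t2 -> t2 < T ->
  (slice_distance t2 <= slice_distance t1)%E.
Proof.
move=> t10 t12 t2T.
have t1r : 0 < t1 < T by rewrite t10 (le_lt_trans t12).
have t2r : 0 < t2 < T by rewrite t2T (lt_le_trans t10).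
have weak r : 0 < r < T -> 0 <= r <= T by case/andP => /ltW -> /ltW ->.
have [n1 n10 E1] := slice_distance_fin (weak _ t1r).
have [n2 n20 E2] := slice_distance_fin (weak _ t2r).
rewrite E1 E2 lee_fin; apply/ler_addgt0Pr => e' e'0.
(* The comparison loses 3 * e at t1 and 3 * e at t2. *)
pose e := e' / 6; have e0 : 0 < e by rewrite divr_gt0.
have -> : e' = 6 * e by rewrite /e; lra.
have [D1 D10 H1] := slice_distance_offset t1r e0.
have [D2 D20 H2] := slice_distance_offset t2r e0.
rewrite E1 in H1; rewrite E2 in H2.
(* The thirds leave the margins 2 * del that [kruzkov] requires at both ends of (0, T). *)
pose del := Num.min (Num.min D1 D2) (Num.min (t1 / 3) ((T - t2) / 3)).
have d0 : 0 < del by rewrite !lt_min D10 D20 !divr_gt0// subr_gt0.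
have [dD1 [dD2 [dt1 dt2]]] : del <= D1 /\ del <= D2 /\ del <= t1 / 3 /\
    del <= (T - t2) / 3.
  by rewrite /del !ge_min !lexx !orbT.
have [b bb] := exists_bump d0.
have [B [dB Bmono Bleft Bright]] := bump_primitive bb.
have t1d : 2 * del < t1 by lra.
have t2d : t2 + 2 * del < T by lra.
have K := kruzkov lam02 c0 lf lA mA A0 su sv bb d0 dB Bmono Bleft Bright
  t12 t1d t2d.
have [m1 m10 M1] := integral_offset_weight d bb d0.
have [m2 m20 M2] := integral_bump bb.
have mm : 0 < m1 * m2 by exact: mulr_gt0.
have band_sub D (W : Z) : del <= D -> band del W -> band D W.
  move=> dD [Wx Wt]; split; last exact: le_trans dD.
  by move=> i; exact: le_trans dD.
pose k t0 p := gap U V p * weight (mollifier b) b (bump_at b t0) p.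
have ik t0 : (doubled R d).-integrable setT (EFin \o k t0).
  have iU := integrable_extension su; have iV := integrable_extension sv.
  have bt : bounded_measurable (bump_at b t0 : measurableTypeR R -> R).
    split; first exact: measurable_bump_at bb t0.
    by have [C HC] := bump_bounded bb; exists C => t; exact: HC.
  have dd0 : 0 < 2 * del by exact: mulr_gt0.
  exact: (integrable_weight dd0 (integrable_norm iU) (integrable_norm iV)
    (measurable_gap iU iV) (gap_le U V) (mollifier_bounded_measurable d bb)
    (bump_bounded_measurable bb) bt (mollifier_box bb d0) (bump_double bb d0)).
pose I t0 := \int[doubled R d]_p k t0 p.
have IE t0 : (\int[doubled R d]_p (k t0 p)%:E = (I t0)%:E)%E.
  by rewrite fineK//; exact: integrable_fin_num (ik t0).
have I21 : I t2 <= I t1.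
  rewrite -subr_ge0 -(RintegralB measurableT (ik t1) (ik t2)).
  move: K; congr (0 <= _); apply: eq_Rintegral => p _.
  by rewrite /k /weight /dtheta /bump_at; ring.
have mU := measurable_extension su; have mV := measurable_extension sv.
have up : I t1 <= (n1 + 3 * e) * (m1 * m2).
  rewrite -lee_fin -IE; apply: (integral_gap_le bb mU mV _ M1 (M2 t1)).
    by rewrite addr_ge0// mulr_ge0// ltW.
  move=> t W tt WW; rewrite EFinD.
  by have [] := H1 t W (le_trans tt dD1) (band_sub _ _ dD1 WW).
(* [integral_gap_ge] needs a nonnegative lower bound; if this one is negative, then n2 < 3 * e and
   the claim follows from n1 >= 0. *)
have [small|big] := ltP (n2 - 3 * e) 0; first by lra.
have lo : (n2 - 3 * e) * (m1 * m2) <= I t2.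
  rewrite -lee_fin -IE; apply: (integral_gap_ge bb mU mV big M1 (M2 t2)).
  move=> t W tt WW; rewrite EFinB leeBlDr//.
  by have [] := H2 t W (le_trans tt dD2) (band_sub _ _ dD2 WW).
have : n2 - 3 * e <= n1 + 3 * e.
  by rewrite -(ler_pM2r mm); apply: le_trans lo (le_trans I21 up).
by lra.
Qed.

Lemma slice_distance_initial t : 0 < t < T ->
  (slice_distance t <= slice_distance 0)%E.
Proof.
move=> tT; have t0 : 0 < t by case/andP: tT.
have T0 : (0 : R) <= 0 <= T.
  by case/andP: tT => _ tT; apply/andP; split=> //; exact: ltW (lt_trans t0 tT).
apply/lee_addgt0Pr => e e0.
have e20 : 0 < e / 2 by rewrite divr_gt0.
have [du du0 Hu] := time_continuity su T0 e20.
have [dv dv0 Hv] := time_continuity sv T0 e20.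
(* Halving makes s strictly smaller than both continuity radii; the minimum with t allows
   monotonicity from s to t. *)
pose s := Num.min t (Num.min du dv / 2).
have s0 : 0 < s by rewrite lt_min t0 divr_gt0// lt_min du0.
have [su_ sv_] : s < du /\ s < dv.
  have : s <= Num.min du dv / 2 by rewrite /s ge_min lexx orbT.
  have : Num.min du dv <= du by rewrite ge_min lexx.
  have : Num.min du dv <= dv by rewrite ge_min lexx orbT.
  by move: (Num.min du dv) => m *; split; lra.
have st : s <= t by rewrite /s ge_min lexx.
have sT : 0 <= s <= T by rewrite ltW//= (le_trans st)// ltW//; case/andP: tT.
apply: (@le_trans _ _ (slice_distance s)).
  by apply: slice_distance_nonincreasing => //; case/andP: tT.
rewrite [e in X in (_ <= X)%E](_ : e = e / 2 + e / 2); last by lra.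
have su' : `|s - 0| < du by rewrite subr0 ger0_norm// ltW.
have sv' : `|s - 0| < dv by rewrite subr0 ger0_norm// ltW.
exact: L1dist_perturb (measurable_slice su sT) (measurable_slice su T0)
  (measurable_slice sv sT) (measurable_slice sv T0)
  (Hu s sT su') (Hv s sT sv').
Qed.

(** [u0] and [v0] are not known to be measurable. The null set where they differ from the slices at
    time 0 is therefore removed on the left only, where the integrand is measurable, and what
    remains is compared pointwise. *)
Lemma slice_distance_initial_data : (0 <= T)%R ->
  (slice_distance 0 <= \int[leb]_x `|u0 x - v0 x|%:E)%E.
Proof.
move=> T0; have T00 : (0 : R) <= 0 <= T by apply/andP; split.
have [N [mN N0 HN]] := filterI (es_init su) (es_init sv).
have mD := measurable_normB (measurable_slice su T00) (measurable_slice sv T00).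
rewrite /slice_distance (ge0_negligible_integral mN measurableT mD) //.
rewrite setTD integral_mkcond; apply: ge0_le_integral_pointwise => x.
  by rewrite patchE; case: ifP => // _; rewrite lee_fin.
rewrite patchE; case: ifPn => [xN|_]; last by rewrite lee_fin.
suff [-> ->] : u x 0 = u0 x /\ v x 0 = v0 x by [].
by apply: contrapT => H; move: xN; rewrite inE; apply; exact: HN.
Qed.

End contraction.

Theorem theorem3p1 (R : realType) (d : nat) (T lambda c : R)
    (f : R -> 'rV[R]_d) (A : R -> R)
    (u0 v0 : 'rV[R]_d -> R) (u v : 'rV[R]_d -> R -> R) :
  (1 <= d)%N -> 0 < T -> 0 < lambda < 2 -> 0 < c ->
  lipschitz f -> lipschitz A -> {homo A : x y / x <= y} -> A 0 = 0 ->
  entropy_solution T lambda c f A u0 u ->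
  entropy_solution T lambda c f A v0 v ->
  forall t : R, 0 < t < T ->
    ('N[lebesgue_rV R d]_1[EFin \o (u ^~ t \- v ^~ t)%R] <=
     'N[lebesgue_rV R d]_1[EFin \o (u0 \- v0)%R])%E.
Proof.
move=> _ T0 lam02 c0 lf lA mA A0 su sv t tT; rewrite !Lnorm1 /=.
apply: le_trans (slice_distance_initial_data su sv (ltW T0)).
exact: slice_distance_initial lam02 c0 lf lA mA A0 su sv _ tT.
Qed.
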